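(* Let $\beta>0$ and let $-A$ be the generator of a polynomially stable $C_0$-semigroup $(e^{-tA})_{t\ge 0}$ with parameter $\beta$ on a Hilbert space $H$. Let $V(A) := (A-I)(A+I)^{-1}$. Then, for all $\alpha>0$, $$\|V(A)^n A^{-\alpha}\| = O\left(\frac{(\log n)^{k+1}}{n^{\alpha/(2+\beta)}}\right)\quad (n\to\infty),\qquad\text{where } k := \left\lfloor \frac{2\alpha}{2+\beta}\right\rfloor .$$
   Context: Hilbert spaces are complex. A $C_0$-semigroup $(e^{-tA})_{t\ge 0}$ with generator $-A$ is called polynomially stable with parameter $\beta>0$ if $\sup_{t\ge 0}\|e^{-tA}\|<\infty$ and $\|e^{-tA}(I+A)^{-1}\| = O(t^{-1/\beta})$ as $t\to\infty$. It is known that in this case $A$ has a bounded inverse ($0\in\varrho(A)$), so the bounded operators $A^{-\alpha}$, $\alpha>0$, are defined as fractional powers (via the sectorial functional calculus). The notation $f(n)=O(g(n))$ as $n\to\infty$ means that there are constants $M>0$ and $n_0$ with $f(n)\le M g(n)$ for all $n\ge n_0$ (similarly for a continuous variable $t$). For real $\xi$, $\lfloor \xi\rfloor := \max\{k\in\mathbb{Z}: k\le \xi\}$. *)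

(* Defs.v *)
From Stdlib Require Import Reals.
From Coquelicot Require Import Coquelicot.
Local Open Scope R_scope.

(* Coquelicot integrates functions with values in modules over R, so a complex
   Banach space has to be viewed as a real one: same carrier, same norm and
   same uniform structure. *)
Section Realify.
Variable V : CompleteNormedModule C_AbsRing.

Definition real_scal (r : R) (x : V) : V := scal (RtoC r : C_AbsRing) x.

Lemma real_scal_assoc (r s : R) (x : V) :
  real_scal r (real_scal s x) = real_scal (mult r s) x.
Proof.
unfold real_scal; rewrite scal_assoc; f_equal.
symmetry; exact (RtoC_mult r s).
Qed.

Lemma real_scal_one (x : V) : real_scal one x = x.
Proof. exact (scal_one x). Qed.

Lemma real_scal_distr_l (r : R) (x y : V) :
  real_scal r (plus x y) = plus (real_scal r x) (real_scal r y).
Proof. exact (scal_distr_l _ x y). Qed.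

Lemma real_scal_distr_r (r s : R) (x : V) :
  real_scal (plus r s) x = plus (real_scal r x) (real_scal s x).
Proof.
unfold real_scal.
transitivity (scal (plus (RtoC r : C_AbsRing) (RtoC s : C_AbsRing)) x).
- f_equal; exact (RtoC_plus r s).
- exact (scal_distr_r (RtoC r : C_AbsRing) (RtoC s : C_AbsRing) x).
Qed.

Definition real_ModuleSpace_mixin : ModuleSpace.mixin_of R_Ring V :=
  ModuleSpace.Mixin R_Ring V real_scal
    real_scal_assoc real_scal_one real_scal_distr_l real_scal_distr_r.

Definition real_NormedModuleAux_class : NormedModuleAux.class_of R_AbsRing V :=
  NormedModuleAux.Class R_AbsRing V
    (ModuleSpace.Class R_Ring V (AbelianGroup.class V) real_ModuleSpace_mixin)
    (UniformSpace.class V).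

Lemma real_norm_scal (r : R) (x : V) :
  norm (real_scal r x) <= abs r * norm x.
Proof.
unfold real_scal.
apply Rle_trans with (1 := norm_scal (RtoC r : C_AbsRing) x).
right; f_equal; exact (Cmod_R r).
Qed.

Definition real_NormedModule_mixin : NormedModule.mixin_of R_AbsRing
    (NormedModuleAux.Pack R_AbsRing V real_NormedModuleAux_class V) :=
  NormedModule.Mixin R_AbsRing
    (NormedModuleAux.Pack R_AbsRing V real_NormedModuleAux_class V)
    (fun x : V => norm x) (@norm_factor _ V)
    (@norm_triangle _ V) real_norm_scal
    (@norm_compat1 _ V) (@norm_compat2 _ V) (@norm_eq_zero _ V).

Definition realify : CompleteNormedModule R_AbsRing :=
  CompleteNormedModule.Pack R_AbsRing V
    (CompleteNormedModule.Class R_AbsRing V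
      (NormedModule.Class R_AbsRing V
        real_NormedModuleAux_class real_NormedModule_mixin)
      (CompleteSpace.mixin _ (CompleteSpace.class V))) V.

End Realify.

Definition polar (r theta : R) : C := (r * cos theta, r * sin theta).

(* The principal argument, with values in (-PI, PI), on C minus (-oo, 0]. *)
Definition Arg (z : C) : R := 2 * atan (Im z / (Cmod z + Re z)).

Definition Cpower (z : C) (a : R) : C := polar (Rpower (Cmod z) a) (a * Arg z).

Section Operators.
Context {H : CompleteNormedModule C_AbsRing}.

(* [H] is a Hilbert space when its norm is induced by an inner product;
   definiteness is that of the norm. *)
Record is_inner_product (inner : H -> H -> C) : Prop := {
  inner_plus_l : forall x y z,
    inner (plus x y) z = (inner x z + inner y z)%C;
  inner_scal_l : forall (c : C) x z,
    inner (scal (c : C_AbsRing) x) z = (c * inner x z)%C;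
  inner_conj : forall x y, inner y x = Cconj (inner x y);
  inner_norm : forall x, inner x x = RtoC (norm x ^ 2)
}.

Definition opnorm (B : H -> H) : Rbar :=
  Lub_Rbar (fun r => exists x, norm x <= 1 /\ r = norm (B x)).

(* An unbounded operator is identified with its graph: [A x y] means that [x]
   lies in the domain of [A] and that [A x = y]. *)
Definition operator := H -> H -> Prop.

Definition op_shift (A : operator) (c : C) : operator :=
  fun x y => A x (minus y (scal (c : C_AbsRing) x)).

Definition op_coshift (A : operator) (c : C) : operator :=
  fun x y => A x (minus (scal (c : C_AbsRing) x) y).

Definition op_inv (A : operator) : operator := fun x y => A y x.

Definition op_comp (A B : operator) : operator :=
  fun x z => exists y, B x y /\ A y z.

(* The function whose graph is [A]; meaningful when [A] is single-valued and
   everywhere defined. *)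
Definition op_fun (A : operator) (x : H) : H := iota (A x).

Definition resolvent (A : operator) (z : C) : H -> H :=
  op_fun (op_inv (op_coshift A z)).

Definition inv_one_plus (A : operator) : H -> H :=
  op_fun (op_inv (op_shift A 1%C)).

Definition cayley (A : operator) : H -> H :=
  op_fun (op_comp (op_shift A (-(1))%C) (op_inv (op_shift A 1%C))).

(* Only the values of [T] on [0, +oo) matter; [is_linear] includes
   boundedness. *)
Record is_C0_semigroup (T : R -> H -> H) : Prop := {
  C0_linear : forall t, 0 <= t -> is_linear (T t);
  C0_zero : forall x, T 0 x = x;
  C0_plus : forall s t x, 0 <= s -> 0 <= t -> T (s + t) x = T s (T t x);
  C0_cont : forall x, filterlim (fun t => T t x) (at_right 0) (locally x)
}.

Definition generator (T : R -> H -> H) : operator := fun x y =>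
  filterlim (fun t => scal (RtoC (/ t) : C_AbsRing) (minus (T t x) x))
    (at_right 0) (locally y).

Definition neg_generates (A : operator) (T : R -> H -> H) : Prop :=
  forall x y, A x y <-> generator T x (opp y).

Definition polynomially_stable (T : R -> H -> H) (A : operator) (beta : R) :
    Prop :=
  (exists M : R, forall t, 0 <= t -> Rbar_le (opnorm (T t)) (Finite M)) /\
  (exists M t0 : R, 0 < M /\ forall t, t0 <= t ->
     Rbar_le (opnorm (fun x => T t (inv_one_plus A x)))
       (Finite (M * Rpower t (- (1 / beta))))).

(* For bounded semigroups A is sectorial of angle at most PI/2.  The contour
   below is the boundary of the sector { |arg z| < 3 PI / 4 }, positively
   oriented; by Cauchy's theorem any angle in (PI/2, PI) gives the same
   operator for the functions g considered here. *)
Definition contour_angle : R := 3 * PI / 4.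

Definition ray_integral (A : operator) (g : C -> C) (theta : R) (x : H) : H :=
  RInt_gen (V := realify H)
    (fun r => scal ((g (polar r theta) * polar 1 theta)%C : C_AbsRing)
                (resolvent A (polar r theta) x))
    (at_right 0) (Rbar_locally p_infty).

(* g(A) x = 1 / (2 PI i) * (contour integral of g(z) (z - A)^{-1} x dz), for g
   holomorphic on larger sectors, with polynomial decay at 0 and at
   infinity. *)
Definition primary_calculus (A : operator) (g : C -> C) (x : H) : H :=
  scal ((/ (2 * PI * Ci))%C : C_AbsRing)
    (minus (ray_integral A g (- contour_angle) x)
           (ray_integral A g contour_angle x)).

(* A (I + A)^{-1}, the value at A of z / (1 + z) = 1 - 1 / (1 + z). *)
Definition regularizer (A : operator) : H -> H :=
  op_fun (op_comp A (op_inv (op_shift A 1%C))).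

(* f(A) = e(A)^{-1} (e f)(A), regularized by e(z) = (z / (1 + z))^m, for A
   injective; m must be large enough for e f to decay at 0. *)
Definition regularized_calculus (A : operator) (m : nat) (f : C -> C) :
    operator := fun x y =>
  Nat.iter m (regularizer A) y =
  primary_calculus A (fun z => (Cpow (z / (1 + z)) m * f z)%C) x.

(* A^{-alpha}, for alpha > 0 and A boundedly invertible.  The exponent
   m = up alpha > alpha makes z^(m - alpha) / (1 + z)^m decay at 0. *)
Definition neg_power (A : operator) (alpha : R) : H -> H :=
  op_fun (regularized_calculus A (Z.to_nat (up alpha))
            (fun z => Cpower z (- alpha))).

End Operators.

Arguments operator : clear implicits.

(* Main.v *)
(* Put V_xi = (A + xi - 1) (A + xi + 1)^{-1} and R_xi = (A + xi + 1)^{-1}, so that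
   V_0 = V(A) and V_xi = 1 - 2 R_xi.  For xi > 0 two energy identities play the
   roles of an observability and of a controllability estimate for the shifted
   semigroup e^{-xi t} T(t): the densities of the orbits of u and of V_xi u
   differ by -2 d/dt |e^{-xi t} T(t) R_xi u|^2, and the states reachable by inputs
   of bounded energy are stable under V_xi.  Summing over blocks of powers of V_xi
   they give
     |V_xi^n R_xi^b A^{-J} x| <= C (n xi)^{-b/2} xi^{J/beta} |x|  for large b,
   without any use of the adjoint semigroup or of Plancherel's theorem.
   Integrating d/dxi (V_xi^n R_xi^b) = 2 n V_xi^{n-1} R_xi^{b+2} - b V_xi^n R_xi^{b+1}
   with decreasing b, and choosing xi = n^{-beta/(2+beta)}, one gets
     |V(A)^n A^{-J} x| <= C N^{-J} |x| for J >= 2, with N = n^{1/(2+beta)},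
   and a factor log n for J = 0.  For fractional exponents, let
   B = A (N + A)^{-1}, so that B (1 + N A^{-1}) = 1.  By Cauchy's theorem
   (z^{-alpha})(A) B^J is the contour integral with symbol z^{-alpha} (z/(N+z))^J,
   of norm O(N^{-alpha}) if J >= alpha + 1; hence
     |V(A)^n A^{-alpha} x| <= C N^{-alpha} |(1 + N A^{-1})^J V(A)^n x|,
   and the last norm is at most C log n |x|. *)

Require Import Defs.
From Stdlib Require Import Reals ZArith Lra Lia ssreflect.
From Coquelicot Require Import Coquelicot.
Local Open Scope R_scope.

(** * Linear identities, norms and inner products *)

(** Orbits of a merely bounded semigroup need not have finite energy; this is the reason for the
    shift xi, and polynomial decay has to repay the powers of xi that it costs. An estimate with q +
    2 resolvents costs an energy with weight t^q, and this weight can absorb the squared decay t^(-2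
    J / beta) near t = 0 only if q >= 2 J / beta: hence the start from many resolvents and the
    descent to b = 0. A factor (eta / xi)^theta with a small theta > 0 is kept throughout the
    descent; it makes the last integral converge at the shift 0. The choice of xi balances xi^(J /
    beta) against (n xi)^(-J / 2), the bound found by regarding A^{-J} as J further resolvents. That
    bound takes at least two resolvents, whence J >= 2. For J = 0 the integrand 1 / xi produces the
    logarithm, and J = 1 is interpolated between 0 and 2. Only one logarithm arises, and log n <=
    (log n)^(k + 1) because k >= 0. Vector-valued mean value and Cauchy theorems are reduced to real
    functions by testing against the very difference that is to be estimated. *)

Section LinearCombinations.
Context {K : Ring} {V : ModuleSpace K}.

(** Syntax for reflection over an arbitrary ring, so that real and complex scalars share one tactic;
    the coefficient identities are left to [ring] and [field]. *)
Inductive lin_expr :=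
  | LVar (n : nat) | LZero | LPlus (a b : lin_expr) | LOpp (a : lin_expr)
  | LMinus (a b : lin_expr) | LScal (k : K) (a : lin_expr).

Fixpoint lin_eval (l : list V) (e : lin_expr) : V :=
  match e with
  | LVar n => List.nth n l zero
  | LZero => zero
  | LPlus a b => plus (lin_eval l a) (lin_eval l b)
  | LOpp a => opp (lin_eval l a)
  | LMinus a b => minus (lin_eval l a) (lin_eval l b)
  | LScal k a => scal k (lin_eval l a)
  end.

Fixpoint lin_coef (e : lin_expr) (i : nat) : K :=
  match e with
  | LVar n => if Nat.eqb n i then one else zero
  | LZero => zero
  | LPlus a b => plus (lin_coef a i) (lin_coef b i)
  | LOpp a => opp (lin_coef a i)
  | LMinus a b => plus (lin_coef a i) (opp (lin_coef b i))
  | LScal k a => mult k (lin_coef a i)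
  end.

Fixpoint lin_comb (l : list V) (c : nat -> K) : V :=
  match l with
  | nil => zero
  | cons x l => plus (scal (c O) x) (lin_comb l (fun n => c (S n)))
  end.

Fixpoint same_coefs (l : list V) (c d : nat -> K) : Prop :=
  match l with
  | nil => True
  | cons x l => c O = d O /\ same_coefs l (fun n => c (S n)) (fun n => d (S n))
  end.

Lemma plus_shuffle (a b c d : V) :
  plus (plus a b) (plus c d) = plus (plus a c) (plus b d).
Proof.
rewrite -!plus_assoc; congr (plus a _).
by rewrite !plus_assoc (plus_comm b).
Qed.

Lemma lin_comb_plus l : forall c d,
  lin_comb l (fun n => plus (c n) (d n)) = plus (lin_comb l c) (lin_comb l d).
Proof.
elim: l => [|x l IH] c d /=; first by rewrite plus_zero_l.
by rewrite IH scal_distr_r plus_shuffle.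
Qed.

Lemma lin_comb_scal l k : forall c,
  lin_comb l (fun n => mult k (c n)) = scal k (lin_comb l c).
Proof.
elim: l => [|x l IH] c /=; first by rewrite scal_zero_r.
by rewrite IH scal_distr_l scal_assoc.
Qed.

Lemma lin_comb_opp l : forall c,
  lin_comb l (fun n => opp (c n)) = opp (lin_comb l c).
Proof.
elim: l => [|x l IH] c /=; first by rewrite opp_zero.
by rewrite IH opp_plus scal_opp_l.
Qed.

Lemma lin_comb_zero l : lin_comb l (fun _ => zero) = zero.
Proof.
elim: l => [|x l IH] //=.
by rewrite IH scal_zero_l plus_zero_l.
Qed.

Lemma lin_comb_var l : forall n,
  lin_comb l (fun i => if Nat.eqb n i then one else zero) = List.nth n l zero.
Proof.
elim: l => [|x l IH] [|n] //=.
- by rewrite scal_one lin_comb_zero plus_zero_r.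
- by rewrite IH scal_zero_l plus_zero_l.
Qed.

Lemma lin_eval_comb l e : lin_eval l e = lin_comb l (lin_coef e).
Proof.
elim: e => [n||a Ha b Hb|a Ha|a Ha b Hb|k a Ha] /=.
- by rewrite lin_comb_var.
- by rewrite lin_comb_zero.
- by rewrite lin_comb_plus Ha Hb.
- by rewrite lin_comb_opp Ha.
- by rewrite (lin_comb_plus _ _ (fun n => opp _)) lin_comb_opp Ha Hb.
- by rewrite lin_comb_scal Ha.
Qed.

Lemma same_coefs_comb l : forall c d,
  same_coefs l c d -> lin_comb l c = lin_comb l d.
Proof.
elim: l => [|x l IH] c d //= [-> H].
by rewrite (IH _ _ H).
Qed.

Lemma lin_eval_eq l e f :
  same_coefs l (lin_coef e) (lin_coef f) -> lin_eval l e = lin_eval l f.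
Proof. by move=> H; rewrite !lin_eval_comb; apply: same_coefs_comb. Qed.

End LinearCombinations.

Ltac lin_index x l :=
  lazymatch l with
  | cons x _ => constr:(O)
  | cons _ ?l => let n := lin_index x l in constr:(S n)
  end.

Ltac lin_mem x l :=
  lazymatch l with
  | nil => constr:(false)
  | cons x _ => constr:(true)
  | cons _ ?l => lin_mem x l
  end.

Ltac lin_atoms l e :=
  lazymatch e with
  | plus ?a ?b => let l := lin_atoms l a in lin_atoms l b
  | minus ?a ?b => let l := lin_atoms l a in lin_atoms l b
  | opp ?a => lin_atoms l a
  | scal _ ?a => lin_atoms l a
  | zero => l
  | ?x => let b := lin_mem x l in
          lazymatch b with true => l | false => constr:(cons x l) end
  end.

Ltac lin_reify K l e :=
  lazymatch e with
  | plus ?a ?b =>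
      let a := lin_reify K l a in let b := lin_reify K l b in constr:(@LPlus K a b)
  | minus ?a ?b =>
      let a := lin_reify K l a in let b := lin_reify K l b in constr:(@LMinus K a b)
  | opp ?a => let a := lin_reify K l a in constr:(@LOpp K a)
  | scal ?k ?a => let a := lin_reify K l a in constr:(@LScal K k a)
  | zero => constr:(@LZero K)
  | ?x => let n := lin_index x l in constr:(@LVar K n)
  end.

(* Reduces an equation between linear combinations to the equality of the
   coefficients of each atom. *)
Ltac lin_eq_with K V :=
  lazymatch goal with
  | |- ?a = ?b =>
      let l := lin_atoms (@nil V) a in
      let l := lin_atoms l b in
      let e := lin_reify K l a in
      let f := lin_reify K l b in
      refine (@lin_eval_eq K V l e f _); simpl; repeat split
  end.

Ltac real_eq := match goal with |- ?a = ?b => change (@eq R a b) end.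

Ltac lin_real V :=
  lin_eq_with R_Ring V;
  rewrite /plus /mult /opp /one /zero /=; try (ring || field).

Lemma filter_and_imp {T : Type} {F : (T -> Prop) -> Prop} {FF : Filter F}
    {P Q S : T -> Prop} :
  F P -> F Q -> (forall x, P x -> Q x -> S x) -> F S.
Proof.
intros HP HQ H; generalize (filter_and _ _ HP HQ).
by apply filter_imp => x [H1 H2]; apply: H.
Qed.

Section LinearMaps.
Context {K : AbsRing} {V W : NormedModule K} (B : V -> W).
Hypothesis HB : is_linear B.

Lemma linear_opp x : B (opp x) = opp (B x).
Proof. by rewrite -(scal_opp_one x) (linear_scal _ HB) scal_opp_one. Qed.

Lemma linear_minus x y : B (minus x y) = minus (B x) (B y).
Proof. by rewrite /minus (linear_plus _ HB) linear_opp. Qed.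

Lemma linear_zero : B zero = zero.
Proof. by rewrite -(scal_zero_l zero) (linear_scal _ HB) scal_zero_l. Qed.
End LinearMaps.

Section NormedTools.
Context {V : NormedModule R_AbsRing}.

Lemma filterlim_norm_eps {T : Type} (F : (T -> Prop) -> Prop) {FF : Filter F}
    (f : T -> V) (y : V) :
  filterlim f F (locally y) <->
  (forall eps, 0 < eps -> F (fun x => norm (minus (f x) y) < eps)).
Proof.
split=> [H eps Heps|H].
- exact: (proj1 (filterlim_locally_ball_norm f y) H (mkposreal eps Heps)).
- apply (proj2 (filterlim_locally_ball_norm f y)) => eps.
  exact: (H eps (cond_pos eps)).
Qed.

Lemma is_derive_eps (f : R -> V) (x : R) (l : V) :
  is_derive f x l <->
  (forall eps, 0 < eps -> locally x (fun s =>
     norm (minus (minus (f s) (f x)) (scal (s - x) l)) <= eps * Rabs (s - x))).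
Proof.
split=> [[_ H] eps Heps|H].
- by have := H x (fun P HP => HP) (mkposreal eps Heps).
- split; first exact: is_linear_scal_l.
  move=> y Hy eps.
  have -> : y = x.
    by apply: eq_sym; apply: is_filter_lim_locally_unique.
  exact: (H eps (cond_pos eps)).
Qed.

Lemma norm_scal_R (r : R) (x : V) : norm (scal r x) = Rabs r * norm x.
Proof.
apply: Rle_antisym; first exact: (norm_scal r x).
case: (Req_dec r 0) => [->|Hr].
  by rewrite Rabs_R0 Rmult_0_l; apply: norm_ge_0.
have H := norm_scal (/ r) (scal r x).
have E : scal (/ r) (scal r x) = x by lin_real V.
rewrite E /abs /= Rabs_inv in H.
have Hp : 0 < Rabs r by apply: Rabs_pos_lt.
apply: Rle_trans (Rmult_le_compat_l _ _ _ (Rlt_le _ _ Hp) H) _.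
by right; field; lra.
Qed.

Lemma norm_minus_le (x y : V) : norm (minus x y) <= norm x + norm y.
Proof. by apply: Rle_trans (norm_triangle _ _) _; rewrite norm_opp; lra. Qed.

Lemma norm_minus_sym (x y : V) : norm (minus x y) = norm (minus y x).
Proof. by rewrite -norm_opp opp_minus. Qed.

Lemma norm_split (x y : V) : norm x <= norm y + norm (minus x y).
Proof.
have -> : x = plus y (minus x y) by lin_real V.
apply: Rle_trans (norm_triangle _ _) _; right; congr (_ + norm _); lin_real V.
Qed.

End NormedTools.

(** A product rule for families that are differentiable only along fixed vectors, as orbits of
    semigroups are: a local bound on the operators [B s] replaces continuity in operator norm. *)
Lemma is_derive_apply {V W : NormedModule R_AbsRing} (B : R -> V -> W) (w : R -> V)
    (t K : R) (b : W) (w' : V) :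
  locally t (fun s => is_linear (B s) /\ forall v, norm (B s v) <= K * norm v) ->
  is_derive (fun s => B s (w t)) t b ->
  continuous (fun s => B s w') t ->
  is_derive w t w' ->
  is_derive (fun s => B s (w s)) t (plus b (B t w')).
Proof.
move=> HB /is_derive_eps Hb /filterlim_norm_eps Hc /is_derive_eps Hw.
apply/is_derive_eps => eps Heps.
have HK : 0 < 3 * (Rabs K + 1) by have := Rabs_pos K; lra.
have He1 : 0 < eps / 3 by lra.
have He2 : 0 < eps / (3 * (Rabs K + 1)) by apply: Rdiv_lt_0_compat.
apply (filter_and_imp (filter_and _ _ HB (Hb _ He1))
  (filter_and _ _ (Hc _ He1) (Hw _ He2))) => s [[Hlin HBs] H1] [H2 H3].
(* The error splits into the remainder of [w] seen through [B s], the variation of [B] on [w'], and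
   the remainder of [B] on the fixed vector [w t]; each is allowed a third of eps. *)
have -> : minus (minus (B s (w s)) (B t (w t))) (scal (s - t) (plus b (B t w')))
  = plus (B s (minus (minus (w s) (w t)) (scal (s - t) w')))
     (plus (scal (s - t) (minus (B s w') (B t w')))
       (minus (minus (B s (w t)) (B t (w t))) (scal (s - t) b))).
  rewrite !(linear_minus _ Hlin) (linear_scal _ Hlin); lin_real W.
apply: Rle_trans (norm_triangle _ _) _.
apply: Rle_trans (Rplus_le_compat_l _ _ _ (norm_triangle _ _)) _.
have E1 : norm (B s (minus (minus (w s) (w t)) (scal (s - t) w')))
    <= eps / 3 * Rabs (s - t).
  apply: Rle_trans (HBs _) _.
  set z := norm _ in H3 *.
  have -> : eps / 3 * Rabs (s - t)
      = (Rabs K + 1) * (eps / (3 * (Rabs K + 1)) * Rabs (s - t)).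
    by field; have := Rabs_pos K; lra.
  have Hz : 0 <= z by exact: norm_ge_0.
  have HK1 := Rle_abs K; have HK2 := Rabs_pos K.
  apply: Rle_trans (Rmult_le_compat_r z K (Rabs K + 1) Hz _) _; first by lra.
  by apply: Rmult_le_compat_l; first by lra.
have E2 : norm (scal (s - t) (minus (B s w') (B t w'))) <= eps / 3 * Rabs (s - t).
  rewrite norm_scal_R Rmult_comm; apply: Rmult_le_compat_r; first exact: Rabs_pos.
  exact: Rlt_le.
have E3 : eps * Rabs (s - t) = 3 * (eps / 3 * Rabs (s - t)) by field.
lra.
Qed.

Lemma is_derive_continuous {V : NormedModule R_AbsRing} (f : R -> V) x l :
  is_derive f x l -> continuous f x.
Proof. by move=> H; apply: ex_derive_continuous; exists l. Qed.

Lemma is_linear_continuous {T : UniformSpace} {V W : NormedModule R_AbsRing}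
    (B : V -> W) (f : T -> V) x :
  is_linear B -> continuous f x -> continuous (fun t => B (f t)) x.
Proof.
move=> HB Hf.
exact: (continuous_comp f B x Hf (linear_cont _ _ HB)).
Qed.

(** The real part of the complex inner product is of this kind. The energy identities only involve
    real parts, and vector integrals live in the real structure. *)
Record real_inner_product {V : NormedModule R_AbsRing} (rin : V -> V -> R) :
    Prop := {
  rin_plus_l : forall x y z, rin (plus x y) z = rin x z + rin y z;
  rin_scal_l : forall r x z, rin (scal r x) z = r * rin x z;
  rin_sym : forall x y, rin x y = rin y x;
  rin_norm : forall x, rin x x = norm x ^ 2
}.

Section InnerProduct.
Context {V : NormedModule R_AbsRing} {rin : V -> V -> R}.
Hypothesis Hrin : real_inner_product rin.

Lemma rin_plus_r x y z : rin x (plus y z) = rin x y + rin x z.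
Proof.
by rewrite (rin_sym _ Hrin) (rin_plus_l _ Hrin) !(rin_sym _ Hrin x).
Qed.

Lemma rin_scal_r r x y : rin x (scal r y) = r * rin x y.
Proof. by rewrite (rin_sym _ Hrin) (rin_scal_l _ Hrin) (rin_sym _ Hrin x). Qed.

Lemma rin_opp_l x y : rin (opp x) y = - rin x y.
Proof. by rewrite -scal_opp_one (rin_scal_l _ Hrin) /opp /one /=; ring. Qed.

Lemma rin_opp_r x y : rin x (opp y) = - rin x y.
Proof. by rewrite (rin_sym _ Hrin) rin_opp_l (rin_sym _ Hrin). Qed.

Lemma rin_minus_l x y z : rin (minus x y) z = rin x z - rin y z.
Proof. by rewrite /minus (rin_plus_l _ Hrin) rin_opp_l. Qed.

Lemma rin_minus_r x y z : rin x (minus y z) = rin x y - rin x z.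
Proof. by rewrite /minus rin_plus_r rin_opp_r. Qed.

Lemma rin_cauchy_schwarz x y : Rabs (rin x y) <= norm x * norm y.
Proof.
have Hx := norm_ge_0 x; have Hy := norm_ge_0 y.
apply: Rsqr_incr_0; [|exact: Rabs_pos|exact: Rmult_le_pos].
rewrite -Rsqr_abs /Rsqr.
have Hq : forall a b, 0 <= a ^ 2 * norm x ^ 2 + 2 * a * b * rin x y + b ^ 2 * norm y ^ 2.
  move=> a b.
  have := pow2_ge_0 (norm (plus (scal a x) (scal b y))).
  rewrite -!(rin_norm _ Hrin) !(rin_plus_l _ Hrin) !rin_plus_r !(rin_scal_l _ Hrin)
    !rin_scal_r (rin_sym _ Hrin y x); lra.
have H1 := Hq (norm y ^ 2) (- rin x y).
case: (Req_dec (norm y) 0) => [Hy0|Hy0].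
(* If |y| = 0, the quadratic form at (r, -(|x|^2 + 1)) with r = <x, y> equals -(|x|^2 + 2) r^2,
   which forces r = 0. *)
- have H2 := Hq (rin x y) (- (norm x ^ 2 + 1) ).
  have H3 := Hq (- rin x y) (norm x ^ 2 + 1).
  rewrite Hy0 in H2 H3 *.
  have : rin x y = 0; last by move=> ->; lra.
  nra.
- have Hy1 : 0 < norm y ^ 2 by apply: pow_lt; lra.
  have : 0 <= norm y ^ 2 * (norm x ^ 2 * norm y ^ 2 - rin x y ^ 2) by nra.
  nra.
Qed.

Lemma rin_self_minus x y :
  norm (minus x y) ^ 2 = norm x ^ 2 - 2 * rin x y + norm y ^ 2.
Proof.
rewrite -!(rin_norm _ Hrin) !rin_minus_l !rin_minus_r (rin_sym _ Hrin y x); ring.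
Qed.

Lemma is_linear_rin_l y : is_linear (V := R_NormedModule) (fun x => rin x y).
Proof.
split.
- by move=> u v; rewrite (rin_plus_l _ Hrin).
- by move=> r u; rewrite (rin_scal_l _ Hrin).
- exists (norm y + 1); split; first by have := norm_ge_0 y; lra.
  move=> x; rewrite {1}/norm /= /abs /=.
  apply: Rle_trans (rin_cauchy_schwarz _ _) _.
  have := norm_ge_0 x; have := norm_ge_0 y; nra.
Qed.

End InnerProduct.

Ltac pos :=
  solve [ assumption | lra | exact: norm_ge_0 | exact: Rabs_pos | exact: Cmod_ge_0
    | exact: pos_INR | exact: exp_pos | exact: pow2_ge_0 | by apply: lt_0_INR; lia
    | apply: Rmult_lt_0_compat; pos | apply: Rdiv_lt_0_compat; pos
    | apply: Rinv_0_lt_compat; pos | apply: pow_lt; pos | apply: Rplus_lt_0_compat; pos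
    | apply: Rplus_lt_le_0_compat; pos | apply: Rmult_le_pos; pos | apply: pow_le; pos
    | apply: Rplus_le_le_0_compat; pos | apply: Rlt_le; pos ].

(** * Derivatives and integrals of vector-valued functions *)

Section MeanValue.
Context {V : NormedModule R_AbsRing} {rin : V -> V -> R}.
Hypothesis Hrin : real_inner_product rin.

Lemma is_derive_linear_comp {W : NormedModule R_AbsRing} (B : V -> W) (f : R -> V) x l :
  is_linear B -> is_derive f x l -> is_derive (fun t => B (f t)) x (B l).
Proof.
move=> HB Hf.
apply: (filterdiff_ext_lin _ _ _
  (filterdiff_comp' f B x _ _ Hf (filterdiff_linear _ HB))) => y.
by rewrite (linear_scal _ HB).
Qed.

(* Testing against w = g b - g a reduces the inequality to scalar monotonicity. *)
Lemma mean_value_inequality (g g' : R -> V) (F f : R -> R) a b :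
  a <= b ->
  (forall s, a <= s <= b -> is_derive g s (g' s)) ->
  (forall s, a <= s <= b -> is_derive F s (f s)) ->
  (forall s, a <= s <= b -> norm (g' s) <= f s) ->
  norm (minus (g b) (g a)) <= F b - F a.
Proof.
move=> Hab Hg HF Hle.
set w := minus (g b) (g a).
have Hd s : a <= s <= b ->
    is_derive (fun s => rin (g s) w - norm w * F s) s (rin (g' s) w - norm w * f s).
  move=> Hs; apply: is_derive_minus.
  - exact: (is_derive_linear_comp _ _ _ _ (is_linear_rin_l Hrin w) (Hg s Hs)).
  - by apply: is_derive_scal; apply: HF.
have Hm : rin (g b) w - norm w * F b <= rin (g a) w - norm w * F a.
  case: (MVT_gen (fun s => rin (g s) w - norm w * F s) a b
           (fun s => rin (g' s) w - norm w * f s)).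
  - rewrite Rmin_left // Rmax_right // => s Hs; apply: Hd; lra.
  - rewrite Rmin_left // Rmax_right // => s Hs.
    apply/continuity_pt_filterlim; exact: (is_derive_continuous _ _ _ (Hd s Hs)).
  - rewrite Rmin_left // Rmax_right // => c [Hc E].
    have H1 := rin_cauchy_schwarz Hrin (g' c) w.
    have H2 := Rle_abs (rin (g' c) w).
    have H3 := Rmult_le_compat_r _ _ _ (norm_ge_0 w) (Hle c Hc).
    have : rin (g' c) w - norm w * f c <= 0 by lra.
    move: (rin (g' c) w - norm w * f c) E => k E Hk.
    have : k * (b - a) <= 0 by nra.
    lra.
have Hw : norm w ^ 2 = rin (g b) w - rin (g a) w.
  by rewrite -(rin_norm _ Hrin) {1}/w (rin_minus_l Hrin).
have := norm_ge_0 w.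
(* For w = 0 the test gives nothing, and F b - F a >= 0 is derived from f >= |g'| >= 0. *)
case: (Req_dec (norm w) 0) => [H0|H0] Hpos; last by nra.
rewrite H0.
have Hmono := MVT_gen F a b f.
case: Hmono.
- rewrite Rmin_left // Rmax_right // => s Hs; apply: HF; lra.
- rewrite Rmin_left // Rmax_right // => s Hs.
  apply/continuity_pt_filterlim; exact: (is_derive_continuous _ _ _ (HF s Hs)).
- rewrite Rmin_left // Rmax_right // => c [Hc ->].
  have := norm_ge_0 (g' c); have := Hle c Hc; nra.
Qed.
End MeanValue.

Lemma is_RInt_linear {V W : NormedModule R_AbsRing} (B : V -> W) (f : R -> V) a b l :
  is_linear B -> is_RInt f a b l -> is_RInt (fun t => B (f t)) a b (B l).
Proof.
move=> HB Hf.
have HR ptd : Riemann_sum (fun t => B (f t)) ptd = B (Riemann_sum f ptd).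
  elim/@SF_cons_ind: ptd => [x0|h ptd IH]; first by rewrite /Riemann_sum /= linear_zero.
  by rewrite !Riemann_sum_cons (linear_plus _ HB) (linear_scal _ HB) IH.
rewrite /is_RInt.
apply: (filterlim_ext (fun ptd => B (scal (sign (b - a)) (Riemann_sum f ptd)))).
  by move=> ptd; rewrite HR (linear_scal _ HB).
exact: (filterlim_comp _ _ _ _ B _ _ _ Hf (linear_cont _ _ HB)).
Qed.

Lemma RInt_linear {V W : CompleteNormedModule R_AbsRing} (B : V -> W) (f : R -> V) a b :
  is_linear B -> ex_RInt f a b -> RInt (fun t => B (f t)) a b = B (RInt f a b).
Proof.
move=> HB Hf; apply: is_RInt_unique.
by apply: is_RInt_linear => //; apply: RInt_correct.
Qed.

Lemma filterlim_linear {K : AbsRing} {V W : NormedModule K} {T : Type}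
    {F : (T -> Prop) -> Prop} (B : V -> W) (f : T -> V) l :
  is_linear B -> filterlim f F (locally l) ->
  filterlim (fun t => B (f t)) F (locally (B l)).
Proof. move=> HB Hf; exact: (filterlim_comp _ _ _ _ B _ _ _ Hf (linear_cont _ _ HB)). Qed.

Lemma continuous_RInt_ex {V : CompleteNormedModule R_AbsRing} (f : R -> V) a b :
  (forall t, continuous f t) -> ex_RInt f a b.
Proof. by move=> Hf; apply: ex_RInt_continuous => t _; apply: Hf. Qed.

Lemma is_RInt_exp (k l a b : R) : l <> 0 ->
  is_RInt (fun t => k * exp (- l * t)) a b (k / l * (exp (- l * a) - exp (- l * b))).
Proof.
move=> Hl.
have -> : k / l * (exp (- l * a) - exp (- l * b))
   = minus (- k / l * exp (- l * b)) (- k / l * exp (- l * a)).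
  by rewrite /minus /plus /opp /=; field.
apply: (is_RInt_derive (fun t => - k / l * exp (- l * t))) => t _.
- by auto_derive => //; field.
- apply: (ex_derive_continuous (fun t => k * exp (- l * t))); by auto_derive.
Qed.

Lemma exp_decay l eps : 0 < l -> 0 < eps ->
  exists t0, 0 <= t0 /\ forall t, t0 <= t -> exp (- l * t) < eps.
Proof.
move=> Hl He; exists (Rmax 0 ((1 - ln eps) / l)); split; first exact: Rmax_l.
move=> t Ht; have H1 := Rmax_r 0 ((1 - ln eps) / l).
apply: (Rlt_le_trans _ (exp (ln eps))); last by rewrite exp_ln //; lra.
apply: exp_increasing.
have : l * ((1 - ln eps) / l) <= l * t by apply: Rmult_le_compat_l; lra.
have -> : l * ((1 - ln eps) / l) = 1 - ln eps by field; lra.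
lra.
Qed.

Lemma norm_RInt_exp {V : CompleteNormedModule R_AbsRing} (f : R -> V) k l a b :
  0 < l -> a <= b -> ex_RInt f a b ->
  (forall t, a <= t <= b -> norm (f t) <= k * exp (- l * t)) ->
  norm (RInt f a b) <= k / l * (exp (- l * a) - exp (- l * b)).
Proof.
move=> Hl Hab Hf Hle.
apply: (norm_RInt_le f (fun t => k * exp (- l * t)) a b) => //.
- exact: RInt_correct.
- by apply: is_RInt_exp; lra.
Qed.

Lemma improper_RInt_exp {V : CompleteNormedModule R_AbsRing} (f : R -> V) k l :
  0 < l -> 0 <= k -> (forall t, continuous f t) ->
  (forall t, 0 <= t -> norm (f t) <= k * exp (- l * t)) ->
  exists y, filterlim (fun tau => RInt f 0 tau) (Rbar_locally p_infty) (locally y)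
    /\ norm y <= k / l.
Proof.
move=> Hl Hk Hf Hle.
have Hkl : 0 <= k / l by pos.
have Hd a b : 0 <= a <= b -> norm (minus (RInt f 0 b) (RInt f 0 a)) <= k / l * exp (- l * a).
  move=> Hab.
  have -> : minus (RInt f 0 b) (RInt f 0 a) = RInt f a b.
    rewrite -(RInt_Chasles f 0 a b); try exact: continuous_RInt_ex.
    by lin_real V.
  apply: Rle_trans (norm_RInt_exp f k l a b Hl _ (continuous_RInt_ex _ _ _ Hf) _) _.
  - lra.
  - by move=> t Ht; apply: Hle; lra.
  - have := exp_pos (- l * b); nra.
have [y Hy] : exists y, filterlim (fun tau => RInt f 0 tau) (Rbar_locally p_infty) (locally y).
  apply: (proj1 (filterlim_locally_cauchy (F := Rbar_locally p_infty) (fun tau => RInt f 0 tau))) => eps.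
  have He : 0 < eps / (k / l + 1) by apply: Rdiv_lt_0_compat; [exact: cond_pos|lra].
  have [t0 [Ht0 Hs]] := exp_decay l _ Hl He.
  have Hs' a : t0 <= a -> k / l * exp (- l * a) < eps.
    move=> Ha; have H1 := Hs a Ha; have H2 := exp_pos (- l * a).
    have : (k / l + 1) * exp (- l * a) < (k / l + 1) * (eps / (k / l + 1)).
      by apply: Rmult_lt_compat_l; lra.
    have -> : (k / l + 1) * (eps / (k / l + 1)) = eps by field; lra.
    lra.
  exists (fun t => t0 < t); split; first by exists t0.
  move=> u v Hu Hv; apply: norm_compat1.
  case: (Rle_dec u v) => Huv.
  - by apply: Rle_lt_trans (Hd u v _) _; [lra|apply: Hs'; lra].
  - by rewrite norm_minus_sym; apply: Rle_lt_trans (Hd v u _) _; [lra|apply: Hs'; lra].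
exists y; split => //.
have Hn : filterlim (fun tau => norm (RInt f 0 tau)) (Rbar_locally p_infty) (locally (norm y)).
  exact: (filterlim_comp _ _ _ _ norm _ _ _ Hy (filterlim_norm y)).
have := filterlim_le (F := Rbar_locally p_infty) (fun tau => norm (RInt f 0 tau)) (fun _ => k / l) (norm y) (k / l).
apply => //; last exact: filterlim_const.
exists 0 => t Ht.
apply: Rle_trans (norm_RInt_exp f k l 0 t Hl _ (continuous_RInt_ex _ _ _ Hf) _) _.
- lra.
- by move=> s Hs; apply: Hle; lra.
- rewrite Rmult_0_r exp_0; have := exp_pos (- l * t); nra.
Qed.

Section LimitArithmetic.
Context {K : AbsRing} {V : NormedModule K} {T : Type}.
Context {F : (T -> Prop) -> Prop} {FF : Filter F}.

Lemma filterlim_plus_fun (f g : T -> V) a b :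
  filterlim f F (locally a) -> filterlim g F (locally b) ->
  filterlim (fun t => plus (f t) (g t)) F (locally (plus a b)).
Proof.
move=> Hf Hg; eapply filterlim_comp_2; [exact: Hf|exact: Hg|exact: filterlim_plus].
Qed.

Lemma filterlim_opp_fun (f : T -> V) a :
  filterlim f F (locally a) -> filterlim (fun t => opp (f t)) F (locally (opp a)).
Proof. by move=> Hf; eapply filterlim_comp; [exact: Hf|exact: filterlim_opp]. Qed.

Lemma filterlim_minus_fun (f g : T -> V) a b :
  filterlim f F (locally a) -> filterlim g F (locally b) ->
  filterlim (fun t => minus (f t) (g t)) F (locally (minus a b)).
Proof.
by move=> Hf Hg; apply: filterlim_plus_fun => //; apply: filterlim_opp_fun.
Qed.

Lemma filterlim_scal_fun (k : T -> K) (f : T -> V) c a :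
  filterlim k F (locally c) -> filterlim f F (locally a) ->
  filterlim (fun t => scal (k t) (f t)) F (locally (scal c a)).
Proof.
move=> Hf Hg; eapply filterlim_comp_2; [exact: Hf|exact: Hg|exact: filterlim_scal].
Qed.

Lemma filterlim_scal_r_fun (k : K) (f : T -> V) a :
  filterlim f F (locally a) -> filterlim (fun t => scal k (f t)) F (locally (scal k a)).
Proof. by move=> Hf; eapply filterlim_comp; [exact: Hf|exact: filterlim_scal_r]. Qed.
End LimitArithmetic.

Lemma is_linear_scal_left {V : NormedModule R_AbsRing} (k : R) :
  is_linear (fun v : V => scal k v).
Proof.
split.
- by move=> x y; rewrite scal_distr_l.
- by move=> r x; lin_real V.
- exists (Rabs k + 1); split; first by have := Rabs_pos k; lra.
  move=> x; rewrite norm_scal_R; have := norm_ge_0 x; have := Rabs_pos k; nra.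
Qed.

Lemma is_derive_scal_fun {V : NormedModule R_AbsRing} (k : R -> R) (f : R -> V) t k' f' :
  is_derive k t k' -> is_derive f t f' ->
  is_derive (fun s => scal (k s) (f s)) t (plus (scal k' (f t)) (scal (k t) f')).
Proof.
move=> Hk Hf.
have Hc : continuous k t by apply: is_derive_continuous Hk.
apply: (is_derive_apply (fun s v => scal (k s) v) f t (Rabs (k t) + 1)) => //.
- generalize (proj1 (filterlim_norm_eps (V := R_NormedModule) _ _ _) Hc 1 Rlt_0_1).
  apply filter_imp => s Hs; split; first exact: is_linear_scal_left.
  move=> v; rewrite norm_scal_R; apply: Rmult_le_compat_r; first pos.
  have := norm_split (V := R_NormedModule) (k s) (k t).
  move: Hs; rewrite /norm /= /abs /=; lra.
- exact: is_derive_scal_l.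
- apply: continuous_scal => //; exact: continuous_const.
Qed.

Section InnerDerivative.
Context {V : NormedModule R_AbsRing} {rin : V -> V -> R}.
Hypothesis Hrin : real_inner_product rin.

Lemma is_linear_rin_r x : is_linear (V := R_NormedModule) (fun y => rin x y).
Proof.
case: (is_linear_rin_l Hrin x) => Hp Hs [K [HK Hn]]; split.
- by move=> u v; rewrite !(rin_sym _ Hrin x); apply: Hp.
- by move=> k u; rewrite !(rin_sym _ Hrin x); apply: Hs.
- by exists K; split=> // u; rewrite (rin_sym _ Hrin x); apply: Hn.
Qed.

Lemma is_derive_rin (f g : R -> V) t f' g' :
  is_derive f t f' -> is_derive g t g' ->
  is_derive (fun s => rin (f s) (g s)) t (rin f' (g t) + rin (f t) g').
Proof.
move=> Hf Hg.
have Hc : continuous f t by apply: is_derive_continuous Hf.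
apply: (is_derive_apply (W := R_NormedModule) (fun s v => rin (f s) v) g t (norm (f t) + 1)) => //.
- generalize (proj1 (filterlim_norm_eps _ _ _) Hc 1 Rlt_0_1).
  apply filter_imp => s Hs; split; first exact: is_linear_rin_r.
  move=> v; apply: Rle_trans (rin_cauchy_schwarz Hrin _ _) _.
  apply: Rmult_le_compat_r; first pos.
  have := norm_split (f s) (f t); lra.
- exact: (is_derive_linear_comp (fun v => rin v (g t)) _ _ _ (is_linear_rin_l Hrin _) Hf).
- exact: (is_linear_continuous (W := R_NormedModule) (fun v => rin v g') f t (is_linear_rin_l Hrin _) Hc).
Qed.

Lemma is_derive_norm2 (f : R -> V) t f' :
  is_derive f t f' -> is_derive (fun s => norm (f s) ^ 2) t (2 * rin (f t) f').
Proof.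
move=> Hf.
have -> : 2 * rin (f t) f' = rin f' (f t) + rin (f t) f'.
  by rewrite (rin_sym _ Hrin f'); ring.
apply: (is_derive_ext (fun s => rin (f s) (f s))).
  by move=> s; apply: (rin_norm _ Hrin).
exact: is_derive_rin.
Qed.
End InnerDerivative.

Lemma continuous_norm2 {T : UniformSpace} {V : NormedModule R_AbsRing} (f : T -> V) t :
  continuous f t -> continuous (fun s => norm (f s) ^ 2) t.
Proof.
move=> Hf.
have Hn : continuous (fun s => norm (f s)) t.
  exact: (continuous_comp f norm t Hf (filterlim_norm _)).
apply: (continuous_mult (fun s => norm (f s)) (fun s => norm (f s) * 1)) => //.
apply: (continuous_mult (fun s => norm (f s)) (fun s => 1)) => //.
exact: continuous_const.
Qed.

Lemma exp_mono x y : x <= y -> exp x <= exp y.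
Proof. by case=> [H|->]; [apply: Rlt_le; apply: exp_increasing|apply: Rle_refl]. Qed.

(** * Bounded semigroups and their resolvents *)

Record bounded_semigroup {V : NormedModule R_AbsRing} (T : R -> V -> V) (M : R) :
    Prop := {
  bs_pos : 0 < M;
  bs_linear : forall t, 0 <= t -> is_linear (T t);
  bs_zero : forall x, T 0 x = x;
  bs_plus : forall s t x, 0 <= s -> 0 <= t -> T (s + t) x = T s (T t x);
  bs_cont : forall x, filterlim (fun t => T t x) (at_right 0) (locally x);
  bs_bound : forall t x, 0 <= t -> norm (T t x) <= M * norm x
}.

(* The graph of A, where -A is the generator of T. *)
Definition neg_generator {V : NormedModule R_AbsRing} (T : R -> V -> V) (x y : V) :
    Prop :=
  filterlim (fun t => scal (/ t) (minus (T t x) x)) (at_right 0) (locally (opp y)).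

(** A semigroup is constrained on [0, +oo) only; the even extension [T (Rabs t)] makes the integrand
    continuous on the whole line, as two-sided continuity and differentiation require. *)
Definition laplace_partial {V : CompleteNormedModule R_AbsRing}
    (T : R -> V -> V) (l : R) (u : V) (tau : R) : V :=
  RInt (fun t => scal (exp (- l * t)) (T (Rabs t) u)) 0 tau.

(* This is (l + A)^{-1} u. *)
Definition laplace {V : CompleteNormedModule R_AbsRing}
    (T : R -> V -> V) (l : R) (u : V) : V :=
  iota (fun y => filterlim (laplace_partial T l u) (Rbar_locally p_infty) (locally y)).

Section Semigroup.
Context {V : CompleteNormedModule R_AbsRing} {T : R -> V -> V} {M : R}.
Hypothesis HT : bounded_semigroup T M.

Let Mpos : 0 < M := bs_pos _ _ HT.

(** For s >= t, T(s) - T(t) = T(t) (T(s - t) - 1): continuity everywhere reduces to continuity at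
    0. *)
Lemma bs_lipschitz s t x : 0 <= s -> 0 <= t ->
  norm (minus (T s x) (T t x)) <= M * norm (minus (T (Rabs (s - t)) x) x).
Proof.
have main a b : 0 <= a <= b ->
    norm (minus (T b x) (T a x)) <= M * norm (minus (T (b - a) x) x).
  move=> Hab.
  have {1}-> : b = a + (b - a) by ring.
  rewrite (bs_plus _ _ HT); try lra.
  have Hlin := bs_linear _ _ HT a (proj1 Hab).
  rewrite -(linear_minus _ Hlin); apply: (bs_bound _ _ HT); lra.
move=> Hs Ht; case: (Rle_dec t s) => H.
- by rewrite Rabs_pos_eq; [apply: main; lra|lra].
- by rewrite norm_minus_sym Rabs_minus_sym Rabs_pos_eq; [apply: main; lra|lra].
Qed.

Lemma bs_continuous x t : continuous (fun t => T (Rabs t) x) t.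
Proof.
apply/filterlim_norm_eps => eps Heps.
have He : 0 < eps / (M + 1) by pos.
have [d Hd] := proj1 (filterlim_norm_eps _ _ _) (bs_cont _ _ HT x) _ He.
exists d => s Hs.
apply: Rle_lt_trans (bs_lipschitz _ _ _ (Rabs_pos s) (Rabs_pos t)) _.
have Hst : Rabs (Rabs s - Rabs t) < d.
  apply: Rle_lt_trans (Rabs_triang_inv2 _ _) _.
  exact: Hs.
have H : norm (minus (T (Rabs (Rabs s - Rabs t)) x) x) < eps / (M + 1).
  case: (Req_dec (Rabs (Rabs s - Rabs t)) 0) => [->|H0].
    by rewrite (bs_zero _ _ HT) minus_eq_zero norm_zero.
  apply: Hd; last by have := Rabs_pos (Rabs s - Rabs t); lra.
  rewrite /ball /= /AbsRing_ball /abs /minus /plus /opp /=.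
  by rewrite Ropp_0 Rplus_0_r Rabs_Rabsolu.
have E : eps = (M + 1) * (eps / (M + 1)) by field; lra.
rewrite E.
have := norm_ge_0 (minus (T (Rabs (Rabs s - Rabs t)) x) x); nra.
Qed.

Lemma laplace_kernel_continuous l u t :
  continuous (fun t => scal (exp (- l * t)) (T (Rabs t) u)) t.
Proof.
apply: continuous_scal; last exact: bs_continuous.
by apply: (ex_derive_continuous (fun t => exp (- l * t))); auto_derive.
Qed.

Lemma laplace_kernel_norm l u t :
  0 <= t -> norm (scal (exp (- l * t)) (T (Rabs t) u)) <= M * norm u * exp (- l * t).
Proof.
move=> Ht; rewrite norm_scal_R Rabs_pos_eq; last pos.
rewrite Rmult_comm; apply: Rmult_le_compat_r; first pos.
exact: (bs_bound _ _ HT _ _ (Rabs_pos t)).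
Qed.

Lemma laplace_spec l u : 0 < l ->
  filterlim (laplace_partial T l u) (Rbar_locally p_infty) (locally (laplace T l u)) /\
  norm (laplace T l u) <= M / l * norm u.
Proof.
move=> Hl.
have Hk : 0 <= M * norm u by pos.
have [y [Hy Hn]] := improper_RInt_exp _ _ l Hl Hk
  (laplace_kernel_continuous l u) (laplace_kernel_norm l u).
have -> : laplace T l u = y.
  apply: iota_unique; last exact: Hy.
  move=> z Hz; exact: (filterlim_locally_unique _ _ _ Hz Hy).
split; first exact: Hy.
by have -> : M / l * norm u = M * norm u / l by field; lra.
Qed.

Lemma laplace_lim l u : 0 < l ->
  filterlim (laplace_partial T l u) (Rbar_locally p_infty) (locally (laplace T l u)).
Proof. by move=> Hl; case: (laplace_spec l u Hl). Qed.

Lemma laplace_norm l u : 0 < l -> norm (laplace T l u) <= M / l * norm u.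
Proof. by move=> Hl; case: (laplace_spec l u Hl). Qed.

Lemma laplace_eq l u y : 0 < l ->
  filterlim (laplace_partial T l u) (Rbar_locally p_infty) (locally y) ->
  laplace T l u = y.
Proof.
move=> Hl Hy; exact: (filterlim_locally_unique _ _ _ (laplace_lim l u Hl) Hy).
Qed.

Lemma laplace_partial_ex l u a b :
  ex_RInt (fun t => scal (exp (- l * t)) (T (Rabs t) u)) a b.
Proof. exact: continuous_RInt_ex (laplace_kernel_continuous l u). Qed.

Lemma bs_linear_abs t : is_linear (T (Rabs t)).
Proof. exact: (bs_linear _ _ HT _ (Rabs_pos t)). Qed.

Lemma laplace_partial_plus l u v t :
  laplace_partial T l (plus u v) t = plus (laplace_partial T l u t) (laplace_partial T l v t).
Proof.
rewrite /laplace_partial -RInt_plus; try exact: laplace_partial_ex.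
apply: RInt_ext => s _.
by rewrite (linear_plus _ (bs_linear_abs s)) scal_distr_l.
Qed.

Lemma laplace_partial_scal l (k : R) u t :
  laplace_partial T l (scal k u) t = scal k (laplace_partial T l u t).
Proof.
rewrite /laplace_partial -RInt_scal; last exact: laplace_partial_ex.
apply: RInt_ext => s _.
rewrite (linear_scal _ (bs_linear_abs s)); lin_real V.
Qed.

Lemma laplace_linear l : 0 < l -> is_linear (laplace T l).
Proof.
move=> Hl; split.
- move=> u v; apply: laplace_eq => //.
  apply: (filterlim_ext (fun t => plus (laplace_partial T l u t) (laplace_partial T l v t))).
    by move=> t; rewrite laplace_partial_plus.
  exact: (filterlim_plus_fun _ _ _ _ (laplace_lim l u Hl) (laplace_lim l v Hl)).
- move=> k u; apply: laplace_eq => //.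
  apply: (filterlim_ext (fun t => scal k (laplace_partial T l u t))).
    by move=> t; rewrite laplace_partial_scal.
  exact: (filterlim_scal_r_fun _ _ _ (laplace_lim l u Hl)).
- exists (M / l); split; first pos.
  by move=> u; apply: laplace_norm.
Qed.

Lemma laplace_commute l (B : V -> V) : 0 < l -> is_linear B ->
  (forall t x, 0 <= t -> B (T t x) = T t (B x)) ->
  forall u, B (laplace T l u) = laplace T l (B u).
Proof.
move=> Hl HB Hc u; symmetry; apply: laplace_eq => //.
apply: (filterlim_ext (fun t => B (laplace_partial T l u t))).
  move=> t; rewrite /laplace_partial -(RInt_linear B) //; last exact: laplace_partial_ex.
  by apply: RInt_ext => s _; rewrite (linear_scal _ HB) Hc //; apply: Rabs_pos.
exact: (filterlim_linear _ _ _ HB (laplace_lim l u Hl)).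
Qed.

Lemma bs_comm s t x : 0 <= s -> 0 <= t -> T s (T t x) = T t (T s x).
Proof. by move=> Hs Ht; rewrite -!(bs_plus _ _ HT) // Rplus_comm. Qed.

Lemma laplace_semigroup l h u : 0 < l -> 0 <= h ->
  T h (laplace T l u) = laplace T l (T h u).
Proof.
move=> Hl Hh; apply: laplace_commute => //; first exact: (bs_linear _ _ HT).
by move=> t x Ht; apply: bs_comm.
Qed.

(** T(h) turns the partial integral over [0, t] into the one over [h, t + h], up to the factor e^{l
    h}; then t tends to infinity. Differentiability of the orbits of resolvents and the formula for
    the generator on them both come from this identity. *)
Lemma laplace_flow l h u : 0 < l -> 0 <= h ->
  scal (exp (- l * h)) (T h (laplace T l u)) = minus (laplace T l u) (laplace_partial T l u h).
Proof.
move=> Hl Hh.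
have Hlin := bs_linear _ _ HT h Hh.
have H1 : filterlim (fun t => scal (exp (- l * h)) (T h (laplace_partial T l u t)))
    (Rbar_locally p_infty) (locally (scal (exp (- l * h)) (T h (laplace T l u)))).
  apply: filterlim_scal_r_fun.
  exact: filterlim_linear _ _ _ Hlin (laplace_lim l u Hl).
have H2 : filterlim (fun t => minus (laplace_partial T l u (t + h)) (laplace_partial T l u h))
    (Rbar_locally p_infty) (locally (minus (laplace T l u) (laplace_partial T l u h))).
  apply: filterlim_minus_fun.
  - apply: (filterlim_comp _ _ _ (fun t => t + h) _ _ (Rbar_locally p_infty)); last exact: laplace_lim.
    move=> P [N HN]; exists N => t Ht; apply: HN; lra.
  - exact: filterlim_const.
apply: (filterlim_locally_unique (F := Rbar_locally p_infty) _ _ _ H1).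
apply: (filterlim_ext_loc _ _ _ H2).
exists 0 => t Ht.
rewrite /laplace_partial -(RInt_linear (T h)) //; last exact: laplace_partial_ex.
rewrite -RInt_scal; last first.
  apply: continuous_RInt_ex => s.
  apply: is_linear_continuous => //; exact: laplace_kernel_continuous.
have -> : minus (RInt (fun t => scal (exp (- l * t)) (T (Rabs t) u)) 0 (t + h))
            (RInt (fun t => scal (exp (- l * t)) (T (Rabs t) u)) 0 h)
   = RInt (fun t => scal (exp (- l * t)) (T (Rabs t) u)) (1 * 0 + h) (1 * t + h).
  rewrite !Rmult_1_l Rplus_0_l -(RInt_Chasles _ 0 h (t + h)); try exact: laplace_partial_ex.
  lin_real V.
rewrite -RInt_comp_lin; last exact: laplace_partial_ex.
apply: RInt_ext => s; rewrite Rmin_left ?Rmax_right; try lra; move=> Hs.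
rewrite (linear_scal _ Hlin) Rmult_1_l.
have -> : Rabs (s + h) = h + Rabs s by rewrite !Rabs_pos_eq; lra.
rewrite (bs_plus _ _ HT) //; last pos.
have -> : exp (- l * (s + h)) = exp (- l * h) * exp (- l * s).
  by rewrite -exp_plus; congr exp; ring.
lin_real V.
Qed.

Lemma laplace_partial_derive l u t :
  is_derive (laplace_partial T l u) t (scal (exp (- l * t)) (T (Rabs t) u)).
Proof.
apply (is_derive_RInt (fun t => scal (exp (- l * t)) (T (Rabs t) u)) _ 0 t).
- apply filter_forall; move=> s; apply: RInt_correct; exact: laplace_partial_ex.
- exact: laplace_kernel_continuous.
Qed.

(* A C^1 extension to the real line of the orbit of [laplace T l u]. *)
Definition laplace_orbit l u t : V :=
  scal (exp (l * t)) (minus (laplace T l u) (laplace_partial T l u t)).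

Lemma laplace_orbit_eq l u t : 0 < l -> 0 <= t ->
  laplace_orbit l u t = T t (laplace T l u).
Proof.
move=> Hl Ht; rewrite /laplace_orbit -laplace_flow //.
have E : exp (l * t) * exp (- l * t) = 1.
  by rewrite -exp_plus -exp_0; congr exp; ring.
by rewrite scal_assoc /mult /= E scal_one.
Qed.

Lemma laplace_orbit_derive l u t :
  is_derive (laplace_orbit l u) t (minus (scal l (laplace_orbit l u t)) (T (Rabs t) u)).
Proof.
have H1 : is_derive (fun t => exp (l * t)) t (l * exp (l * t)).
  by auto_derive => //; ring.
have H2 : is_derive (fun t => minus (laplace T l u) (laplace_partial T l u t)) t
    (minus zero (scal (exp (- l * t)) (T (Rabs t) u))).
  apply: is_derive_minus; first exact: is_derive_const.
  exact: laplace_partial_derive.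
have E : exp (l * t) * exp (- l * t) = 1.
  by rewrite -exp_plus -exp_0; congr exp; ring.
have -> : minus (scal l (laplace_orbit l u t)) (T (Rabs t) u)
  = plus (scal (l * exp (l * t)) (minus (laplace T l u) (laplace_partial T l u t)))
      (scal (exp (l * t)) (minus zero (scal (exp (- l * t)) (T (Rabs t) u)))).
  by rewrite /laplace_orbit; lin_real V; lra.
exact: is_derive_scal_fun.
Qed.

Lemma at_right_filter_le : filter_le (at_right 0) (locally 0).
Proof. by move=> P; apply: filter_le_within. Qed.

Lemma derive_at_right (f : R -> V) x :
  is_derive f 0 x ->
  filterlim (fun t => scal (/ t) (minus (f t) (f 0))) (at_right 0) (locally x).
Proof.
move=> /is_derive_eps H; apply/filterlim_norm_eps => eps Heps.
have He : 0 < eps / 2 by lra.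
have [d Hd] := H _ He.
exists d => t Ht Ht0.
have Ht' : 0 < t by [].
have -> : minus (scal (/ t) (minus (f t) (f 0))) x
  = scal (/ t) (minus (minus (f t) (f 0)) (scal (t - 0) x)) by lin_real V; lra.
rewrite norm_scal_R Rabs_pos_eq; last pos.
apply: Rle_lt_trans (Rmult_le_compat_l _ _ _ _ (Hd t Ht)) _.
- pos.
- rewrite Rminus_0_r (Rabs_pos_eq t); last lra.
  have -> : / t * (eps / 2 * t) = eps / 2 by field; lra.
  lra.
Qed.

Lemma neg_generator_laplace l u : 0 < l ->
  neg_generator T (laplace T l u) (minus u (scal l (laplace T l u))).
Proof.
move=> Hl; rewrite /neg_generator.
have H := derive_at_right _ _ (laplace_orbit_derive l u 0).
have E0 : laplace_orbit l u 0 = laplace T l u by rewrite laplace_orbit_eq ?(bs_zero _ _ HT) //; lra.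
rewrite E0 Rabs_R0 (bs_zero _ _ HT) in H.
rewrite opp_minus.
apply: (filterlim_ext_loc _ _ _ H).
exists (mkposreal 1 Rlt_0_1) => t _ Ht.
by rewrite laplace_orbit_eq //; apply: Rlt_le.
Qed.

Lemma neg_generator_minus x y x' y' :
  neg_generator T x y -> neg_generator T x' y' ->
  neg_generator T (minus x x') (minus y y').
Proof.
rewrite /neg_generator => H H'.
generalize (filterlim_minus_fun _ _ _ _ H H').
have -> : minus (opp y) (opp y') = opp (minus y y') by lin_real V.
apply filterlim_ext_loc.
exists (mkposreal 1 Rlt_0_1) => t _ Ht.
rewrite (linear_minus _ (bs_linear _ _ HT t (Rlt_le _ _ Ht))); lin_real V.
Qed.

(** The resolvent R at l commutes with T, so it maps the difference quotients of x to those of R x.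
    The limits give R (l x) = l R x - x, whereas R is linear; hence x = 0. This is the injectivity
    of l + A. *)
Lemma neg_generator_eigen l x :
  0 < l -> neg_generator T x (opp (scal l x)) -> x = zero.
Proof.
move=> Hl Hx.
have HL := laplace_linear l Hl.
have H1 := filterlim_linear _ _ _ HL Hx.
have H2 := neg_generator_laplace l x Hl.
have H3 : laplace T l (opp (opp (scal l x))) = opp (minus x (scal l (laplace T l x))).
  apply: (filterlim_locally_unique (F := at_right 0) _ _ _ H1).
  apply: (filterlim_ext_loc _ _ _ H2).
  exists (mkposreal 1 Rlt_0_1) => t _ Ht.
  rewrite (linear_scal _ HL) (linear_minus _ HL) laplace_semigroup //.
  exact: Rlt_le.
rewrite opp_opp (linear_scal _ HL) in H3.
have -> : x = minus (plus x (opp (scal l (laplace T l x)))) (opp (scal l (laplace T l x))) by lin_real V.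
have H4 : plus x (opp (scal l (laplace T l x))) = opp (scal l (laplace T l x)).
  by rewrite {2}H3 /minus opp_opp.
by rewrite H4 minus_eq_zero.
Qed.

(** The graph of A becomes an equation between bounded operators; from here on the limits in the
    definition of the generator are mostly avoided. *)
Lemma neg_generator_iff l x y : 0 < l ->
  neg_generator T x y <-> x = laplace T l (plus y (scal l x)).
Proof.
move=> Hl; split=> [H|H].
- have H1 := neg_generator_minus _ _ _ _ H (neg_generator_laplace l (plus y (scal l x)) Hl).
  set z := laplace _ _ _ in H1 *.
  have E : minus x z = zero.
    apply: (neg_generator_eigen l) => //.
    by congr (neg_generator T _ _): H1; lin_real V.
  have -> : x = plus (minus x z) z by lin_real V.
  by rewrite E plus_zero_l.
- have := neg_generator_laplace l (plus y (scal l x)) Hl.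
  rewrite -H; congr (neg_generator T _ _); lin_real V.
Qed.

Lemma neg_generator_unique x y y' :
  neg_generator T x y -> neg_generator T x y' -> y = y'.
Proof.
move=> H H'.
generalize (filterlim_locally_unique (F := at_right 0) _ _ _ H H').
by move=> /(f_equal opp); rewrite !opp_opp.
Qed.

Lemma laplace_resolvent l m u : 0 < l -> 0 < m ->
  minus (laplace T m u) (laplace T l u) = scal (l - m) (laplace T l (laplace T m u)).
Proof.
move=> Hl Hm.
have H := proj1 (neg_generator_iff l _ _ Hl) (neg_generator_laplace m u Hm).
have HL := laplace_linear l Hl.
rewrite {1}H (linear_plus _ HL) (linear_minus _ HL) !(linear_scal _ HL); lin_real V.
Qed.

(** Variation of constants for the equation (A + l) x = y + l x. *)
Lemma neg_generator_flow l t x y : 0 < l -> 0 <= t -> neg_generator T x y ->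
  scal (exp (- l * t)) (T t x) = minus x (laplace_partial T l (plus y (scal l x)) t).
Proof.
move=> Hl Ht /(proj1 (neg_generator_iff l _ _ Hl)) {1 2}->.
exact: laplace_flow.
Qed.

Lemma laplace_partial_norm l u t : 0 <= l -> 0 <= t ->
  norm (laplace_partial T l u t) <= t * (M * norm u).
Proof.
move=> Hl Ht.
have -> : t * (M * norm u) = (t - 0) * (M * norm u) by ring.
apply: (norm_RInt_le_const _ _ _ _ _ Ht); last exact: RInt_correct (laplace_partial_ex _ _ _ _).
move=> s Hs; apply: Rle_trans (laplace_kernel_norm _ _ _ (proj1 Hs)) _.
have H1 : exp (- l * s) <= 1.
  rewrite -exp_0; case: (Req_dec (- l * s) 0) => [->|H]; first exact: Rle_refl.
  apply: Rlt_le; apply: exp_increasing; have : 0 <= l * s by apply: Rmult_le_pos; lra.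
  lra.
have := exp_pos (- l * s).
have : 0 <= M * norm u by apply: Rmult_le_pos; [lra|exact: norm_ge_0].
nra.
Qed.

End Semigroup.

(** * The observability estimate *)

Definition shifted_resolvent {V : CompleteNormedModule R_AbsRing}
    (T : R -> V -> V) (xi : R) : V -> V := laplace T (1 + xi).

Definition shifted_cayley {V : CompleteNormedModule R_AbsRing}
    (T : R -> V -> V) (xi : R) (u : V) : V :=
  minus u (scal 2 (shifted_resolvent T xi u)).

Definition density {V : CompleteNormedModule R_AbsRing}
    (T : R -> V -> V) (xi : R) (u : V) (t : R) : R :=
  exp (- (2 * xi) * t) * norm (T (Rabs t) u) ^ 2.

Fixpoint sum_upto (f : nat -> R) (L : nat) : R :=
  match L with O => 0 | S L => sum_upto f L + f L end.

Lemma sum_upto_S f L : sum_upto f (S L) = sum_upto f L + f L.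
Proof. by []. Qed.

Lemma sum_upto_le f g L : (forall l, (l < L)%nat -> f l <= g l) ->
  sum_upto f L <= sum_upto g L.
Proof.
elim: L => [|L IH] H /=; first lra.
apply: Rplus_le_compat; last by apply: H; lia.
by apply: IH => l Hl; apply: H; lia.
Qed.

Lemma sum_upto_scal k f L : sum_upto (fun l => k * f l) L = k * sum_upto f L.
Proof. elim: L => [|L IH] /=; [ring|rewrite IH; ring]. Qed.

Lemma sum_upto_telescope (f : nat -> R) L :
  sum_upto (fun l => f l - f (S l)) L = f O - f L.
Proof. elim: L => [|L IH] /=; [ring|rewrite IH; ring]. Qed.

Lemma sum_upto_const k L : sum_upto (fun _ => k) L = INR L * k.
Proof. elim: L => [|L IH]; [by rewrite /= Rmult_0_l|rewrite S_INR /= IH; ring]. Qed.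

Section Energy.
Context {V : CompleteNormedModule R_AbsRing} {T : R -> V -> V} {M : R}.
Context {rin : V -> V -> R}.
Hypothesis HT : bounded_semigroup T M.
Hypothesis Hrin : real_inner_product rin.
Context (xi : R).
Hypothesis Hxi : 0 < xi.

Let Rx := shifted_resolvent T xi.
Let Vx := shifted_cayley T xi.
Let Hl : 0 < 1 + xi. Proof. lra. Qed.

Lemma density_continuous u t : continuous (density T xi u) t.
Proof.
apply: (continuous_mult (fun t => exp (- (2 * xi) * t))).
- by apply: (ex_derive_continuous (fun t => exp (- (2 * xi) * t))); auto_derive.
- apply: continuous_norm2; exact: (bs_continuous HT).
Qed.

Lemma density_ge_0 u t : 0 <= density T xi u t.
Proof. by apply: Rmult_le_pos; [apply: Rlt_le (exp_pos _)|apply: pow2_ge_0]. Qed.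

Lemma density_le u t : 0 <= t ->
  density T xi u t <= M ^ 2 * norm u ^ 2 * exp (- (2 * xi) * t).
Proof.
move=> Ht; rewrite /density Rmult_comm; apply: Rmult_le_compat_r.
  pos.
rewrite -Rpow_mult_distr; apply: pow_incr; split; first pos.
exact: (bs_bound _ _ HT _ _ (Rabs_pos t)).
Qed.

(** The energy density of the orbit of R u, written with the C^1 extension of that orbit: the even
    extension used in [density] need not have a two-sided derivative at 0. *)
Let psi u t := exp (- (2 * xi) * t) * norm (laplace_orbit (T := T) (1 + xi) u t) ^ 2.

Lemma psi_density u t : 0 <= t -> psi u t = density T xi (Rx u) t.
Proof.
by move=> Ht; rewrite /psi /density (laplace_orbit_eq HT) // Rabs_pos_eq.
Qed.

(** Write w = T(t) u and y = T(t) R u. Then T(t) V u = w - 2 y and y' = (1 + xi) y - w, and the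
    weight e^{-2 xi t} cancels the xi in the growth of |y|^2. What remains is 2 |y|^2 - 2 <y, w> = -
    (|w|^2 - |w - 2 y|^2) / 2. *)
Lemma psi_derive u t : 0 <= t ->
  is_derive (psi u) t (- / 2 * (density T xi u t - density T xi (Vx u) t)).
Proof.
move=> Ht.
set y := laplace_orbit (T := T) (1 + xi) u.
have Hy := laplace_orbit_derive HT (1 + xi) u t.
have H1 := is_derive_norm2 Hrin _ _ _ Hy.
have H2 : is_derive (fun t => exp (- (2 * xi) * t)) t (- (2 * xi) * exp (- (2 * xi) * t)).
  by auto_derive => //; ring.
have H3 := is_derive_mult _ _ _ _ _ H2 H1 Rmult_comm.
have -> : - / 2 * (density T xi u t - density T xi (Vx u) t)
  = plus (mult (- (2 * xi) * exp (- (2 * xi) * t)) (norm (y t) ^ 2))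
     (mult (exp (- (2 * xi) * t))
       (2 * rin (y t) (minus (scal (1 + xi) (y t)) (T (Rabs t) u)))); last exact: H3.
rewrite /density /Vx /shifted_cayley (linear_minus _ (bs_linear_abs HT t))
  (linear_scal _ (bs_linear_abs HT t)).
have -> : T (Rabs t) (shifted_resolvent T xi u) = y t.
  by rewrite /y (laplace_orbit_eq HT) // Rabs_pos_eq.
move: (y t) (T (Rabs t) u) => z w.
rewrite (rin_self_minus Hrin) -(rin_norm _ Hrin (scal 2 z)) (rin_minus_r Hrin)
  !(rin_scal_r Hrin) !(rin_scal_l _ Hrin) (rin_norm _ Hrin) (rin_sym _ Hrin z w).
rewrite /plus /mult /=; field.
Qed.

Lemma weighted_density_ex k u a b : (forall t, continuous k t) ->
  ex_RInt (fun t => k t * density T xi u t) a b.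
Proof.
move=> Hk; apply: (continuous_RInt_ex (V := R_CompleteNormedModule)) => t.
by apply: (continuous_mult k) => //; apply: density_continuous.
Qed.

(** Integration by parts of the energy identity against a weight k. With a power of t for k, the
    last term is the energy of R u with a lower power: a power of t is traded for a resolvent. *)
Lemma energy_step (k k' : R -> R) u tau : 0 <= tau ->
  (forall t, is_derive k t (k' t)) -> (forall t, continuous k' t) ->
  RInt (fun t => k t * density T xi u t) 0 tau
    - RInt (fun t => k t * density T xi (Vx u) t) 0 tau
  = 2 * (k 0 * norm (Rx u) ^ 2 - k tau * density T xi (Rx u) tau)
    + 2 * RInt (fun t => k' t * density T xi (Rx u) t) 0 tau.
Proof.
move=> Htau Hk Hk'.
have Hkc t : continuous k t by apply: is_derive_continuous (Hk t).
have HI : is_RInt (fun t => -2 * (k' t * psi u t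
      + k t * (- / 2 * (density T xi u t - density T xi (Vx u) t)))) 0 tau
    (minus (-2 * (k tau * psi u tau)) (-2 * (k 0 * psi u 0))).
  apply: (is_RInt_derive (fun t => -2 * (k t * psi u t))) => t;
    rewrite Rmin_left // Rmax_right // => Ht.
  - apply: is_derive_scal.
    exact: is_derive_mult (Hk t) (psi_derive u t (proj1 Ht)) Rmult_comm.
  - apply: (continuous_mult (fun _ => -2)); first exact: continuous_const.
    apply: (continuous_plus (fun t => k' t * psi u t)).
    + apply: (continuous_mult k') => //.
      apply: (is_derive_continuous (V := R_NormedModule)); exact: psi_derive u t (proj1 Ht).
    + apply: (continuous_mult k) => //.
      apply: (continuous_mult (fun _ => - / 2)); first exact: continuous_const.
      apply: (continuous_minus (V := R_NormedModule)); exact: density_continuous.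
have E : psi u 0 = norm (Rx u) ^ 2.
  by rewrite psi_density; [rewrite /density Rabs_R0 (bs_zero _ _ HT) Rmult_0_r exp_0; ring|lra].
rewrite E psi_density // in HI.
have H1 := RInt_correct _ _ _ (weighted_density_ex k u 0 tau Hkc).
have H2 := RInt_correct _ _ _ (weighted_density_ex k (Vx u) 0 tau Hkc).
have H3 := RInt_correct _ _ _ (weighted_density_ex k' (Rx u) 0 tau Hk').
have H4 := is_RInt_minus _ _ _ _ _ _ (is_RInt_minus _ _ _ _ _ _ H1 H2)
  (is_RInt_scal _ _ _ 2 _ H3).
have H5 : is_RInt (fun t => -2 * (k' t * psi u t
      + k t * (- / 2 * (density T xi u t - density T xi (Vx u) t)))) 0 tau
    (minus (minus (RInt (fun t => k t * density T xi u t) 0 tau)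
       (RInt (fun t => k t * density T xi (Vx u) t) 0 tau))
       (scal 2 (RInt (fun t => k' t * density T xi (Rx u) t) 0 tau))).
  apply: is_RInt_ext H4 => t; rewrite Rmin_left // Rmax_right // => Ht.
  rewrite psi_density; last lra.
  rewrite /minus /plus /opp /scal /= /mult /=; field.
have H6 := is_RInt_unique _ _ _ _ HI.
rewrite (is_RInt_unique _ _ _ _ H5) in H6.
move: H6; rewrite /minus /plus /opp /scal /= /mult /=; lra.
Qed.

(* row_energy q u = sum over l_1, ..., l_q < L of |R^q V^(l_1 + ... + l_q) u|^2. *)
Fixpoint row_energy (L q : nat) (u : V) : R :=
  match q with
  | O => norm u ^ 2
  | S q => sum_upto (fun l => row_energy L q (Rx (Nat.iter l Vx u))) L
  end.

Lemma sum_upto_eventually (F : (R -> Prop) -> Prop) {FF : Filter F} (a b : nat -> R -> R)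
    L :
  (forall l eps, 0 < eps -> F (fun t => a l t <= b l t + eps)) ->
  forall eps, 0 < eps -> F (fun t => sum_upto (fun l => a l t) L <= sum_upto (fun l => b l t) L + eps).
Proof.
move=> H; elim: L => [|L IH] eps Heps.
- by apply filter_forall => t /=; lra.
- have He : 0 < eps / 2 by lra.
  apply (filter_and_imp (IH _ He) (H L _ He)) => t /=; lra.
Qed.

Lemma power_exp_decay q l eps : 0 < l -> 0 < eps ->
  exists t0, 0 <= t0 /\ forall t, t0 <= t -> t ^ q * exp (- l * t) < eps.
Proof.
elim: q l eps => [|q IH] l eps Hl' He.
- have [t0 [H0 H1]] := exp_decay l eps Hl' He.
  by exists t0; split=> // t Ht; rewrite /= Rmult_1_l; apply: H1.
- have Hl2 : 0 < l / 2 by lra.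
  have [t0 [H0 H1]] := IH (l / 2) (eps * (l / 2)) Hl2 ltac:(nra).
  exists t0; split=> // t Ht.
  (* Half of the exponent absorbs one factor t at the cost 2 / l; the other half serves the
     induction hypothesis. *)
  have -> : exp (- l * t) = exp (- (l / 2) * t) * exp (- (l / 2) * t).
    by rewrite -exp_plus; congr exp; field.
  have H2 := H1 t Ht.
  have H3 : t * exp (- (l / 2) * t) <= / (l / 2).
    have H4 := exp_ineq1_le (l / 2 * t).
    have E : exp (- (l / 2) * t) * exp (l / 2 * t) = 1.
      by rewrite -exp_plus -exp_0; congr exp; ring.
    have H5 := exp_pos (- (l / 2) * t).
    have H6 : l / 2 * t * exp (- (l / 2) * t) <= 1 by nra.
    apply: (Rmult_le_reg_l (l / 2)) => //; rewrite Rinv_r; lra.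
  have -> : t ^ S q * (exp (- (l / 2) * t) * exp (- (l / 2) * t))
    = (t * exp (- (l / 2) * t)) * (t ^ q * exp (- (l / 2) * t)) by rewrite /=; ring.
  have H7 : 0 <= t ^ q * exp (- (l / 2) * t) by pos.
  apply: Rle_lt_trans (Rmult_le_compat_r _ _ _ H7 H3) _.
  apply: (Rmult_lt_reg_l (l / 2)) => //.
  by rewrite -Rmult_assoc Rinv_r ?Rmult_1_l; lra.
Qed.

Lemma density_power_vanishes q u eps : 0 < eps ->
  Rbar_locally p_infty (fun tau => tau ^ q * density T xi u tau <= eps).
Proof.
move=> He.
have Hk : 0 <= M ^ 2 * norm u ^ 2 by pos.
have [t0 [H0 H1]] := power_exp_decay q (2 * xi) (eps / (M ^ 2 * norm u ^ 2 + 1))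
  ltac:(lra) ltac:(apply: Rdiv_lt_0_compat; lra).
exists t0 => t Ht.
have Ht0 : 0 <= t by lra.
have H2 := Rmult_le_compat_l _ _ _ (pow_le _ q Ht0) (density_le u t Ht0).
have H3 := H1 t (Rlt_le _ _ Ht).
apply: Rle_trans H2 _.
have H4 : 0 <= t ^ q * exp (- (2 * xi) * t) by pos.
have -> : eps = (M ^ 2 * norm u ^ 2 + 1) * (eps / (M ^ 2 * norm u ^ 2 + 1)) by field; lra.
nra.
Qed.

Lemma weighted_energy_ge_0 k u tau : 0 <= tau -> (forall t, continuous k t) ->
  (forall t, 0 <= t -> 0 <= k t) -> 0 <= RInt (fun t => k t * density T xi u t) 0 tau.
Proof.
move=> Ht Hk Hp; apply: RInt_ge_0 => //; first exact: weighted_density_ex.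
by move=> t Ht'; apply: Rmult_le_pos; [apply: Hp; lra|apply: density_ge_0].
Qed.

Lemma pow_derive q t : is_derive (fun t => t ^ q) t (INR q * t ^ pred q).
Proof. by auto_derive => //; ring. Qed.

Lemma pow_continuous q t : continuous (fun t => t ^ q) t.
Proof. exact: (is_derive_continuous (V := R_NormedModule) _ _ _ (pow_derive q t)). Qed.

(** The left sides of the energy identity telescope along u, V u, V^2 u, ...; the remaining energy
    of V^L u is nonnegative and is dropped. *)
Lemma energy_sum (k k' : R -> R) u tau L : 0 <= tau ->
  (forall t, is_derive k t (k' t)) -> (forall t, continuous k' t) ->
  (forall t, 0 <= t -> 0 <= k t) ->
  sum_upto (fun l => k 0 * norm (Rx (Nat.iter l Vx u)) ^ 2
    + RInt (fun t => k' t * density T xi (Rx (Nat.iter l Vx u)) t) 0 tau) L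
  <= / 2 * RInt (fun t => k t * density T xi u t) 0 tau
    + sum_upto (fun l => k tau * density T xi (Rx (Nat.iter l Vx u)) tau) L.
Proof.
move=> Ht Hk Hk' Hp.
have Hkc t : continuous k t by apply: is_derive_continuous (Hk t).
set J := fun u => RInt (fun t => k t * density T xi u t) 0 tau.
have Hs := sum_upto_telescope (fun l => J (Nat.iter l Vx u)) L.
have HJ := weighted_energy_ge_0 k (Nat.iter L Vx u) tau Ht Hkc Hp.
have E : sum_upto (fun l => J (Nat.iter l Vx u) - J (Nat.iter (S l) Vx u)) L
  = 2 * (sum_upto (fun l => k 0 * norm (Rx (Nat.iter l Vx u)) ^ 2
      + RInt (fun t => k' t * density T xi (Rx (Nat.iter l Vx u)) t) 0 tau) L)
    - 2 * sum_upto (fun l => k tau * density T xi (Rx (Nat.iter l Vx u)) tau) L.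
  elim: L {Hs HJ} => [|L IH]; first by rewrite /=; ring.
  rewrite !sum_upto_S IH; have := energy_step k k' (Nat.iter L Vx u) tau Ht Hk Hk'.
  rewrite -/(J _) -/(J (Vx _)) => H.
  change (Nat.iter (S L) Vx u) with (Vx (Nat.iter L Vx u)); lra.
rewrite E in Hs; move: HJ; rewrite -/(J _) => HJ; move: Hs; rewrite [Nat.iter 0 _ _]/=.
rewrite -/(J u); lra.
Qed.

(** Induction on q with the weight t^q. The boundary terms at tau vanish in the limit thanks to
    e^{-2 xi t}; the form [eventually, up to eps] avoids speaking of the improper integrals
    themselves. *)
Lemma row_bound L q u eps : 0 < eps ->
  Rbar_locally p_infty (fun tau =>
    row_energy L (S q) u <= RInt (fun t => t ^ q * density T xi u t) 0 tau + eps).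
Proof.
have Hvanish p e v : 0 < e -> Rbar_locally p_infty (fun tau =>
    sum_upto (fun l => tau ^ p * density T xi (Rx (Nat.iter l Vx v)) tau) L <= e).
  move=> He.
  have H l e' : 0 < e' -> Rbar_locally p_infty (fun tau =>
      tau ^ p * density T xi (Rx (Nat.iter l Vx v)) tau <= 0 + e').
    move=> He'; generalize (density_power_vanishes p (Rx (Nat.iter l Vx v)) e' He').
    by apply filter_imp => t /=; lra.
  generalize (sum_upto_eventually _ _ _ L H e He).
  by apply filter_imp => t; rewrite sum_upto_const; lra.
have Hpos : Rbar_locally p_infty (fun tau => 0 <= tau) by exists 0 => t; lra.
elim: q u eps => [|q IH] u eps Heps.
- apply (filter_and_imp Hpos (Hvanish O eps u Heps)) => tau Htau Hv.
  have H := energy_sum (fun t => t ^ 0) (fun _ => 0) u tau L Htau.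
  have Hz v : RInt (fun t => 0 * density T xi v t) 0 tau = 0.
    rewrite (RInt_ext _ (fun _ => 0)); last by move=> t _; rewrite Rmult_0_l.
    by rewrite RInt_const /scal /= /mult /= Rmult_0_r.
  have HJ := weighted_energy_ge_0 (fun t => t ^ 0) u tau Htau (pow_continuous 0)
    (fun t Ht => Rle_0_1).
  (* Since [0 ^ 0 = 1], the boundary term at 0 of the constant weight is the row energy itself. *)
  have Hs : sum_upto (fun l => 0 ^ 0 * norm (Rx (Nat.iter l Vx u)) ^ 2
      + RInt (fun t => 0 * density T xi (Rx (Nat.iter l Vx u)) t) 0 tau) L
      = row_energy L 1 u.
    rewrite /row_energy; elim: L {H Hv Hvanish} => [|L IHL] //.
    by rewrite !sum_upto_S IHL Hz /=; ring.
  rewrite -Hs; apply: Rle_trans (H _ _ _) _.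
  + by move=> t; apply: (is_derive_const 1).
  + by move=> t; apply: continuous_const.
  + by move=> t _ /=; lra.
  + lra.
- have He : 0 < eps / 2 by lra.
  have H1 := sum_upto_eventually (Rbar_locally p_infty) (FF := @filter_filter _ _ (Rbar_locally_filter p_infty))
    (fun l _ => row_energy L (S q) (Rx (Nat.iter l Vx u)))
    (fun l tau => RInt (fun t => t ^ q * density T xi (Rx (Nat.iter l Vx u)) t) 0 tau) L
    (fun l e He => IH (Rx (Nat.iter l Vx u)) e He) _ He.
  apply (filter_and_imp (filter_and _ _ Hpos H1) (Hvanish (S q) _ u He)) => tau [Htau Hr] Hv.
  have H := energy_sum (fun t => t ^ (S q)) (fun t => INR (S q) * t ^ q) u tau L Htau
    (pow_derive (S q)).
  have Hq : 1 <= INR (S q) by rewrite S_INR; have := pos_INR q; lra.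
  have HJ := weighted_energy_ge_0 (fun t => t ^ (S q)) u tau Htau (pow_continuous (S q))
    (fun t Ht => pow_le _ _ Ht).
  (* For the weight t^(q + 1) the boundary term at 0 vanishes, and the factor q + 1 >= 1 of the
     derivative is dropped. *)
  have Hs : sum_upto (fun l => RInt (fun t => t ^ q * density T xi (Rx (Nat.iter l Vx u)) t) 0 tau) L
     <= sum_upto (fun l => 0 ^ (S q) * norm (Rx (Nat.iter l Vx u)) ^ 2
      + RInt (fun t => INR (S q) * t ^ q * density T xi (Rx (Nat.iter l Vx u)) t) 0 tau) L.
    apply: sum_upto_le => l _; rewrite pow_i; last lia.
    set v := Rx _.
    have HJv := weighted_energy_ge_0 (fun t => t ^ q) v tau Htau (pow_continuous q)
      (fun t Ht => pow_le _ _ Ht).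
    rewrite (RInt_ext (fun t => INR (S q) * t ^ q * density T xi v t)
      (fun t => scal (INR (S q)) (t ^ q * density T xi v t))); last first.
      by move=> t _; rewrite /scal /= /mult /=; ring.
    rewrite RInt_scal; last exact: weighted_density_ex (pow_continuous q).
    move: HJv; set j := RInt _ _ _ => HJv.
    have -> : scal (INR (S q)) j = INR (S q) * j by [].
    nra.
  have H2 := H _ (fun t Ht => pow_le t (S q) Ht).
  apply: Rle_trans Hr _.
  apply: Rle_trans (Rplus_le_compat_r _ _ _ Hs) _.
  apply: Rle_trans (Rplus_le_compat_r _ _ _ (H2 _)) _.
    move=> t; apply: (continuous_mult (fun _ => INR (S q))); first exact: continuous_const.
    exact: pow_continuous.
  lra.
Qed.

(* Each power of R costs one power of t in the energy of the orbit. *)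
Lemma row_bound_sup L q u K :
  (forall tau, 0 <= tau -> RInt (fun t => t ^ q * density T xi u t) 0 tau <= K) ->
  row_energy L (S q) u <= K.
Proof.
move=> HK; apply: le_epsilon => eps Heps.
have [N HN] := row_bound L q u eps Heps.
have Hm := Rmax_l 0 N; have Hm' := Rmax_r 0 N.
apply: Rle_trans (HN (Rmax 0 N + 1) _) _; first lra.
by apply: Rplus_le_compat_r; apply: HK; lra.
Qed.
End Energy.

(** * The controllability estimate *)

Lemma continuous_apply {V W : NormedModule R_AbsRing} (B : R -> V -> W) (w : R -> V) t K :
  locally t (fun s => is_linear (B s) /\ forall v, norm (B s v) <= K * norm v) ->
  continuous (fun s => B s (w t)) t -> continuous w t ->
  continuous (fun s => B s (w s)) t.
Proof.
move=> HB Hb Hw; apply/filterlim_norm_eps => eps Heps.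
have HK : 0 < 2 * (Rabs K + 1) by have := Rabs_pos K; lra.
have He1 : 0 < eps / 2 by lra.
have He2 : 0 < eps / (2 * (Rabs K + 1)) by pos.
apply (filter_and_imp HB (filter_and _ _
  (proj1 (filterlim_norm_eps _ _ _) Hb _ He1)
  (proj1 (filterlim_norm_eps _ _ _) Hw _ He2))) => s [Hlin HBs] [H1 H2].
have -> : minus (B s (w s)) (B t (w t))
  = plus (B s (minus (w s) (w t))) (minus (B s (w t)) (B t (w t))).
  by rewrite (linear_minus _ Hlin); lin_real W.
apply: Rle_lt_trans (norm_triangle _ _) _.
have H3 := HBs (minus (w s) (w t)).
set z := norm (minus (w s) (w t)) in H2 H3.
have Hz : 0 <= z by pos.
have H4 : (Rabs K + 1) * (eps / (2 * (Rabs K + 1))) = eps / 2.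
  by field; have := Rabs_pos K; lra.
have := Rle_abs K; have := Rabs_pos K; nra.
Qed.

Section ShiftedLinear.
Context {V : CompleteNormedModule R_AbsRing} {T : R -> V -> V} {M : R}.
Hypothesis HT : bounded_semigroup T M.

Lemma shifted_resolvent_linear xi : -1 < xi -> is_linear (shifted_resolvent T xi).
Proof. by move=> H; apply: laplace_linear HT _ _; lra. Qed.

Lemma shifted_cayley_linear xi : -1 < xi -> is_linear (shifted_cayley T xi).
Proof.
move=> H; have HR := shifted_resolvent_linear xi H.
split.
- by move=> a b; rewrite /shifted_cayley !(linear_plus _ HR); lin_real V.
- by move=> k a; rewrite /shifted_cayley !(linear_scal _ HR); lin_real V.
- case: (linear_norm _ HR) => K [HK HKn]; exists (1 + 2 * K); split; first lra.
  move=> x; apply: Rle_trans (norm_minus_le _ _) _; rewrite norm_scal_R Rabs_pos_eq; last lra.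
  have := HKn x; lra.
Qed.
End ShiftedLinear.

Section Reachability.
Context {V : CompleteNormedModule R_AbsRing} {T : R -> V -> V} {M : R}.
Context {rin : V -> V -> R}.
Hypothesis HT : bounded_semigroup T M.
Hypothesis Hrin : real_inner_product rin.
Context (xi : R).
Hypothesis Hxi : 0 < xi.

Let Rx := shifted_resolvent T xi.
Let Vx := shifted_cayley T xi.
Let Hl : 0 < 1 + xi. Proof. lra. Qed.
Let Mpos : 0 < M := bs_pos _ _ HT.

Definition shifted_semigroup (t : R) (v : V) : V := scal (exp (- xi * t)) (T (Rabs t) v).
Let S_ := shifted_semigroup.

Lemma shifted_semigroup_linear t : is_linear (S_ t).
Proof.
have HL := bs_linear_abs HT t.
split.
- by move=> x y; rewrite /S_ /shifted_semigroup (linear_plus _ HL) scal_distr_l.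
- by move=> k x; rewrite /S_ /shifted_semigroup (linear_scal _ HL); lin_real V.
- exists (exp (- xi * t) * M); split.
    pos.
  move=> x; rewrite /S_ /shifted_semigroup norm_scal_R Rabs_pos_eq; last pos.
  rewrite Rmult_assoc; apply: Rmult_le_compat_l; first pos.
  exact: (bs_bound _ _ HT _ _ (Rabs_pos t)).
Qed.

Lemma shifted_semigroup_norm t x : norm (S_ t x) <= M * exp (- xi * t) * norm x.
Proof.
rewrite /S_ /shifted_semigroup norm_scal_R Rabs_pos_eq; last pos.
rewrite (Rmult_comm M) Rmult_assoc; apply: Rmult_le_compat_l; first pos.
exact: (bs_bound _ _ HT _ _ (Rabs_pos t)).
Qed.

Lemma shifted_semigroup_continuous w t :
  continuous w t -> continuous (fun s => S_ s (w s)) t.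
Proof.
move=> Hw.
apply: continuous_scal.
  by apply: (ex_derive_continuous (fun t => exp (- xi * t))); auto_derive.
apply: (continuous_apply (fun s v => T (Rabs s) v) w t M) => //.
- apply filter_forall => s; split; first exact: (bs_linear_abs HT).
  by move=> v; apply: (bs_bound _ _ HT _ _ (Rabs_pos s)).
- exact: bs_continuous HT _ _.
Qed.

(* [reachable U E]: the state U = int_0^oo S(t) f(t) dt is reached by an input f
   of energy at most E. *)
Definition reachable (U : V) (E : R) : Prop :=
  exists f : R -> V, (forall t, continuous f t) /\
    (forall tau, 0 <= tau -> RInt (fun t => norm (f t) ^ 2) 0 tau <= E) /\
    filterlim (fun tau => RInt (fun t => S_ t (f t)) 0 tau)
      (Rbar_locally p_infty) (locally U).

Lemma reachable_zero : reachable zero 0.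
Proof.
exists (fun _ => zero); split; [|split].
- by move=> t; apply: continuous_const.
- move=> tau _; rewrite (RInt_ext _ (fun _ => 0)).
    by rewrite RInt_const /scal /= /mult /=; lra.
  by move=> t _; rewrite norm_zero /=; ring.
- apply: (filterlim_ext (fun _ => zero)); last exact: filterlim_const.
  move=> tau; rewrite (RInt_ext _ (fun _ => zero)).
    by rewrite RInt_const scal_zero_r.
  by move=> t _; apply: linear_zero; apply: shifted_semigroup_linear.
Qed.

Lemma norm2_ex (f : R -> V) a b : (forall t, continuous f t) ->
  ex_RInt (fun t => norm (f t) ^ 2) a b.
Proof.
move=> Hf; apply: (continuous_RInt_ex (V := R_CompleteNormedModule)) => t.
exact: continuous_norm2.
Qed.

(** The Cauchy-Schwarz inequality for integrals in the form of a weighted mean inequality for every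
    mu; mu = 2 xi a / M turns the first term into a / 2. *)
Lemma cauchy_schwarz_optimize a E : 0 <= a -> 0 <= E ->
  (forall mu, 0 < mu -> a <= M / 2 * (mu / (2 * xi) + E / mu)) ->
  a ^ 2 <= M ^ 2 / (2 * xi) * E.
Proof.
move=> Ha HE H.
have Hc : 0 <= M ^ 2 / (2 * xi) by pos.
case: (Req_dec a 0) => [->|Ha0].
  have -> : 0 ^ 2 = 0 by ring.
  pos.
have Ha1 : 0 < a by lra.
have := H (2 * xi * a / M) ltac:(apply: Rdiv_lt_0_compat => //; nra).
have -> : M / 2 * (2 * xi * a / M / (2 * xi) + E / (2 * xi * a / M))
  = a / 2 + M ^ 2 / (2 * xi) * E / (2 * a) by field; lra.
move=> H1.
have H2 : a / 2 <= M ^ 2 / (2 * xi) * E / (2 * a) by lra.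
have H3 := Rmult_le_compat_l (2 * a) _ _ ltac:(lra) H2.
have E1 : 2 * a * (a / 2) = a ^ 2 by field.
have E2 : 2 * a * (M ^ 2 / (2 * xi) * E / (2 * a)) = M ^ 2 / (2 * xi) * E by field; lra.
lra.
Qed.

Lemma reachable_norm U E : reachable U E -> norm U ^ 2 <= M ^ 2 / (2 * xi) * E.
Proof.
move=> [f [Hc [HE Hlim]]].
have HE0 : 0 <= E by have := HE 0 (Rle_refl _); rewrite RInt_point.
apply: cauchy_schwarz_optimize => //; first pos.
move=> mu Hmu.
have Hn : filterlim (fun tau => norm (RInt (fun t => S_ t (f t)) 0 tau))
    (Rbar_locally p_infty) (locally (norm U)).
  exact: (filterlim_comp _ _ _ _ norm _ _ _ Hlim (filterlim_norm U)).
have Hsc : forall t, continuous (fun t => S_ t (f t)) t.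
  by move=> t; apply: shifted_semigroup_continuous.
apply: (filterlim_le (F := Rbar_locally p_infty)
  (fun tau => norm (RInt (fun t => S_ t (f t)) 0 tau))
  (fun _ => M / 2 * (mu / (2 * xi) + E / mu)) (norm U)
  (M / 2 * (mu / (2 * xi) + E / mu))) => //; last exact: filterlim_const.
exists 0 => tau Htau.
have Htau' : 0 <= tau by lra.
have HI1 := is_RInt_exp (M / 2 * mu) (2 * xi) 0 tau ltac:(lra).
have HI2 := is_RInt_scal _ _ _ (M / 2 / mu) _ (RInt_correct _ _ _ (norm2_ex f 0 tau Hc)).
have HI := is_RInt_plus _ _ _ _ _ _ HI1 HI2.
have := norm_RInt_le _ _ _ _ _ _ Htau' _
  (RInt_correct _ _ _ (continuous_RInt_ex _ 0 tau Hsc)) HI.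
move=> H; apply: Rle_trans (H _) _.
- move=> t Ht; apply: Rle_trans (shifted_semigroup_norm _ _) _.
  rewrite /plus /scal /= /mult /= Rmult_1_r.
  have -> : exp (- (2 * xi) * t) = exp (- xi * t) * exp (- xi * t).
    by rewrite -exp_plus; congr exp; ring.
  set e := exp _; set n := norm (f t).
  (* The pointwise weighted mean inequality: the defect is a multiple of a square. *)
  have -> : M / 2 * mu * (e * e) + M / 2 / mu * (n * n)
     = M * e * n + M / (2 * mu) * (mu * e - n) ^ 2 by field; lra.
  have : 0 <= M / (2 * mu) * (mu * e - n) ^ 2.
    apply: Rmult_le_pos; last pos.
    pos.
  lra.
- rewrite /plus /scal /= /mult /= Rmult_0_r exp_0.
  have H1 := HE tau Htau'.
  have H2 := exp_pos (- (2 * xi) * tau).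
  have -> : M / 2 * (mu / (2 * xi) + E / mu) = M / 2 * mu / (2 * xi) + M / 2 / mu * E by field; lra.
  apply: Rplus_le_compat.
  + have : 0 < M / 2 * mu / (2 * xi) by apply: Rdiv_lt_0_compat; nra.
    nra.
  + apply: Rmult_le_compat_l => //.
    pos.
Qed.

(* The C^1 extension of t |-> S(t) R v to the real line. *)
Let O_ t v := scal (exp (- xi * t)) (laplace_orbit (T := T) (1 + xi) v t).

Lemma extended_orbit_eq t v : 0 <= t -> O_ t v = S_ t (Rx v).
Proof.
by move=> Ht; rewrite /O_ /S_ /shifted_semigroup (laplace_orbit_eq HT) // Rabs_pos_eq.
Qed.

Lemma extended_orbit_derive v t : is_derive (fun t => O_ t v) t (minus (O_ t v) (S_ t v)).
Proof.
have H1 : is_derive (fun t => exp (- xi * t)) t (- xi * exp (- xi * t)).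
  by auto_derive => //; ring.
have H2 := is_derive_scal_fun _ _ _ _ _ H1 (laplace_orbit_derive HT (1 + xi) v t).
have -> : minus (O_ t v) (S_ t v) = plus
  (scal (- xi * exp (- xi * t)) (laplace_orbit (T := T) (1 + xi) v t))
  (scal (exp (- xi * t)) (minus (scal (1 + xi) (laplace_orbit (T := T) (1 + xi) v t)) (T (Rabs t) v))).
  by rewrite /O_ /S_ /shifted_semigroup; move: (laplace_orbit _ _ _) => z; lin_real V.
exact: H2.
Qed.

Lemma laplace_partial_norm_abs l u t : 0 <= l ->
  norm (laplace_partial T l u t) <= Rabs t * (exp (l * Rabs t) * (M * norm u)).
Proof.
move=> Hl0.
have Hb s : Rabs s <= Rabs t ->
    norm (scal (exp (- l * s)) (T (Rabs s) u)) <= exp (l * Rabs t) * (M * norm u).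
  move=> Hs; rewrite norm_scal_R Rabs_pos_eq; last pos.
  apply: Rmult_le_compat; [exact: Rlt_le (exp_pos _)|exact: norm_ge_0| |].
  - apply: exp_mono; have := Rle_abs (- s); rewrite Rabs_Ropp => H.
    have : l * (- s) <= l * Rabs t by apply: Rmult_le_compat_l; lra.
    lra.
  - exact: (bs_bound _ _ HT _ _ (Rabs_pos s)).
set c := exp (l * Rabs t) * (M * norm u) in Hb *.
case: (Rle_dec 0 t) => Ht.
- have -> : Rabs t * c = (t - 0) * c by rewrite Rabs_pos_eq //; ring.
  apply: (norm_RInt_le_const _ _ _ _ _ Ht); last exact: RInt_correct (laplace_partial_ex HT _ _ _ _).
  by move=> s Hs; apply: Hb; rewrite !Rabs_pos_eq; lra.
- have Ht' : t <= 0 by lra.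
  have -> : Rabs t * c = (0 - t) * c by rewrite Rabs_left; [ring|lra].
  rewrite /laplace_partial -(opp_RInt_swap _ t 0); last exact: laplace_partial_ex HT _ _ _ _.
  rewrite norm_opp.
  apply: (norm_RInt_le_const _ _ _ _ _ Ht'); last exact: RInt_correct (laplace_partial_ex HT _ _ _ _).
  by move=> s Hs; apply: Hb; rewrite !Rabs_left1; lra.
Qed.

Lemma extended_orbit_linear t : is_linear (O_ t).
Proof.
have HL := laplace_linear HT _ Hl.
split.
- move=> x y; rewrite /O_ /laplace_orbit (linear_plus _ HL) (laplace_partial_plus HT); lin_real V.
- move=> k x; rewrite /O_ /laplace_orbit (linear_scal _ HL) (laplace_partial_scal HT); lin_real V.
- exists (exp (- xi * t) * (exp ((1 + xi) * t) * (M / (1 + xi) + Rabs t * (exp ((1 + xi) * Rabs t) * M)))).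
  have H0 : 0 < M / (1 + xi) + Rabs t * (exp ((1 + xi) * Rabs t) * M) by pos.
  split.
    pos.
  move=> x; rewrite /O_ /laplace_orbit !norm_scal_R !(Rabs_pos_eq (exp _)); try exact: Rlt_le (exp_pos _).
  rewrite !Rmult_assoc; apply: Rmult_le_compat_l; first pos.
  apply: Rmult_le_compat_l; first pos.
  apply: Rle_trans (norm_minus_le _ _) _.
  have H1 := laplace_norm HT (1 + xi) x Hl.
  have H2 := laplace_partial_norm_abs (1 + xi) x t (Rlt_le _ _ Hl).
  rewrite Rmult_plus_distr_r !Rmult_assoc; lra.
Qed.

(** The local bound that the product rule asks for, on both sides of t; the extension of the orbit
    to negative times may grow, so the constant depends on t. *)
Lemma extended_orbit_bounded t : exists K, locally t (fun s => is_linear (O_ s) /\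
  forall v, norm (O_ s v) <= K * norm v).
Proof.
set a := Rabs t + 1.
have Ha : 0 <= a by pos.
exists (exp (xi * a) * (exp ((1 + xi) * a) * (M / (1 + xi) + a * (exp ((1 + xi) * a) * M)))).
exists (mkposreal 1 Rlt_0_1) => s Hs; split; first exact: extended_orbit_linear.
have Hsa : Rabs s <= a.
  have H1 : Rabs (s - t) < 1 by exact: Hs.
  have := Rabs_triang_inv s t; rewrite /a; lra.
have Hsa1 : - s <= a by have := Rle_abs (- s); rewrite Rabs_Ropp; lra.
have Hsa2 : s <= a by have := Rle_abs s; lra.
move=> v; rewrite /O_ /laplace_orbit !norm_scal_R !(Rabs_pos_eq (exp _)); try exact: Rlt_le (exp_pos _).
rewrite !Rmult_assoc; apply: Rmult_le_compat; [exact: Rlt_le (exp_pos _)| | |].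
- pos.
- by apply: exp_mono; nra.
- apply: Rmult_le_compat; [exact: Rlt_le (exp_pos _)|exact: norm_ge_0| |].
    by apply: exp_mono; nra.
  apply: Rle_trans (norm_minus_le _ _) _.
  have H1 := laplace_norm HT (1 + xi) v Hl.
  have H2 := laplace_partial_norm_abs (1 + xi) v s (Rlt_le _ _ Hl).
  have H3 : Rabs s * (exp ((1 + xi) * Rabs s) * (M * norm v)) <= a * (exp ((1 + xi) * a) * (M * norm v)).
    have Hn : 0 <= M * norm v by pos.
    apply: Rmult_le_compat => //; first pos.
    - pos.
    - by apply: Rmult_le_compat_r => //; apply: exp_mono; apply: Rmult_le_compat_l; lra.
  rewrite Rmult_plus_distr_r !Rmult_assoc; lra.
Qed.

(* The input is passed through the all-pass filter f |-> f - 2 w, where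
   w' = - w + f; the initial value w(0) = - y / 2 adds the impulse e^{-t} y. *)
Lemma reachable_step U E y : reachable U E ->
  reachable (plus (Vx U) (Rx y)) (E + norm y ^ 2 / 2).
Proof.
move=> [f [Hf [HE Hlim]]].
have He t : continuous (fun t => exp t) t by apply: (ex_derive_continuous exp); auto_derive.
have Hk t : continuous (fun t => scal (exp t) (f t)) t by apply: continuous_scal.
(* Duhamel's formula for w' = f - w. The value - y / 2 at 0 contributes 2 |w(0)|^2 = |y|^2 / 2 to
   the energy and - 2 R w(0) = R y to the state. *)
pose w t := scal (exp (- t)) (plus (scal (- / 2) y) (RInt (fun t => scal (exp t) (f t)) 0 t)).
have Hw t : is_derive w t (minus (f t) (w t)).
  have H1 : is_derive (fun t => exp (- t)) t (- exp (- t)) by auto_derive => //; ring.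
  have H2 : is_derive (fun t => plus (scal (- / 2) y) (RInt (fun t => scal (exp t) (f t)) 0 t)) t
      (plus zero (scal (exp t) (f t))).
    apply: is_derive_plus; first exact: is_derive_const.
    apply (is_derive_RInt (fun t => scal (exp t) (f t)) _ 0 t) => //.
    by apply filter_forall => s; apply: RInt_correct; apply: continuous_RInt_ex.
  have E1 : exp (- t) * exp t = 1 by rewrite -exp_plus -exp_0; congr exp; ring.
  have -> : minus (f t) (w t) = plus
     (scal (- exp (- t)) (plus (scal (- / 2) y) (RInt (fun t => scal (exp t) (f t)) 0 t)))
     (scal (exp (- t)) (plus zero (scal (exp t) (f t)))).
    by rewrite /w; lin_real V; lra.
  exact: is_derive_scal_fun.
have Hwc t : continuous w t by apply: is_derive_continuous (Hw t).
have Hw0 : w 0 = scal (- / 2) y.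
  by rewrite /w RInt_point Ropp_0 exp_0; lin_real V.
clearbody w.
have Hg t : continuous (fun t => minus (f t) (scal 2 (w t))) t.
  apply: continuous_minus => //.
  by apply: (continuous_scal_r 2 w).
(* By the equation of w, |f - 2 w|^2 = |f|^2 - 2 (|w|^2)': the filter changes the energy by boundary
   terms only. *)
have Hener tau : 0 <= tau -> RInt (fun t => norm (minus (f t) (scal 2 (w t))) ^ 2) 0 tau
    = RInt (fun t => norm (f t) ^ 2) 0 tau + norm y ^ 2 / 2 - 2 * norm (w tau) ^ 2.
  move=> Htau.
  have HI : is_RInt (fun t => -2 * (2 * rin (w t) (minus (f t) (w t)))) 0 tau
      (minus (-2 * norm (w tau) ^ 2) (-2 * norm (w 0) ^ 2)).
    apply: (is_RInt_derive (fun t => -2 * norm (w t) ^ 2)) => t _.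
    - apply: is_derive_scal; exact: is_derive_norm2 Hrin _ _ _ (Hw t).
    - apply: (continuous_ext (fun t => norm (minus (f t) (scal 2 (w t))) ^ 2 - norm (f t) ^ 2)).
        move=> s; move: (w s) (f s) => z v.
        rewrite (rin_self_minus Hrin) -(rin_norm _ Hrin (scal 2 z)) (rin_minus_r Hrin)
          !(rin_scal_r Hrin) (rin_scal_l _ Hrin) (rin_sym _ Hrin z v); real_eq; ring.
      by apply: (continuous_minus (V := R_NormedModule)); apply: continuous_norm2.
  have H1 := RInt_correct _ _ _ (norm2_ex f 0 tau Hf).
  have H2 := is_RInt_plus _ _ _ _ _ _ H1 HI.
  apply: is_RInt_unique.
  have -> : RInt (fun t => norm (f t) ^ 2) 0 tau + norm y ^ 2 / 2 - 2 * norm (w tau) ^ 2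
    = plus (RInt (fun t => norm (f t) ^ 2) 0 tau)
       (minus (-2 * norm (w tau) ^ 2) (-2 * norm (w 0) ^ 2)).
    rewrite Hw0 norm_scal_R Rabs_left; last lra.
    rewrite /plus /minus /opp /= /plus /=.
    real_eq; field.
  apply: is_RInt_ext H2 => t _; move: (w t) (f t) => z v.
  rewrite (rin_self_minus Hrin) -(rin_norm _ Hrin (scal 2 z)) (rin_minus_r Hrin)
     !(rin_scal_r Hrin) (rin_scal_l _ Hrin) (rin_sym _ Hrin z v) /plus /=; real_eq; ring.
exists (fun t => minus (f t) (scal 2 (w t))); split; [exact: Hg|split].
  move=> tau Htau; rewrite Hener //; have := HE tau Htau; have := pow2_ge_0 (norm (w tau)); lra.
have HRl : is_linear Rx by exact: laplace_linear HT _ Hl.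
have Hint tau : 0 <= tau -> RInt (fun t => S_ t (minus (f t) (scal 2 (w t)))) 0 tau
    = plus (plus (Vx (RInt (fun t => S_ t (f t)) 0 tau)) (Rx y)) (scal 2 (O_ tau (w tau))).
  move=> Htau.
  have HSf t : continuous (fun t => S_ t (f t)) t by apply: shifted_semigroup_continuous.
  have HSw t : continuous (fun t => S_ t (w t)) t by apply: shifted_semigroup_continuous.
  (* The derivative of S(t) R w(t) is S R w - S w + S R (f - w) = R S f - S w. Hence the integral of
     S w is R applied to that of S f, up to boundary terms. *)
  have HI : is_RInt (fun t => minus (Rx (S_ t (f t))) (S_ t (w t))) 0 tau
      (minus (O_ tau (w tau)) (O_ 0 (w 0))).
    apply: (is_RInt_derive (fun t => O_ t (w t))) => t; rewrite Rmin_left // Rmax_right // => Ht.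
    - have [K HK] := extended_orbit_bounded t.
      have := is_derive_apply O_ w t K _ _ HK (extended_orbit_derive (w t) t) _ (Hw t).
      have -> : plus (minus (O_ t (w t)) (S_ t (w t))) (O_ t (minus (f t) (w t)))
         = minus (Rx (S_ t (f t))) (S_ t (w t)).
        rewrite (linear_minus _ (extended_orbit_linear t)) (extended_orbit_eq t (f t) (proj1 Ht)).
        have -> : S_ t (Rx (f t)) = Rx (S_ t (f t)).
          rewrite /S_ /shifted_semigroup (linear_scal _ HRl); congr (scal _ _).
          apply: laplace_semigroup HT _ _ _ Hl (Rabs_pos t).
        lin_real V.
      apply; apply: is_derive_continuous; exact: extended_orbit_derive.
    - apply: continuous_minus => //; exact: is_linear_continuous HRl (HSf t).
  have H1 := RInt_correct _ _ _ (continuous_RInt_ex _ 0 tau HSf).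
  have H2 := is_RInt_linear Rx _ _ _ _ HRl H1.
  have H3 := is_RInt_plus _ _ _ _ _ _ (is_RInt_minus _ _ _ _ _ _ H1 (is_RInt_scal _ _ _ 2 _ H2))
     (is_RInt_scal _ _ _ 2 _ HI).
  apply: is_RInt_unique.
  set I := RInt _ _ _ in H1 H2 H3 *.
  have -> : plus (plus (Vx I) (Rx y)) (scal 2 (O_ tau (w tau)))
    = plus (minus I (scal 2 (Rx I))) (scal 2 (minus (O_ tau (w tau)) (O_ 0 (w 0)))).
    have -> : O_ 0 (w 0) = scal (- / 2) (Rx y).
      rewrite extended_orbit_eq ?Hw0; last lra.
      rewrite /S_ /shifted_semigroup Rabs_R0 (bs_zero _ _ HT) Rmult_0_r exp_0 (linear_scal _ HRl).
      lin_real V.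
    rewrite /Vx /shifted_cayley -/Rx; move: (O_ tau (w tau)) => z; lin_real V.
  apply: is_RInt_ext H3 => t _.
  rewrite (linear_minus _ (shifted_semigroup_linear t)) (linear_scal _ (shifted_semigroup_linear t)).
  lin_real V.
(* The output has nonnegative energy, so 2 |w|^2 is bounded by the energy supplied; meanwhile S(t) R
   decays exponentially. *)
have Hvan : filterlim (fun tau => O_ tau (w tau)) (Rbar_locally p_infty) (locally (zero : V)).
  apply/filterlim_norm_eps => eps Heps.
  set E' := E + norm y ^ 2 / 2 + 1.
  have HwE tau : 0 <= tau -> norm (w tau) <= E'.
    move=> Htau; have H1 := Hener tau Htau; have H2 := HE tau Htau.
    have H3 : 0 <= RInt (fun t => norm (minus (f t) (scal 2 (w t))) ^ 2) 0 tau.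
      apply: RInt_ge_0 => //; first exact: norm2_ex.
      by move=> t _; apply: pow2_ge_0.
    have : norm (w tau) ^ 2 <= E' - 1 by rewrite /E'; have := pow2_ge_0 (norm (w tau)); lra.
    have := pow2_ge_0 (norm (w tau) - 1); rewrite /=; nra.
  have HE' : 0 < E'.
    have := HE 0 (Rle_refl _); rewrite RInt_point /E' /zero /=; have := pow2_ge_0 (norm y); rewrite /=; lra.
  have HMl : 0 < M / (1 + xi) by pos.
  have HC : 0 < M * (M / (1 + xi) * E') by pos.
  have [t0 [Ht0 Hd]] := exp_decay xi (eps / (M * (M / (1 + xi) * E'))) Hxi
    ltac:(apply: Rdiv_lt_0_compat => //).
  exists t0 => tau Htau.
  have Htau0 : 0 <= tau by lra.
  rewrite minus_zero_r extended_orbit_eq //.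
  apply: Rle_lt_trans (shifted_semigroup_norm _ _) _.
  have H1 := laplace_norm HT (1 + xi) (w tau) Hl.
  have H2 := HwE tau Htau0.
  have H3 := Hd tau (Rlt_le _ _ Htau).
  have H4 := exp_pos (- xi * tau).
  have H5 : norm (Rx (w tau)) <= M / (1 + xi) * E' by apply: Rle_trans H1 _; apply: Rmult_le_compat_l; lra.
  apply: Rle_lt_trans (_ : M * exp (- xi * tau) * (M / (1 + xi) * E') < _).
    apply: Rmult_le_compat_l => //; apply: Rmult_le_pos; lra.
  have -> : eps = M * (M / (1 + xi) * E') * (eps / (M * (M / (1 + xi) * E'))) by field; lra.
  have -> : M * exp (- xi * tau) * (M / (1 + xi) * E') = M * (M / (1 + xi) * E') * exp (- xi * tau) by ring.
  exact: Rmult_lt_compat_l.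
have HVl : is_linear Vx by apply: (shifted_cayley_linear HT); lra.
generalize (filterlim_plus_fun _ _ _ _ (filterlim_plus_fun _ _ _ _
  (filterlim_linear Vx _ _ HVl Hlim) (filterlim_const (Rx y))) (filterlim_scal_r_fun 2 _ _ Hvan)).
rewrite scal_zero_r plus_zero_r => H.
apply: (filterlim_ext_loc _ _ _ H).
by exists 0 => tau Htau; rewrite Hint //; lra.
Qed.
End Reachability.

(** * Powers of the shifted Cayley transform *)

Lemma iter_commute {X : Type} (B C : X -> X) n x :
  (forall x, B (C x) = C (B x)) -> Nat.iter n B (C x) = C (Nat.iter n B x).
Proof. by move=> H; elim: n => [|n IH] //=; rewrite IH H. Qed.

Lemma iter_linear {V : NormedModule R_AbsRing} (B : V -> V) n :
  is_linear B -> is_linear (Nat.iter n B).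
Proof.
move=> HB; elim: n => [|n IH]; first exact: is_linear_id.
exact: (is_linear_comp (Nat.iter n B) B IH HB).
Qed.

Section PowerBounds.
Context {V : CompleteNormedModule R_AbsRing} {T : R -> V -> V} {M : R}.
Context {rin : V -> V -> R}.
Hypothesis HT : bounded_semigroup T M.
Hypothesis Hrin : real_inner_product rin.
Let Mpos : 0 < M := bs_pos _ _ HT.

Lemma shifted_cayley_commute xi (B : V -> V) : -1 < xi -> is_linear B ->
  (forall x, B (shifted_resolvent T xi x) = shifted_resolvent T xi (B x)) ->
  forall x, B (shifted_cayley T xi x) = shifted_cayley T xi (B x).
Proof.
move=> H HB Hc x.
by rewrite /shifted_cayley (linear_minus _ HB) (linear_scal _ HB) Hc.
Qed.

Lemma cayley_resolvent xi n x : -1 < xi ->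
  Nat.iter n (shifted_cayley T xi) (shifted_resolvent T xi x)
  = shifted_resolvent T xi (Nat.iter n (shifted_cayley T xi) x).
Proof.
move=> H; apply: iter_commute => z; symmetry; apply: shifted_cayley_commute => //.
exact: (shifted_resolvent_linear HT).
Qed.

Lemma cayley_resolvent_iter xi n m x : -1 < xi ->
  Nat.iter n (shifted_cayley T xi) (Nat.iter m (shifted_resolvent T xi) x)
  = Nat.iter m (shifted_resolvent T xi) (Nat.iter n (shifted_cayley T xi) x).
Proof.
move=> H; elim: m => [|m IH] //=; by rewrite cayley_resolvent // IH.
Qed.

Section FixedShift.
Context (xi : R).
Hypothesis Hxi : 0 < xi.
Let Hxi1 : -1 < xi. Proof. lra. Qed.
Let Rx := shifted_resolvent T xi.
Let Vx := shifted_cayley T xi.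

Lemma reachable_iter U E m : reachable (T := T) xi U E ->
  reachable (T := T) xi (Nat.iter m Vx U) E.
Proof.
move=> H; elim: m => [|m IH] //=.
have := reachable_step HT Hrin xi Hxi _ _ zero IH.
rewrite (linear_zero _ (shifted_resolvent_linear HT xi Hxi1)) plus_zero_r norm_zero.
by have -> : E + 0 ^ 2 / 2 = E by field.
Qed.

(** With y = R V^l u at step l, the impulses R R V^l u are carried by the later steps onto one and
    the same vector V^L R^2 u and add up coherently: the state has the factor L, while the energy is
    only half the sum of the |R V^l u|^2. One more V is applied to U so that L = 0 is no
    exception. *)
Lemma reachable_column L u : exists U,
  reachable (T := T) xi U (/ 2 * row_energy (T := T) xi L 1 u) /\
  Vx U = scal (INR L) (Nat.iter L Vx (Rx (Rx u))).
Proof.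
have HV : is_linear Vx by exact: (shifted_cayley_linear HT).
elim: L => [|L [U [H1 H2]]].
- exists zero; split.
    by rewrite /= Rmult_0_r; apply: reachable_zero HT _.
  by rewrite (linear_zero _ HV) /=; lin_real V.
- exists (plus (Vx U) (Rx (Rx (Nat.iter L Vx u)))); split.
    have := reachable_step HT Hrin xi Hxi _ _ (Rx (Nat.iter L Vx u)) H1.
    congr (reachable _ _ _); rewrite /row_energy sum_upto_S /Rx /Vx; real_eq; field.
  rewrite (linear_plus _ HV) H2 (linear_scal _ HV).
  have -> : Rx (Rx (Nat.iter L Vx u)) = Nat.iter L Vx (Rx (Rx u)).
    by rewrite /Rx /Vx !cayley_resolvent.
  rewrite S_INR /=; set z := Vx (Nat.iter _ _ _); lin_real V.
Qed.

Lemma column_bound L n u : (L <= n)%nat ->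
  INR L ^ 2 * norm (Nat.iter n Vx (Rx (Rx u))) ^ 2
    <= M ^ 2 / (4 * xi) * row_energy (T := T) xi L 1 u.
Proof.
move=> Hn.
have [U [H1 H2]] := reachable_column L u.
(* Further steps without impulse leave the energy unchanged, and V^(n - L + 1) U = L V^n R^2 u. *)
have H3 := reachable_norm HT xi Hxi _ _ (reachable_iter _ _ (S (n - L)) H1).
have E : Nat.iter (S (n - L)) Vx U = scal (INR L) (Nat.iter n Vx (Rx (Rx u))).
  rewrite Nat.iter_succ_r H2 (linear_scal _ (iter_linear _ _ (shifted_cayley_linear HT xi Hxi1))).
  by rewrite -Nat.iter_add; congr (scal _ (Nat.iter _ _ _)); lia.
rewrite E norm_scal_R Rabs_pos_eq in H3; last pos.
rewrite Rpow_mult_distr in H3.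
have -> : M ^ 2 / (4 * xi) * row_energy (T := T) xi L 1 u
   = M ^ 2 / (2 * xi) * (/ 2 * row_energy (T := T) xi L 1 u) by field; lra.
exact: H3.
Qed.

(** For each l < L, V^n R^(q + 3) u = V^(n - l) R^(q + 2) (R V^l u). Summing the induction
    hypothesis over l gains one factor L on the left and one index of the row energy on the right; q
    + 1 blocks of length L must fit into n. *)
Lemma power_row_bound L q : forall n u, (S q * L <= n)%nat ->
  INR L ^ (S (S q)) * norm (Nat.iter n Vx (Nat.iter (S (S q)) Rx u)) ^ 2
    <= M ^ 2 / (4 * xi) * row_energy (T := T) xi L (S q) u.
Proof.
elim: q => [|q IH] n u Hn.
  by apply: column_bound; lia.
have H l : (l < L)%nat ->
    INR L ^ (S (S q)) * norm (Nat.iter n Vx (Nat.iter (S (S (S q))) Rx u)) ^ 2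
    <= M ^ 2 / (4 * xi) * row_energy (T := T) xi L (S q) (Rx (Nat.iter l Vx u)).
  move=> Hlt.
  have := IH (n - l)%nat (Rx (Nat.iter l Vx u)) ltac:(nia).
  have -> // : Nat.iter (n - l) Vx (Nat.iter (S (S q)) Rx (Rx (Nat.iter l Vx u)))
    = Nat.iter n Vx (Nat.iter (S (S (S q))) Rx u).
  rewrite -Nat.iter_succ_r /Rx /Vx -cayley_resolvent_iter // -Nat.iter_add.
  by have -> : (n - l + l = n)%nat by lia.
have := sum_upto_le _ _ L H.
rewrite sum_upto_const sum_upto_scal => H1.
apply: Rle_trans H1; right; rewrite -tech_pow_Rmult; ring.
Qed.

(** The weight e^{-2 xi t} is split: one half enters the pointwise bound kappa, the integral of the
    other half is at most 1 / xi. *)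
Lemma energy_exp_bound q u kappa : 0 <= kappa ->
  (forall t, 0 < t -> t ^ q * norm (T t u) ^ 2 * exp (- xi * t) <= kappa) ->
  forall tau, 0 <= tau ->
  RInt (fun t => t ^ q * density T xi u t) 0 tau <= kappa / xi.
Proof.
move=> Hk H tau Htau.
have HI := is_RInt_exp kappa xi 0 tau ltac:(lra).
have H1 := RInt_correct _ _ _ (weighted_density_ex HT xi (fun t => t ^ q) u 0 tau (pow_continuous q)).
apply: Rle_trans (is_RInt_le _ _ _ _ _ _ Htau H1 HI _) _.
- move=> t Ht; rewrite /density Rabs_pos_eq; last lra.
  have -> : exp (- (2 * xi) * t) = exp (- xi * t) * exp (- xi * t).
    by rewrite -exp_plus; congr exp; ring.
  have := H t ltac:(lra); have := exp_pos (- xi * t) => H2 H3.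
  have -> : t ^ q * (exp (- xi * t) * exp (- xi * t) * norm (T t u) ^ 2)
    = (t ^ q * norm (T t u) ^ 2 * exp (- xi * t)) * exp (- xi * t) by ring.
  by apply: Rmult_le_compat_r; lra.
- rewrite Rmult_0_r exp_0; have := exp_pos (- xi * tau).
  have : 0 <= kappa / xi by apply: Rmult_le_pos => //; apply: Rlt_le; apply: Rinv_0_lt_compat.
  nra.
Qed.

Lemma cayley_power_bound q u kappa n : 0 <= kappa ->
  (forall t, 0 < t -> t ^ q * norm (T t u) ^ 2 * exp (- xi * t) <= kappa) ->
  (S q <= n)%nat ->
  norm (Nat.iter n Vx (Nat.iter (S (S q)) Rx u)) ^ 2
  <= M ^ 2 / 4 * (2 * INR (S q)) ^ (S (S q)) * (kappa / (xi ^ 2 * INR n ^ (S (S q)))).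
Proof.
move=> Hk H Hn.
(* The longest block of which q + 1 copies fit into n; as q + 1 <= n, it satisfies n <= 2 (q + 1)
   L. *)
pose L := (n / S q)%nat.
have HL1 : (S q * L <= n)%nat by apply: Nat.Div0.mul_div_le.
have HL2 : (n < S q * S L)%nat by apply: Nat.mul_succ_div_gt.
have HL3 : (1 <= L)%nat by apply: Nat.div_le_lower_bound; lia.
have H1 := power_row_bound L q n u HL1.
have H2 := row_bound_sup HT Hrin xi Hxi L q u _ (energy_exp_bound q u kappa Hk H).
set b := S (S q) in H1 *.
set z := norm _ in H1 *.
have Hq : 0 < INR (S q) by pos.
have HLn : INR n <= 2 * INR (S q) * INR L.
  have : (n <= 2 * S q * L)%nat by nia.
  by move=> /le_INR; rewrite !mult_INR.
have HLpos : 0 < INR L by pos.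
have Hnpos : 0 < INR n by pos.
have H3 : INR n ^ b <= (2 * INR (S q)) ^ b * INR L ^ b.
  by rewrite -Rpow_mult_distr; apply: pow_incr; split; lra.
have Hnb : 0 < INR n ^ b by pos.
have HLb : 0 < INR L ^ b by pos.
have H4 : INR L ^ b * z ^ 2 <= M ^ 2 / (4 * xi) * (kappa / xi).
  apply: Rle_trans H1 _; apply: Rmult_le_compat_l => //.
  pos.
apply: (Rmult_le_reg_l (INR n ^ b)) => //.
have -> : INR n ^ b * (M ^ 2 / 4 * (2 * INR (S q)) ^ b * (kappa / (xi ^ 2 * INR n ^ b)))
  = (2 * INR (S q)) ^ b * (M ^ 2 / (4 * xi) * (kappa / xi)) by field; lra.
have Hqb : 0 < (2 * INR (S q)) ^ b by pos.
apply: Rle_trans (_ : (2 * INR (S q)) ^ b * (INR L ^ b * z ^ 2) <= _); last first.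
  by apply: Rmult_le_compat_l => //; lra.
rewrite -Rmult_assoc; apply: Rmult_le_compat_r => //; exact: pow2_ge_0.
Qed.

(** The last term of a row energy of order 1. With a single resolvent the bound grows like
    xi^(-1/2), which is integrable at 0; the logarithmic bound uses it for tiny shifts. *)
Lemma cayley_resolvent_single n u :
  norm (Rx (Nat.iter n Vx u)) ^ 2 <= M ^ 2 * norm u ^ 2 / xi.
Proof.
have Hk : 0 <= M ^ 2 * norm u ^ 2 by pos.
have H t : 0 < t -> t ^ 0 * norm (T t u) ^ 2 * exp (- xi * t) <= M ^ 2 * norm u ^ 2.
  move=> Ht.
  have H1 : norm (T t u) ^ 2 <= M ^ 2 * norm u ^ 2.
    rewrite -Rpow_mult_distr; apply: pow_incr; split; first pos.
    by apply: (bs_bound _ _ HT); lra.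
  have H2 := exp_pos (- xi * t).
  have H3 : exp (- xi * t) <= 1.
    have H4 : 0 <= xi * t by pos.
    by rewrite -exp_0; apply: exp_mono; lra.
  have := pow2_ge_0 (norm (T t u)); rewrite [t ^ 0]/=; nra.
have H2 := row_bound_sup HT Hrin xi Hxi (S n) 0 u _ (energy_exp_bound 0 u _ Hk H).
apply: Rle_trans H2; rewrite /row_energy sum_upto_S.
have : 0 <= sum_upto (fun l => norm (shifted_resolvent T xi (Nat.iter l (shifted_cayley T xi) u)) ^ 2) n.
  have <- : sum_upto (fun _ => 0) n = 0 by rewrite sum_upto_const; ring.
  by apply: sum_upto_le => l _; apply: pow2_ge_0.
rewrite /Rx /Vx; lra.
Qed.
End FixedShift.
End PowerBounds.

(** * The inverse of the generator *)

Definition generator_inverse {V : CompleteNormedModule R_AbsRing}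
    (T : R -> V -> V) (u : V) : V := iota (fun x => neg_generator T x u).

Section PolynomialDecay.
Context {V : CompleteNormedModule R_AbsRing} {T : R -> V -> V} {M : R}.
Hypothesis HT : bounded_semigroup T M.
Let Mpos : 0 < M := bs_pos _ _ HT.
Context (t1 : R).
Hypothesis Ht1 : 0 <= t1.
Hypothesis Hhalf : forall x, norm (T t1 (laplace T 1 x)) <= / 2 * norm x.

Definition inverse_bound := 1 + 2 * t1 * M.

Lemma inverse_bound_ge_1 : 1 <= inverse_bound.
Proof. rewrite /inverse_bound; have : 0 <= t1 * M by apply: Rmult_le_pos; lra. lra. Qed.

(** Here x is e^{-l t1} T(t1) x plus an integral of size t1 M |u|, and x = R_1 (u + (1 - l) x). The
    contraction gives |x| <= (|u| + |x|) / 2 + t1 M |u|; absorbing |x| / 2 yields the constant 1 + 2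
    t1 M, independent of l. *)
Lemma neg_generator_lower_bound l x y : 0 < l <= 1 -> neg_generator T x y ->
  norm x <= inverse_bound * norm (plus y (scal l x)).
Proof.
move=> Hl Hg; set u := plus y (scal l x).
have Hflow := neg_generator_flow HT l t1 x y (proj1 Hl) Ht1 Hg.
have Hx1 := proj1 (neg_generator_iff HT 1 x y Rlt_0_1) Hg.
have Hpart := laplace_partial_norm HT l u t1 ltac:(lra) Ht1.
rewrite -/u in Hflow.
have H1 : norm x <= norm (T t1 x) + t1 * (M * norm u).
  have E : x = plus (scal (exp (- l * t1)) (T t1 x)) (laplace_partial T l u t1).
    by rewrite Hflow; lin_real V.
  rewrite {1}E; apply: Rle_trans (norm_triangle _ _) _.
  apply: Rplus_le_compat => //.
  rewrite norm_scal_R Rabs_pos_eq; last pos.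
  have H2 : exp (- l * t1) <= 1.
    have H3 : 0 <= l * t1 by pos.
    by rewrite -exp_0; apply: exp_mono; lra.
  have := norm_ge_0 (T t1 x); nra.
have H2 : norm (T t1 x) <= / 2 * (norm u + norm x).
  rewrite {1}Hx1; apply: Rle_trans (Hhalf _) _; apply: Rmult_le_compat_l; first lra.
  have -> : plus y (scal 1 x) = plus u (scal (1 - l) x) by rewrite /u; lin_real V.
  apply: Rle_trans (norm_triangle _ _) _; apply: Rplus_le_compat_l.
  rewrite norm_scal_R Rabs_pos_eq; last lra.
  have := norm_ge_0 x; nra.
rewrite /inverse_bound; lra.
Qed.

Lemma neg_generator_bound x y : neg_generator T x y -> norm x <= inverse_bound * norm y.
Proof.
move=> Hg; apply: le_epsilon => eps Heps.
have HK := inverse_bound_ge_1.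
set c := inverse_bound * (norm x + 1).
have Hc : 0 < c by have := norm_ge_0 x; rewrite /c; nra.
pose l := Rmin 1 (eps / c).
have Hl : 0 < l by apply: Rmin_glb_lt; [lra|apply: Rdiv_lt_0_compat].
have Hl1 : l <= 1 by apply: Rmin_l.
have Hl2 : l * c <= eps.
  have H : l <= eps / c by apply: Rmin_r.
  have -> : eps = eps / c * c by field; lra.
  by apply: Rmult_le_compat_r; lra.
apply: Rle_trans (neg_generator_lower_bound l x y (conj Hl Hl1) Hg) _.
have H1 := norm_triangle y (scal l x).
rewrite norm_scal_R Rabs_pos_eq in H1; last lra.
have H2 : inverse_bound * (l * norm x) <= l * c.
  rewrite /c; have := norm_ge_0 x; nra.
nra.
Qed.

Lemma laplace_inverse_bound l u : 0 < l <= 1 -> norm (laplace T l u) <= inverse_bound * norm u.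
Proof.
move=> Hl.
have := neg_generator_lower_bound l _ _ Hl (neg_generator_laplace HT l u (proj1 Hl)).
by have -> : plus (minus u (scal l (laplace T l u))) (scal l (laplace T l u)) = u by lin_real V.
Qed.

(** The resolvent identity and the uniform bound make (l + A)^{-1} u Lipschitz in l, so it converges
    as l tends to 0. The closedness of A enters through the equivalent equation x = R_1 (u + x),
    which passes to the limit. *)
Lemma neg_generator_surjective u : exists x, neg_generator T x u.
Proof.
have HK := inverse_bound_ge_1.
have Hu := norm_ge_0 u.
have Hcauchy l m : 0 < l <= 1 -> 0 < m <= 1 ->
    norm (minus (laplace T m u) (laplace T l u)) <= Rabs (l - m) * (inverse_bound ^ 2 * norm u).
  move=> Hl Hm.
  rewrite (laplace_resolvent HT l m u (proj1 Hl) (proj1 Hm)) norm_scal_R.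
  apply: Rmult_le_compat_l; first pos.
  apply: Rle_trans (laplace_inverse_bound _ _ Hl) _.
  have := laplace_inverse_bound m u Hm; nra.
have [x Hx] : exists x, filterlim (fun l => laplace T l u) (at_right 0) (locally x).
  apply: (proj1 (filterlim_locally_cauchy (F := at_right 0) (fun l => laplace T l u))) => eps.
  set c := inverse_bound ^ 2 * norm u + 1.
  have Hc : 0 < c by rewrite /c; nra.
  have He : 0 < Rmin 1 (eps / c).
    by apply: Rmin_glb_lt; [lra|apply: Rdiv_lt_0_compat => //; apply: cond_pos].
  exists (fun l => 0 < l < Rmin 1 (eps / c)); split.
    exists (mkposreal _ He) => l Hl Hl0; split=> //.
    have : Rabs (l - 0) < Rmin 1 (eps / c) by exact: Hl.
    by rewrite Rminus_0_r Rabs_pos_eq //; apply: Rlt_le.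
  move=> l m Hl Hm; apply: norm_compat1.
  have H1 : Rmin 1 (eps / c) <= 1 by apply: Rmin_l.
  have H2 : Rmin 1 (eps / c) <= eps / c by apply: Rmin_r.
  apply: Rle_lt_trans (Hcauchy l m _ _) _; try lra.
  have H3 : Rabs (l - m) < eps / c by apply: Rabs_def1; lra.
  have E : eps / c * c = eps by field; lra.
  have H4 := Rabs_pos (l - m).
  have H5 : Rabs (l - m) * c < eps by rewrite -E; apply: Rmult_lt_compat_r.
  rewrite /c in H5; lra.
exists x; apply/(neg_generator_iff HT 1 x u Rlt_0_1).
have H1 : filterlim (fun l => laplace T 1 (plus (minus u (scal l (laplace T l u))) (scal 1 (laplace T l u))))
    (at_right 0) (locally (laplace T 1 (plus (minus u (scal 0 x)) (scal 1 x)))).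
  apply: filterlim_linear; first exact: laplace_linear HT _ Rlt_0_1.
  apply: filterlim_plus_fun.
  - apply: filterlim_minus_fun; first exact: filterlim_const.
    apply: filterlim_scal_fun => //.
    by move=> P HP; apply: at_right_filter_le.
  - exact: filterlim_scal_r_fun.
have H2 : filterlim (fun l => laplace T l u) (at_right 0)
    (locally (laplace T 1 (plus (minus u (scal 0 x)) (scal 1 x)))).
  apply: (filterlim_ext_loc _ _ _ H1).
  exists (mkposreal 1 Rlt_0_1) => l _ Hl.
  symmetry; apply (proj1 (neg_generator_iff HT 1 _ _ Rlt_0_1)).
  exact: neg_generator_laplace HT l u Hl.
have E := filterlim_locally_unique (F := at_right 0) _ _ _ Hx H2.
by rewrite {1}E scal_zero_l minus_zero_r.
Qed.

Lemma neg_generator_injective x x' u :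
  neg_generator T x u -> neg_generator T x' u -> x = x'.
Proof.
move=> H H'.
have := neg_generator_bound _ _ (neg_generator_minus HT _ _ _ _ H H').
rewrite minus_eq_zero norm_zero Rmult_0_r => H0.
have E : minus x x' = zero by apply: norm_eq_zero; apply: Rle_antisym => //; apply: norm_ge_0.
have -> : x = plus (minus x x') x' by lin_real V.
by rewrite E plus_zero_l.
Qed.

Let Ai := generator_inverse T.

Lemma generator_inverse_spec u : neg_generator T (Ai u) u.
Proof.
apply: (iota_correct (fun x => neg_generator T x u)).
have [x Hx] := neg_generator_surjective u.
by exists x; split=> // y Hy; apply: neg_generator_injective Hx Hy.
Qed.

Lemma generator_inverse_unique x u : neg_generator T x u -> x = Ai u.
Proof. by move=> H; apply: neg_generator_injective H (generator_inverse_spec u). Qed.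

Lemma generator_inverse_norm u : norm (Ai u) <= inverse_bound * norm u.
Proof. exact: neg_generator_bound (generator_inverse_spec u). Qed.

Lemma generator_inverse_resolvent l u : 0 < l ->
  Ai u = laplace T l (plus u (scal l (Ai u))).
Proof. by move=> Hl; apply (proj1 (neg_generator_iff HT l _ _ Hl)); exact: generator_inverse_spec. Qed.

Lemma generator_inverse_linear : is_linear Ai.
Proof.
have HL := laplace_linear HT 1 Rlt_0_1.
split.
- move=> x y; symmetry; apply: generator_inverse_unique.
  apply (proj2 (neg_generator_iff HT 1 _ _ Rlt_0_1)).
  rewrite {1}(generator_inverse_resolvent 1 x Rlt_0_1) {1}(generator_inverse_resolvent 1 y Rlt_0_1).
  rewrite -(linear_plus _ HL); congr (laplace _ _ _); lin_real V.
- move=> k x; symmetry; apply: generator_inverse_unique.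
  apply (proj2 (neg_generator_iff HT 1 _ _ Rlt_0_1)).
  rewrite {1}(generator_inverse_resolvent 1 x Rlt_0_1).
  rewrite -(linear_scal _ HL); congr (laplace _ _ _); lin_real V.
- exists inverse_bound; split; first by have := inverse_bound_ge_1; lra.
  exact: generator_inverse_norm.
Qed.

Lemma generator_inverse_commute (B : V -> V) : is_linear B ->
  (forall t x, 0 <= t -> B (T t x) = T t (B x)) -> forall u, B (Ai u) = Ai (B u).
Proof.
move=> HB Hc u; apply: generator_inverse_unique.
have := filterlim_linear B _ _ HB (generator_inverse_spec u).
rewrite /neg_generator (linear_opp _ HB); apply filterlim_ext_loc.
exists (mkposreal 1 Rlt_0_1) => t _ Ht.
by rewrite (linear_scal _ HB) (linear_minus _ HB) Hc //; apply: Rlt_le.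
Qed.

Lemma generator_inverse_semigroup t u : 0 <= t -> T t (Ai u) = Ai (T t u).
Proof.
move=> Ht; apply: generator_inverse_commute; first exact: bs_linear _ _ HT _ Ht.
by move=> s x Hs; apply: bs_comm HT _ _ _ Ht Hs.
Qed.

Lemma generator_inverse_laplace l u : 0 < l -> laplace T l (Ai u) = Ai (laplace T l u).
Proof.
move=> Hl; apply: generator_inverse_commute; first exact: laplace_linear HT _ Hl.
by move=> s x Hs; rewrite (laplace_semigroup HT).
Qed.

(** T(J s) A^{-J} = (T(s) A^{-1})^J with s = t / J; J = 0 is the boundedness of T. *)
Lemma inverse_power_decay gamma C : 0 < gamma -> 0 < C ->
  (forall t x, 0 < t -> norm (T t (Ai x)) <= C * Rpower t (- gamma) * norm x) ->
  forall J, exists D, 0 < D /\ forall t x, 0 < t ->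
    norm (T t (Nat.iter J Ai x)) <= D * Rpower t (- (INR J * gamma)) * norm x.
Proof.
move=> Hg HC H J.
have Hmul s x : 0 < s -> forall j,
    norm (T (INR j * s) (Nat.iter j Ai x)) <= M * (C * Rpower s (- gamma)) ^ j * norm x.
  move=> Hs; elim=> [|j IH].
    by rewrite Rmult_0_l (bs_zero _ _ HT) /= Rmult_1_r -{1}(bs_zero _ _ HT x); apply: (bs_bound _ _ HT); lra.
  have Hj : 0 <= INR j * s by pos.
  rewrite S_INR Rmult_plus_distr_r Rmult_1_l Rplus_comm (bs_plus _ _ HT) //; last lra.
  rewrite Nat.iter_succ generator_inverse_semigroup //.
  apply: Rle_trans (H _ _ Hs) _.
  have Hp : 0 <= C * Rpower s (- gamma) by pos.
  apply: Rle_trans (Rmult_le_compat_l _ _ _ Hp IH) _.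
  by right; rewrite /=; ring.
case: J => [|J].
- exists M; split=> // t x Ht; rewrite Rmult_0_l Ropp_0 Rpower_O // Rmult_1_r.
  by apply: (bs_bound _ _ HT); lra.
- have HJ : 0 < INR (S J) by pos.
  exists (M * (C ^ (S J) * Rpower (/ INR (S J)) (- (INR (S J) * gamma)))).
  split.
    apply: Rmult_lt_0_compat => //; apply: Rmult_lt_0_compat; last pos.
    pos.
  move=> t x Ht.
  have Hs : 0 < t * / INR (S J) by pos.
  have := Hmul _ x Hs (S J).
  have -> : INR (S J) * (t * / INR (S J)) = t by field; lra.
  rewrite Rpow_mult_distr -(Rpower_pow (S J) (Rpower _ _)); last pos.
  have -> : Rpower (Rpower (t * / INR (S J)) (- gamma)) (INR (S J))
     = Rpower (t * / INR (S J)) (- (INR (S J) * gamma)).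
    by rewrite Rpower_mult; congr Rpower; ring.
  move=> H1; apply: Rle_trans H1 _; right.
  rewrite -Rpower_mult_distr //; last pos.
  ring.
Qed.
End PolynomialDecay.

(** * Decay of the orbits of the inverse *)

Section Decay.
Context {V : CompleteNormedModule R_AbsRing} {T : R -> V -> V} {M : R}.
Hypothesis HT : bounded_semigroup T M.
Let Mpos : 0 < M := bs_pos _ _ HT.
Context (gamma C t0 : R).
Hypothesis Hgamma : 0 < gamma.
Hypothesis HC : 0 < C.
Hypothesis Hdecay : forall t x, t0 <= t ->
  norm (T t (laplace T 1 x)) <= C * Rpower t (- gamma) * norm x.

Lemma Rpower_pos x y : 0 < Rpower x y.
Proof. exact: exp_pos. Qed.

Lemma Rpower_neg_le a b g : 0 < a -> a <= b -> 0 <= g -> Rpower b (- g) <= Rpower a (- g).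
Proof.
move=> Ha Hab Hg; rewrite !Rpower_Ropp; apply: Rinv_le_contravar; first exact: Rpower_pos.
exact: Rle_Rpower_l.
Qed.

Lemma eventual_contraction : exists t1, 0 <= t1 /\
  forall x, norm (T t1 (laplace T 1 x)) <= / 2 * norm x.
Proof.
(* The solution of C a^(-gamma) = 1 / 2. *)
pose a := Rpower (/ (2 * C)) (- / gamma).
have Ha : 0 < a by apply: Rpower_pos.
have H1 := Rmax_l t0 a; have H2 := Rmax_r t0 a.
exists (Rmax t0 a); split; first lra.
move=> x; apply: Rle_trans (Hdecay _ x H1) _.
apply: Rmult_le_compat_r; first pos.
have H3 := Rpower_neg_le a _ gamma Ha H2 ltac:(lra).
have E : Rpower a (- gamma) = / (2 * C).
  rewrite /a Rpower_mult.
  have -> : - / gamma * - gamma = 1 by field; lra.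
  by apply: Rpower_1; apply: Rinv_0_lt_compat; lra.
rewrite E in H3.
have -> : / 2 = C * / (2 * C) by field; lra.
by apply: Rmult_le_compat_l; lra.
Qed.

(** For t >= t0 the identity A^{-1} = R_1 (1 + A^{-1}) transfers the decay from R_1. For smaller t
    boundedness suffices, since t^(-gamma) >= s^(-gamma) with s = max(t0, 1). *)
Lemma inverse_decay t1 : 0 <= t1 ->
  (forall x, norm (T t1 (laplace T 1 x)) <= / 2 * norm x) ->
  exists C', 0 < C' /\ forall t x, 0 < t ->
    norm (T t (generator_inverse T x)) <= C' * Rpower t (- gamma) * norm x.
Proof.
move=> Ht1 Hhalf.
pose K := @inverse_bound M t1.
have HK : 1 <= K by exact: inverse_bound_ge_1 HT t1 Ht1.
pose s := Rmax t0 1.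
have Hs1 : 1 <= s by apply: Rmax_r.
have Hs0 : t0 <= s by apply: Rmax_l.
have Hps : 0 < Rpower s (- gamma) by apply: Rpower_pos.
have HCs : 0 < M * K / Rpower s (- gamma) by pos.
have HCK : 0 < C * (1 + K) by pos.
exists (C * (1 + K) + M * K / Rpower s (- gamma)); split; first lra.
move=> t x Ht.
have Hpt : 0 < Rpower t (- gamma) by apply: Rpower_pos.
have Hx := norm_ge_0 x.
have HA : norm (generator_inverse T x) <= K * norm x by exact: generator_inverse_norm HT t1 Ht1 Hhalf x.
have Hptx : 0 <= Rpower t (- gamma) * norm x by pos.
case: (Rle_dec t0 t) => Htt.
- rewrite (generator_inverse_resolvent HT t1 Ht1 Hhalf 1 x Rlt_0_1).
  apply: Rle_trans (Hdecay _ _ Htt) _.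
  have H1 : norm (plus x (scal 1 (generator_inverse T x))) <= (1 + K) * norm x.
    apply: Rle_trans (norm_triangle _ _) _; rewrite norm_scal_R Rabs_R1; lra.
  have H2 : 0 < C * Rpower t (- gamma) by pos.
  apply: Rle_trans (Rmult_le_compat_l _ _ _ (Rlt_le _ _ H2) H1) _.
  have : 0 <= M * K / Rpower s (- gamma) * (Rpower t (- gamma) * norm x) by apply: Rmult_le_pos; lra.
  lra.
- apply: Rle_trans (bs_bound _ _ HT _ _ (Rlt_le _ _ Ht)) _.
  have H3 : Rpower s (- gamma) <= Rpower t (- gamma) by apply: Rpower_neg_le; lra.
  have H4 : M * norm (generator_inverse T x) <= M * (K * norm x) by apply: Rmult_le_compat_l; lra.
  have H5 : M * (K * norm x) <= M * K / Rpower s (- gamma) * (Rpower t (- gamma) * norm x).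
    have -> : M * (K * norm x) = M * K / Rpower s (- gamma) * (Rpower s (- gamma) * norm x) by field; lra.
    apply: Rmult_le_compat_l; first lra.
    exact: Rmult_le_compat_r.
  have : 0 <= C * (1 + K) * (Rpower t (- gamma) * norm x) by apply: Rmult_le_pos; lra.
  lra.
Qed.
End Decay.

Lemma sq_le_inv a b : 0 <= b -> a ^ 2 <= b ^ 2 -> a <= b.
Proof. by move=> Hb H; apply: Rnot_lt_le => Hlt; nra. Qed.

(** The inequality x <= e^x at x = s / (q + 1), raised to the power q; q + 1 in place of q keeps the
    division meaningful for q = 0. *)
Lemma pow_le_exp q s : 0 <= s -> s ^ q <= INR (S q) ^ q * exp s.
Proof.
move=> Hs.
have Hq : 0 < INR (S q) by pos.
have H1 : s / INR (S q) <= exp (s / INR (S q)) by have := exp_ineq1_le (s / INR (S q)); lra.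
have H0 : 0 <= s / INR (S q) by pos.
have H2 : (s / INR (S q)) ^ q <= exp (s / INR (S q)) ^ q by apply: pow_incr.
have H3 : exp (s / INR (S q)) ^ q <= exp s.
  rewrite -Rpower_pow; last pos.
  rewrite /Rpower ln_exp; apply: exp_mono.
  have E : s = INR (S q) * (s / INR (S q)) by field; lra.
  rewrite {2}E; apply: Rmult_le_compat_r => //; apply: le_INR; lia.
have -> : s ^ q = INR (S q) ^ q * (s / INR (S q)) ^ q.
  by rewrite -Rpow_mult_distr; congr (_ ^ _); field; lra.
apply: Rmult_le_compat_l; first pos.
lra.
Qed.

Lemma Rpower_le_pow s a q : 0 < s -> 0 <= a <= INR q -> Rpower s a <= 1 + s ^ q.
Proof.
move=> Hs Ha.
have Hq : 0 < s ^ q by pos.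
case: (Rle_dec s 1) => H.
- have : Rpower s a <= 1; last lra.
  rewrite -exp_0; apply: exp_mono.
  have : ln s <= 0 by rewrite -ln_1; apply: Rcomplements.ln_le.
  nra.
- have : Rpower s a <= s ^ q; last lra.
  rewrite -Rpower_pow //; apply: Rle_Rpower; lra.
Qed.

(** With s = xi t the left side is s^(q - 2 delta) e^(-s) times xi^(2 delta - q), and 2 delta <= q
    keeps the power of s bounded near 0. *)
Lemma exp_weight q delta xi t : 0 <= delta -> 2 * delta <= INR q -> 0 < xi -> 0 < t ->
  t ^ q * Rpower t (- delta) ^ 2 * exp (- xi * t)
  <= (1 + INR (S q) ^ q) * (Rpower xi delta ^ 2 / xi ^ q).
Proof.
move=> Hd Hq Hxi Ht.
have Hs : 0 < xi * t by pos.
have Hxq : 0 < xi ^ q by pos.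
have E : t ^ q * Rpower t (- delta) ^ 2 = Rpower (xi * t) (INR q - 2 * delta) * (Rpower xi delta ^ 2 / xi ^ q).
  rewrite -!Rpower_pow //; try exact: exp_pos.
  rewrite /Rdiv -Rpower_Ropp !Rpower_mult -Rpower_mult_distr // /Rpower -!exp_plus.
  by congr exp; rewrite /=; ring.
rewrite E.
have Hp : 0 < Rpower xi delta ^ 2 / xi ^ q by pos.
rewrite (Rmult_comm _ (_ / _)) Rmult_assoc (Rmult_comm _ (_ / _)).
apply: Rmult_le_compat_l; first lra.
have H1 := Rpower_le_pow (xi * t) (INR q - 2 * delta) q Hs ltac:(lra).
have H2 := pow_le_exp q (xi * t) ltac:(lra).
have H3 := exp_pos (- xi * t).
have H4 : exp (xi * t) * exp (- xi * t) = 1 by rewrite -exp_plus -exp_0; congr exp; ring.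
have H5 : exp (- xi * t) <= 1 by rewrite -exp_0; apply: exp_mono; lra.
apply: Rle_trans (Rmult_le_compat_r _ _ _ (Rlt_le _ _ H3) H1) _.
have H6 := Rmult_le_compat_r _ _ _ (Rlt_le _ _ H3) H2.
rewrite Rmult_assoc H4 in H6; lra.
Qed.

(** * Power bounds with decay, and derivatives in the shift *)

Section CayleyDecay.
Context {V : CompleteNormedModule R_AbsRing} {T : R -> V -> V} {M : R}.
Context {rin : V -> V -> R}.
Hypothesis HT : bounded_semigroup T M.
Hypothesis Hrin : real_inner_product rin.
Let Mpos : 0 < M := bs_pos _ _ HT.

Let Rx := shifted_resolvent T.
Let Vx := shifted_cayley T.

(** The weight t^q that belongs to q + 2 resolvents has to dominate the singularity t^(-2 delta) of
    the squared decay, so the gain xi^delta is first available for many resolvents only. The powers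
    of n and xi combine because xi^2 xi^q n^(q + 2) = (n xi)^(q + 2). *)
Lemma cayley_decay_bound q delta D : 0 < D -> 0 <= delta -> 2 * delta <= INR q ->
  exists C, 0 < C /\ forall xi n u a, 0 < xi -> (S q <= n)%nat -> 0 <= a ->
    (forall t, 0 < t -> norm (T t u) <= D * Rpower t (- delta) * a) ->
    norm (Nat.iter n (Vx xi) (Nat.iter (S (S q)) (Rx xi) u))
    <= C * Rpower (INR n * xi) (- (INR (S (S q)) / 2)) * Rpower xi delta * a.
Proof.
move=> HD Hd Hq.
set W := 1 + INR (S q) ^ q.
have HW : 0 < W by pos.
have HQ : 0 < (2 * INR (S q)) ^ (S (S q)) by pos.
set C0 := M ^ 2 / 4 * (2 * INR (S q)) ^ (S (S q)) * (D ^ 2 * W).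
have HC0 : 0 < C0 by pos.
exists (1 + C0); split; first lra.
move=> xi n u a Hxi Hn Ha Hu.
have Hnpos : 0 < INR n by pos.
have Hxq : 0 < xi ^ q by pos.
have Hpd : 0 < Rpower xi delta by pos.
set kappa := D ^ 2 * a ^ 2 * (W * (Rpower xi delta ^ 2 / xi ^ q)).
have Ha2 : 0 <= D ^ 2 * a ^ 2 by pos.
have Hk : 0 <= kappa by pos.
have H := cayley_power_bound HT Hrin xi Hxi q u kappa n Hk _ Hn.
have {}H := H _.
apply: sq_le_inv.
  pos.
apply: Rle_trans (H _) _.
- move=> t Ht.
  have H1 : norm (T t u) ^ 2 <= (D * Rpower t (- delta) * a) ^ 2.
    by apply: pow_incr; split; [exact: norm_ge_0|exact: Hu].
  have Htq : 0 < t ^ q by pos.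
  have He := exp_pos (- xi * t).
  apply: Rle_trans (_ : t ^ q * (D * Rpower t (- delta) * a) ^ 2 * exp (- xi * t) <= _).
    apply: Rmult_le_compat_r; first lra.
    by apply: Rmult_le_compat_l => //; lra.
  have -> : t ^ q * (D * Rpower t (- delta) * a) ^ 2 * exp (- xi * t)
    = D ^ 2 * a ^ 2 * (t ^ q * Rpower t (- delta) ^ 2 * exp (- xi * t)) by ring.
  apply: Rmult_le_compat_l => //; exact: exp_weight.
- set b := S (S q).
  have Hnx : 0 < INR n * xi by pos.
  have Hnb : 0 < INR n ^ b by pos.
  have E1 : Rpower (INR n * xi) (- (INR b / 2)) ^ 2 = / (INR n ^ b * (xi ^ 2 * xi ^ q)).
    have -> : INR n ^ b * (xi ^ 2 * xi ^ q) = (INR n * xi) ^ b.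
      by rewrite Rpow_mult_distr /b /=; ring.
    rewrite -(Rpower_pow 2); last pos.
    rewrite -(Rpower_pow b) // -Rpower_Ropp Rpower_mult.
    by congr Rpower; rewrite /=; field.
  have -> : ((1 + C0) * Rpower (INR n * xi) (- (INR b / 2)) * Rpower xi delta * a) ^ 2
    = (1 + C0) ^ 2 * (Rpower (INR n * xi) (- (INR b / 2)) ^ 2 * (Rpower xi delta ^ 2 * a ^ 2)) by ring.
  rewrite E1.
  have -> : M ^ 2 / 4 * (2 * INR (S q)) ^ b * (kappa / (xi ^ 2 * INR n ^ b))
    = C0 * (/ (INR n ^ b * (xi ^ 2 * xi ^ q)) * (Rpower xi delta ^ 2 * a ^ 2)).
    by rewrite /kappa /C0 -/b; field; lra.
  apply: Rmult_le_compat_r; last nra.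
  pos.
Qed.

Lemma cayley_high_bound q : exists C, 0 < C /\ forall xi n u, 0 < xi -> (S q <= n)%nat ->
    norm (Nat.iter n (Vx xi) (Nat.iter (S (S q)) (Rx xi) u))
    <= C * Rpower (INR n * xi) (- (INR (S (S q)) / 2)) * norm u.
Proof.
have [C [HC H]] := cayley_decay_bound q 0 M Mpos (Rle_refl _) ltac:(rewrite Rmult_0_r; exact: pos_INR).
exists C; split=> // xi n u Hxi Hn.
have := H xi n u (norm u) Hxi Hn (norm_ge_0 u).
rewrite Rpower_O // Rmult_1_r; apply => t Ht.
rewrite Ropp_0 Rpower_O // Rmult_1_r; apply: (bs_bound _ _ HT); lra.
Qed.

Lemma shifted_resolvent_norm xi u : -1 < xi -> norm (Rx xi u) <= M / (1 + xi) * norm u.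
Proof. by move=> H; apply: laplace_norm HT _ _ _; lra. Qed.

(** Two uses of the resolvent identity leave the remainder (s' - s)^2 R_s R_s R_s' v, and the
    resolvents stay bounded while 1 + s' >= (1 + s) / 2. *)
Lemma resolvent_derive s v : -1 < s ->
  is_derive (fun s => Rx s v) s (opp (Rx s (Rx s v))).
Proof.
move=> Hs; apply/is_derive_eps => eps Heps.
set k := M / ((1 + s) / 2).
have Hk : 0 < k by pos.
have Hbound s' x : (1 + s) / 2 <= 1 + s' -> norm (Rx s' x) <= k * norm x.
  move=> Hs'; apply: Rle_trans (shifted_resolvent_norm _ _ _) _; first lra.
  apply: Rmult_le_compat_r; first pos.
  apply: Rmult_le_compat_l; first lra.
  by apply: Rinv_le_contravar; lra.
set c := k * (k * (k * norm v)) + 1.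
have Hc : 0 < c.
  have : 0 <= k * (k * (k * norm v)).
    by do 3! (apply: Rmult_le_pos; first lra); exact: norm_ge_0.
  rewrite /c; lra.
have Hd : 0 < Rmin ((1 + s) / 2) (eps / c).
  by apply: Rmin_glb_lt; [lra|apply: Rdiv_lt_0_compat].
exists (mkposreal _ Hd) => s' Hball.
have H0 : Rabs (s' - s) < Rmin ((1 + s) / 2) (eps / c) by exact: Hball.
have H1 : Rabs (s' - s) < (1 + s) / 2 by apply: Rlt_le_trans H0 (Rmin_l _ _).
have H2 : Rabs (s' - s) < eps / c by apply: Rlt_le_trans H0 (Rmin_r _ _).
have H3 : (1 + s) / 2 <= 1 + s' by have [H4 H5] := Rabs_def2 _ _ H1; lra.
have HR u : minus (Rx s' u) (Rx s u) = scal (s - s') (Rx s (Rx s' u)).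
  have := laplace_resolvent HT (1 + s) (1 + s') u ltac:(lra) ltac:(lra).
  have -> : 1 + s - (1 + s') = s - s' by ring.
  by [].
have Hl : is_linear (Rx s) := shifted_resolvent_linear HT s Hs.
have -> : minus (minus (Rx s' v) (Rx s v)) (scal (s' - s) (opp (Rx s (Rx s v))))
   = scal ((s - s') * (s - s')) (Rx s (Rx s (Rx s' v))).
  have E : Rx s (Rx s' v) = plus (Rx s (Rx s v)) (scal (s - s') (Rx s (Rx s (Rx s' v)))).
    rewrite -(linear_scal _ Hl) -HR (linear_minus _ Hl); lin_real V.
  rewrite HR {1}E; lin_real V.
rewrite norm_scal_R Rabs_mult (Rabs_minus_sym s s').
have H6 : norm (Rx s (Rx s (Rx s' v))) <= c.
  apply: Rle_trans (_ : k * (k * (k * norm v)) <= _); last by rewrite /c; lra.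
  apply: Rle_trans (Hbound _ _ _) _; first lra.
  apply: Rmult_le_compat_l; first lra.
  apply: Rle_trans (Hbound _ _ _) _; first lra.
  apply: Rmult_le_compat_l; first lra.
  exact: Hbound.
have H7 := Rabs_pos (s' - s).
have H8 : Rabs (s' - s) * c <= eps.
  have -> : eps = eps / c * c by field; lra.
  by apply: Rmult_le_compat_r; lra.
have H9 := norm_ge_0 (Rx s (Rx s (Rx s' v))).
apply: Rle_trans (_ : Rabs (s' - s) * Rabs (s' - s) * c <= _).
  by apply: Rmult_le_compat_l => //; apply: Rmult_le_pos.
rewrite Rmult_assoc Rmult_comm; exact: Rmult_le_compat_r.
Qed.

Lemma resolvent_apply_derive s (w : R -> V) w' : -1 < s -> is_derive w s w' ->
  is_derive (fun s => Rx s (w s)) s (plus (opp (Rx s (Rx s (w s)))) (Rx s w')).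
Proof.
move=> Hs Hw.
set k := M / ((1 + s) / 2).
apply: (is_derive_apply Rx w s k) => //.
- have Hd : 0 < (1 + s) / 2 by lra.
  exists (mkposreal _ Hd) => s' Hball.
  have H1 : Rabs (s' - s) < (1 + s) / 2 by exact: Hball.
  have H3 : (1 + s) / 2 <= 1 + s' by have [H4 H5] := Rabs_def2 _ _ H1; lra.
  split; first by apply: (shifted_resolvent_linear HT); lra.
  move=> v; apply: Rle_trans (shifted_resolvent_norm _ _ _) _; first lra.
  apply: Rmult_le_compat_r; first pos.
  apply: Rmult_le_compat_l; first lra.
  by apply: Rinv_le_contravar; lra.
- exact: resolvent_derive.
- apply: is_derive_continuous; exact: resolvent_derive.
Qed.

Lemma resolvent_iter_derive b s u : -1 < s ->
  is_derive (fun s => Nat.iter b (Rx s) u) s (scal (- INR b) (Nat.iter (S b) (Rx s) u)).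
Proof.
move=> Hs; have Hl : is_linear (Rx s) := shifted_resolvent_linear HT s Hs.
elim: b => [|b IH].
- have -> : scal (- INR 0) (Nat.iter 1 (Rx s) u) = zero by rewrite /=; lin_real V.
  exact: is_derive_const.
- have := resolvent_apply_derive s _ _ Hs IH.
  have -> : plus (opp (Rx s (Rx s (Nat.iter b (Rx s) u))))
      (Rx s (scal (- INR b) (Nat.iter (S b) (Rx s) u)))
    = scal (- INR (S b)) (Nat.iter (S (S b)) (Rx s) u).
    rewrite (linear_scal _ Hl) S_INR !Nat.iter_succ.
    move: (Rx s (Rx s _)) => z; lin_real V.
  by [].
Qed.

(** Since the derivative of R_s is - R_s^2, that of V_s = 1 - 2 R_s is 2 R_s^2, and all the factors
    commute. At n = 0 the coefficient of the first term is 0, so [pred 0 = 0] is harmless. *)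
Lemma cayley_iter_derive n s (w : R -> V) w' : -1 < s -> is_derive w s w' ->
  is_derive (fun s => Nat.iter n (Vx s) (w s)) s
    (plus (scal (2 * INR n) (Nat.iter (pred n) (Vx s) (Rx s (Rx s (w s)))))
       (Nat.iter n (Vx s) w')).
Proof.
move=> Hs Hw.
have Hl : is_linear (Rx s) := shifted_resolvent_linear HT s Hs.
have HV : is_linear (Vx s) := shifted_cayley_linear HT s Hs.
elim: n => [|n IH].
- have -> : plus (scal (2 * INR 0) (Nat.iter (Nat.pred 0) (Vx s) (Rx s (Rx s (w s)))))
     (Nat.iter 0 (Vx s) w') = w' by rewrite /=; lin_real V.
  exact: Hw.
- have H1 := resolvent_apply_derive s _ _ Hs IH.
  have H2 := is_derive_minus _ _ _ _ _ IH (is_derive_linear_comp (fun v => scal 2 v) _ _ _ (is_linear_scal_left 2) H1).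
  move: H2; set z := Nat.iter n (Vx s) (w s); set y := plus (scal _ _) _.
  have -> : plus (scal (2 * INR (S n)) (Nat.iter (Nat.pred (S n)) (Vx s) (Rx s (Rx s (w s)))))
     (Nat.iter (S n) (Vx s) w') = minus y (scal 2 (plus (opp (Rx s (Rx s z))) (Rx s y))).
    have E1 : Nat.iter n (Vx s) (Rx s (Rx s (w s))) = Rx s (Rx s z).
      by rewrite /z /Vx /Rx !(cayley_resolvent HT).
    have E2 : Vx s y = plus (scal (2 * INR n) (Rx s (Rx s z))) (Nat.iter (S n) (Vx s) w').
      rewrite /y (linear_plus _ HV) (linear_scal _ HV); congr (plus _ _).
      case: (n) E1 => [|m] E1; first by rewrite /=; lin_real V.
      by rewrite -E1.
    have -> : minus y (scal 2 (plus (opp (Rx s (Rx s z))) (Rx s y)))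
      = plus (scal 2 (Rx s (Rx s z))) (Vx s y).
      by rewrite /Vx /shifted_cayley -/(Rx s); lin_real V.
    rewrite E2 -E1 S_INR [Nat.pred _]/=.
    move: (Nat.iter n (Vx s) (Rx s (Rx s (w s)))) (Nat.iter (S n) (Vx s) w') => p r; lin_real V.
  by [].
Qed.
End CayleyDecay.

(** * The Cayley transform on the range of an inverse power *)

Lemma Rpower_le_exponent x a b : 0 < x <= 1 -> a <= b -> Rpower x b <= Rpower x a.
Proof.
move=> [Hx Hx1] Hab; apply: exp_mono.
have : ln x <= 0 by rewrite -ln_1; apply: Rcomplements.ln_le.
nra.
Qed.

Lemma Rpower_inv_base x a : 0 < x -> Rpower (/ x) a = Rpower x (- a).
Proof. by move=> Hx; rewrite /Rpower ln_Rinv //; congr exp; ring. Qed.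

Lemma Rpower_div_base x y a : 0 < x -> 0 < y ->
  Rpower (x / y) a = Rpower x a * Rpower y (- a).
Proof.
move=> Hx Hy; rewrite /Rdiv -Rpower_mult_distr ?Rpower_inv_base //.
pos.
Qed.

Lemma is_derive_Rpower p s : 0 < s ->
  is_derive (fun s => Rpower s p) s (p * Rpower s (p - 1)).
Proof.
move=> Hs; rewrite /Rpower.
have -> : p * exp ((p - 1) * ln s) = p * / s * exp (p * ln s).
  have -> : (p - 1) * ln s = p * ln s + - ln s by ring.
  by rewrite exp_plus exp_Ropp exp_ln //; field; lra.
by auto_derive => //; field; lra.
Qed.

Lemma ln_ge_1 n : (3 <= n)%nat -> 1 <= ln (INR n).
Proof.
move=> Hn; have H3 : 3 <= INR n by have := le_INR 3 n Hn; rewrite /=; lra.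
rewrite -{1}(ln_exp 1); apply: Rcomplements.ln_le; first pos.
have := exp_le_3; lra.
Qed.

Section CayleyEstimates.
Context {V : CompleteNormedModule R_AbsRing} {T : R -> V -> V} {M : R}.
Context {rin : V -> V -> R}.
Hypothesis HT : bounded_semigroup T M.
Hypothesis Hrin : real_inner_product rin.
Let Mpos : 0 < M := bs_pos _ _ HT.

Let Rx := shifted_resolvent T.
Let Vx := shifted_cayley T.

Lemma cayley_iter_continuous n s u : -1 < s -> continuous (fun s => Nat.iter n (Vx s) u) s.
Proof.
move=> Hs; apply: is_derive_continuous.
exact: (cayley_iter_derive HT n s (fun _ => u) zero Hs (is_derive_const _ _)).
Qed.

Lemma cayley_iter_norm n s u : 0 <= s ->
  norm (Nat.iter n (Vx s) u) <= exp (INR n * (2 * (M / (1 + s)))) * norm u.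
Proof.
move=> Hs.
have Hk : 0 < M / (1 + s) by pos.
have H1 x : norm (Vx s x) <= exp (2 * (M / (1 + s))) * norm x.
  rewrite /Vx /shifted_cayley; apply: Rle_trans (norm_minus_le _ _) _.
  rewrite norm_scal_R Rabs_pos_eq; last lra.
  have H2 := shifted_resolvent_norm HT s x ltac:(lra).
  have H3 := exp_ineq1_le (2 * (M / (1 + s))); have := norm_ge_0 x; nra.
elim: n => [|n IH]; first by rewrite /= Rmult_0_l exp_0; lra.
rewrite Nat.iter_succ S_INR Rmult_plus_distr_r exp_plus Rmult_1_l.
apply: Rle_trans (H1 _) _.
rewrite (Rmult_comm (exp (INR n * _))) Rmult_assoc.
by apply: Rmult_le_compat_l => //; apply: Rlt_le; apply: exp_pos.
Qed.

Lemma limit_norm_le (g : R -> V) c : continuous g 0 ->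
  at_right 0 (fun s => norm (g s) <= c) -> norm (g 0) <= c.
Proof.
move=> Hg Hle.
have Hn : filterlim (fun s => norm (g s)) (at_right 0) (locally (norm (g 0))).
  apply: (filterlim_comp _ _ _ g norm _ (locally (g 0))); last exact: filterlim_norm.
  by move=> P HP; apply: at_right_filter_le; apply: Hg.
exact: (filterlim_le (F := at_right 0) (fun s => norm (g s)) (fun _ => c) (norm (g 0)) c Hle Hn
  (filterlim_const c)).
Qed.

Lemma at_right_intro (P : R -> Prop) d : 0 < d -> (forall s, 0 < s < d -> P s) -> at_right 0 P.
Proof.
move=> Hd H; exists (mkposreal d Hd) => s Hs Hs0; apply: H; split=> //.
have : Rabs (s - 0) < d by exact: Hs.
by rewrite Rminus_0_r Rabs_pos_eq //; apply: Rlt_le.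
Qed.

(** At the shift s = n the crude bound exp(2 M n / (1 + n)) is bounded. Between n^(-2) and n the
    derivative of V_s^n is at most 4 C / s, with integral 12 C log n. Below n^(-2) the bound with a
    single resolvent, integrable at 0, contributes a constant. *)
Lemma cayley_log_bound : exists C, 0 < C /\ forall n u, (3 <= n)%nat ->
  norm (Nat.iter n (Vx 0) u) <= C * ln (INR n) * norm u.
Proof.
have [C [HC HB]] := cayley_high_bound HT Hrin 0.
exists (exp (2 * M) + 12 * C + 4 * M ^ 2); split.
  have := exp_pos (2 * M); have := pow2_ge_0 M; lra.
move=> n u Hn.
have Hln := ln_ge_1 n Hn.
have Hu := norm_ge_0 u.
have Hn3 : 3 <= INR n by have := le_INR 3 n Hn; rewrite /=; lra.
set g := fun s => Nat.iter n (Vx s) u.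
set g' := fun s => plus (scal (2 * INR n) (Nat.iter (pred n) (Vx s) (Rx s (Rx s u))))
       (Nat.iter n (Vx s) zero).
have Hg s : 0 <= s -> is_derive g s (g' s).
  move=> Hs; apply: (cayley_iter_derive HT n s (fun _ => u) zero); first lra.
  exact: is_derive_const.
have Hg'n s : 0 <= s -> norm (g' s) = 2 * INR n * norm (Nat.iter (pred n) (Vx s) (Rx s (Rx s u))).
  move=> Hs; rewrite /g' (linear_zero _ (iter_linear _ n (shifted_cayley_linear HT s ltac:(lra)))).
  by rewrite plus_zero_r norm_scal_R Rabs_pos_eq //; lra.
have Hpred : INR (pred n) = INR n - 1 by case: (n) Hn => [|m] Hm; [lia|rewrite S_INR /=; ring].
have Hhigh s : 0 < s -> norm (g' s) <= 4 * C * norm u * / s.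
  move=> Hs; rewrite Hg'n; last lra.
  have H1 := HB s (pred n) u Hs ltac:(lia).
  have E : Rpower (INR (pred n) * s) (- (INR 2 / 2)) = / ((INR n - 1) * s).
    have -> : - (INR 2 / 2) = - (1) by rewrite /=; field.
    by rewrite Rpower_Ropp Rpower_1 ?Hpred //; apply: Rmult_lt_0_compat; lra.
  rewrite E in H1.
  apply: Rle_trans (Rmult_le_compat_l (2 * INR n) _ _ ltac:(lra) H1) _.
  have H2 : 2 * INR n * / ((INR n - 1) * s) <= 4 * / s.
    have -> : 4 * / s = (4 * (INR n - 1)) * / ((INR n - 1) * s) by field; lra.
    apply: Rmult_le_compat_r; last lra.
    pos.
  have H3 : 0 <= C * norm u by pos.
  have -> : 2 * INR n * (C * / ((INR n - 1) * s) * norm u)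
     = 2 * INR n * / ((INR n - 1) * s) * (C * norm u) by ring.
  have -> : 4 * C * norm u * / s = 4 * / s * (C * norm u) by ring.
  exact: Rmult_le_compat_r.
have Hlow s : 0 < s -> norm (g' s) <= 2 * INR n * M ^ 2 * norm u * / sqrt s.
  move=> Hs; rewrite Hg'n; last lra.
  have Hss : 0 < sqrt s by apply: sqrt_lt_R0.
  have H1 := cayley_resolvent_single HT Hrin s Hs (pred n) (Rx s u).
  have E : Nat.iter (pred n) (Vx s) (Rx s (Rx s u)) = Rx s (Nat.iter (pred n) (Vx s) (Rx s u)).
    by rewrite /Vx /Rx (cayley_resolvent HT) //; lra.
  rewrite E.
  have H2 : norm (Rx s u) <= M * norm u.
    apply: Rle_trans (shifted_resolvent_norm HT s u ltac:(lra)) _.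
    apply: Rmult_le_compat_r => //.
    rewrite -{2}(Rdiv_1_r M).
    by apply: Rmult_le_compat_l; [lra|apply: Rinv_le_contravar; lra].
  have H3 : norm (Rx s (Nat.iter (pred n) (Vx s) (Rx s u))) <= M ^ 2 * norm u * / sqrt s.
    apply: sq_le_inv.
      apply: Rmult_le_pos; last pos.
      pos.
    apply: Rle_trans H1 _.
    have -> : (M ^ 2 * norm u * / sqrt s) ^ 2 = M ^ 2 * (M * norm u) ^ 2 / s.
      by rewrite -{2}(sqrt_sqrt s); [field; lra|lra].
    apply: Rmult_le_compat_r; first pos.
    apply: Rmult_le_compat_l; first pos.
    by apply: pow_incr; split=> //; apply: norm_ge_0.
  have -> : 2 * INR n * M ^ 2 * norm u * / sqrt s = 2 * INR n * (M ^ 2 * norm u * / sqrt s) by ring.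
  by apply: Rmult_le_compat_l; lra.
(* Below a the integral is at most 4 n M^2 sqrt(a), which this choice makes 4 M^2. *)
set a := / (INR n ^ 2).
have Hn2 : 0 < INR n ^ 2 by pos.
have Ha : 0 < a by pos.
have Han : a <= INR n.
  apply: Rle_trans (_ : 1 <= _); last lra.
  rewrite /a -Rinv_1; apply: Rinv_le_contravar; nra.
have Hlna : ln a = - 2 * ln (INR n).
  by rewrite /a ln_Rinv // -Rpower_pow ?ln_exp /=; [ring|lra].
have H1 : norm (minus (g (INR n)) (g a)) <= 12 * C * norm u * ln (INR n).
  have := mean_value_inequality Hrin g g' (fun s => 4 * C * norm u * ln s)
    (fun s => 4 * C * norm u * / s) a (INR n) Han.
  move=> H; apply: Rle_trans (H _ _ _) _.
  - by move=> s Hs; apply: Hg; lra.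
  - move=> s Hs; apply: is_derive_scal; auto_derive; [lra|field; lra].
  - by move=> s Hs; apply: Hhigh; lra.
  - by rewrite Hlna; right; ring.
have H2 : norm (g (INR n)) <= exp (2 * M) * norm u.
  apply: Rle_trans (cayley_iter_norm n (INR n) u ltac:(lra)) _.
  apply: Rmult_le_compat_r => //; apply: exp_mono.
  have -> : INR n * (2 * (M / (1 + INR n))) = 2 * M * (INR n / (1 + INR n)) by field; lra.
  have : INR n / (1 + INR n) <= 1.
    apply: (Rmult_le_reg_r (1 + INR n)); first lra.
    have -> : INR n / (1 + INR n) * (1 + INR n) = INR n by field; lra.
    lra.
  nra.
have Hsa : sqrt a = / INR n.
  rewrite /a sqrt_inv; congr (/ _); exact: sqrt_pow2 (INR n) ltac:(lra).
have H3 s : 0 < s < a -> norm (minus (g a) (g s)) <= 4 * M ^ 2 * norm u.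
  move=> Hs.
  have := mean_value_inequality Hrin g g' (fun s => 4 * INR n * M ^ 2 * norm u * sqrt s)
    (fun s => 2 * INR n * M ^ 2 * norm u * / sqrt s) s a ltac:(lra).
  move=> H; apply: Rle_trans (H _ _ _) _.
  - by move=> s' Hs'; apply: Hg; lra.
  - move=> s' Hs'; have Hss : 0 < sqrt s' by apply: sqrt_lt_R0; lra.
    auto_derive; [lra|field; lra].
  - by move=> s' Hs'; apply: Hlow; lra.
  - rewrite Hsa.
    have H4 : 0 <= sqrt s by apply: sqrt_pos.
    have -> : 4 * INR n * M ^ 2 * norm u * / INR n = 4 * M ^ 2 * norm u by field; lra.
    have : 0 <= 4 * INR n * M ^ 2 * norm u * sqrt s.
      pos.
    lra.
have H4 : norm (g 0) <= exp (2 * M) * norm u + 12 * C * norm u * ln (INR n) + 4 * M ^ 2 * norm u.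
  apply: limit_norm_le; first by apply: cayley_iter_continuous; lra.
  apply: (at_right_intro _ a Ha) => s Hs.
  have H5 := norm_split (g s) (g a).
  have H6 := norm_split (g a) (g (INR n)).
  have H7 := H3 s Hs.
  rewrite norm_minus_sym in H7; rewrite norm_minus_sym in H1; lra.
apply: Rle_trans H4 _.
have := pow2_ge_0 M; have := exp_pos (2 * M) => H5 H6.
have H7 : exp (2 * M) * norm u <= exp (2 * M) * norm u * ln (INR n).
  by have : 0 <= exp (2 * M) * norm u; [apply: Rmult_le_pos; lra|nra].
have H8 : 4 * M ^ 2 * norm u <= 4 * M ^ 2 * norm u * ln (INR n).
  by have : 0 <= 4 * M ^ 2 * norm u; [apply: Rmult_le_pos; lra|nra].
lra.
Qed.

Section BoundedInverse.
Context (Ai : V -> V) (K gamma : R).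
Hypothesis HAl : is_linear Ai.
Hypothesis HK : 1 <= K.
Hypothesis HAn : forall u, norm (Ai u) <= K * norm u.
Hypothesis HAr : forall l u, 0 < l -> Ai u = laplace T l (plus u (scal l (Ai u))).
Hypothesis HAc : forall l u, 0 < l -> laplace T l (Ai u) = Ai (laplace T l u).
Hypothesis Hgamma : 0 < gamma.
Hypothesis HAd : forall J, exists D, 0 < D /\ forall t x, 0 < t ->
    norm (T t (Nat.iter J Ai x)) <= D * Rpower t (- (INR J * gamma)) * norm x.

(** From A^{-1} = R_xi (1 + (1 + xi) A^{-1}): J inverses count as J resolvents at every shift xi <=
    1, with a constant independent of xi. *)
Lemma inverse_factor xi J x : 0 < xi <= 1 -> exists y,
  Nat.iter J Ai x = Nat.iter J (Rx xi) y /\ norm y <= (1 + 2 * K) ^ J * norm x.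
Proof.
move=> Hxi; elim: J => [|J [y [H1 H2]]].
  by exists x; split=> //=; lra.
exists (plus y (scal (1 + xi) (Ai y))); split.
- rewrite Nat.iter_succ H1 Nat.iter_succ_r.
  have -> : Rx xi (plus y (scal (1 + xi) (Ai y))) = Ai y.
    by rewrite /Rx /shifted_resolvent -HAr //; lra.
  rewrite -(iter_commute (Rx xi) Ai J y) //.
  by move=> z; rewrite /Rx /shifted_resolvent HAc //; lra.
- apply: Rle_trans (norm_triangle _ _) _.
  rewrite norm_scal_R Rabs_pos_eq; last lra.
  have H3 := HAn y; have H4 := norm_ge_0 y.
  have H5 : (1 + xi) * norm (Ai y) <= 2 * K * norm y.
    have H6 : 0 <= norm (Ai y) by pos.
    nra.
  rewrite /= Rmult_assoc.
  apply: Rle_trans (_ : (1 + 2 * K) * norm y <= _); first lra.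
  by apply: Rmult_le_compat_l; first lra.
Qed.

Lemma cayley_inverse_high_bound b J : (2 <= b + J)%nat -> exists C, 0 < C /\
  forall xi n x, 0 < xi <= 1 -> (b + J <= n)%nat ->
    norm (Nat.iter n (Vx xi) (Nat.iter b (Rx xi) (Nat.iter J Ai x)))
    <= C * Rpower (INR n * xi) (- (INR (b + J) / 2)) * norm x.
Proof.
move=> HbJ.
have Eq : (b + J = S (S (b + J - 2)))%nat by lia.
have [C [HC HB]] := cayley_high_bound HT Hrin (b + J - 2).
have HKJ : 0 < (1 + 2 * K) ^ J by pos.
exists (C * (1 + 2 * K) ^ J); split; first pos.
move=> xi n x Hxi Hn.
have [y [H1 H2]] := inverse_factor xi J x Hxi.
have H3 := HB xi n y (proj1 Hxi) ltac:(lia).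
rewrite -Eq in H3.
rewrite H1 -Nat.iter_add; apply: Rle_trans H3 _.
have Hp : 0 <= C * Rpower (INR n * xi) (- (INR (b + J) / 2)) by pos.
apply: Rle_trans (Rmult_le_compat_l _ _ _ Hp H2) _; right; ring.
Qed.

(** * Descent in the number of resolvents at small shifts *)

Section LowFrequencies.
Context (J : nat).
Hypothesis HJ : (2 <= J)%nat.

Let delta := INR J * gamma.
(** The exponent of the factor (eta / xi)^theta. theta <= delta lets the decay of the orbit supply
    it; 0 < theta < 1/2 makes theta - b / 2 negative for b >= 1 and positive for b = 0, so that the
    powers of the shift are integrated without a logarithm and the last integral converges at 0. *)
Let theta := Rmin delta (1 / 4).

Let delta_pos : 0 < delta.
Proof. by apply: Rmult_lt_0_compat => //; apply: lt_0_INR; lia. Qed.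

Let theta_pos : 0 < theta.
Proof. by apply: Rmin_glb_lt; lra. Qed.

Let theta_le : theta <= 1 / 4.
Proof. exact: Rmin_r. Qed.

Let theta_delta : theta <= delta.
Proof. exact: Rmin_l. Qed.

Let g n b x s := Nat.iter n (Vx s) (Nat.iter b (Rx s) (Nat.iter J Ai x)).

(* xi plays the role of n^(-beta / (2 + beta)), where both lower bounds for W
   become n^(- J / (2 + beta)). *)
Let admissible n xi W :=
  xi <= 1 /\ Rpower xi delta <= W /\ Rpower (INR n * xi) (- (INR J / 2)) <= W.

Let low_bound b := exists C n0, 0 < C /\ forall n eta xi W x,
  (n0 <= n)%nat -> 0 < eta <= xi -> admissible n xi W ->
  norm (g n b x eta)
    <= C * W * Rpower (INR n * eta) (- (INR b / 2)) * Rpower (eta / xi) theta * norm x.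

(** eta^delta = (eta / xi)^delta xi^delta: the power of xi is at most W, and the power of eta / xi
    <= 1 is weakened to the exponent theta. *)
Lemma low_bound_base q : 2 * delta <= INR q -> low_bound (S (S q)).
Proof.
move=> Hq.
have [D [HD Hdec]] := HAd J.
have [C [HC HB]] := cayley_decay_bound HT Hrin q delta D HD (Rlt_le _ _ delta_pos) Hq.
exists C, (S q); split=> // n eta xi W x Hn Heta [Hxi1 [HW1 HW2]].
have H1 := HB eta n _ (norm x) (proj1 Heta) Hn (norm_ge_0 x) (fun t => Hdec t x).
apply: Rle_trans H1 _.
have Hpe : 0 < Rpower (eta / xi) theta by pos.
have H2 : Rpower eta delta <= W * Rpower (eta / xi) theta.
  have -> : eta = eta / xi * xi by field; lra.
  have Hq1 : 0 < eta / xi by pos.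
  have Hq2 : eta / xi <= 1.
    apply: (Rmult_le_reg_r xi); first lra.
    have -> : eta / xi * xi = eta by field; lra.
    lra.
  rewrite -Rpower_mult_distr //; last lra.
  rewrite Rmult_comm; apply: Rmult_le_compat => //; try by apply: Rlt_le; apply: exp_pos.
  have -> : eta / xi * xi / xi = eta / xi by field; lra.
  exact: Rpower_le_exponent.
have -> : C * W * Rpower (INR n * eta) (- (INR (S (S q)) / 2)) * Rpower (eta / xi) theta * norm x
  = C * Rpower (INR n * eta) (- (INR (S (S q)) / 2)) * (W * Rpower (eta / xi) theta) * norm x by ring.
apply: Rmult_le_compat_r; first pos.
apply: Rmult_le_compat_l => //.
pos.
Qed.

(** Both terms of the derivative of V_s^n R_s^b are at most a multiple of W n^(-b/2) xi^(-theta)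
    s^(theta - b/2 - 1), whose primitive is explicit since theta - b/2 is never 0. *)
Lemma low_bound_difference b : low_bound (S b) -> low_bound (S (S b)) ->
  exists C n0, 0 < C /\ forall n eta xi W x,
  (n0 <= n)%nat -> 0 < eta <= xi -> admissible n xi W ->
  norm (minus (g n b x xi) (g n b x eta))
    <= C * W * norm x * Rpower (INR n) (- (INR b / 2)) * Rpower xi (- theta)
       * ((Rpower xi (theta - INR b / 2) - Rpower eta (theta - INR b / 2)) / (theta - INR b / 2)).
Proof.
move=> [C1 [n1 [HC1 H1]]] [C2 [n2 [HC2 H2]]].
(* [c2] and [c3] pay for the exponent n - 1 >= n / 2 of the first term: [c2] in the admissibility of
   W, [c3] in the power of n s. *)
set c2 := Rpower 2 (INR J / 2).
set c3 := Rpower 2 (INR (S (S b)) / 2).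
have Hc2 : 0 < c2 by pos.
have Hc3 : 0 < c3 by pos.
have Hb0 := pos_INR b.
set C := 2 * (C2 * c2 * c3) + INR b * C1.
have HC22 : 0 < C2 * c2 * c3 by pos.
have HC : 0 < C by pos.
exists C, (S (S (S (n1 + n2)))); split=> // n eta xi W x Hn Heta Hadm.
have [Hxi1 [HW1 HW2]] := Hadm.
have HW : 0 < W by apply: Rlt_le_trans HW1; apply: exp_pos.
have Hn3 : 3 <= INR n by have := le_INR 3 n ltac:(lia); rewrite /=; lra.
have Hx := norm_ge_0 x.
have Hpred : INR (pred n) = INR n - 1.
  by case: (n) Hn => [|m] Hm; [lia|rewrite S_INR /=; ring].
have Hadm2 : admissible (pred n) xi (c2 * W).
  split=> //; split.
  - apply: Rle_trans HW1 _.
    have : 1 <= c2.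
      rewrite /c2 -(Rpower_O 2); last lra.
      apply: Rle_Rpower; first lra.
      have := pos_INR J; lra.
    nra.
  - apply: Rle_trans (_ : c2 * Rpower (INR n * xi) (- (INR J / 2)) <= _); last first.
      by apply: Rmult_le_compat_l; first lra.
    have -> : c2 * Rpower (INR n * xi) (- (INR J / 2)) = Rpower (INR n * xi / 2) (- (INR J / 2)).
      rewrite Rpower_div_base; last lra; last pos.
      by rewrite Ropp_involutive /c2 Rmult_comm.
    apply: Rpower_neg_le.
    + pos.
    + rewrite Hpred; nra.
    + have := pos_INR J; lra.
set p := theta - INR b / 2.
set c := C * W * norm x * Rpower (INR n) (- (INR b / 2)) * Rpower xi (- theta).
pose g' s := plus (scal (2 * INR n) (Nat.iter (pred n) (Vx s) (Rx s (Rx s (Nat.iter b (Rx s) (Nat.iter J Ai x))))))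
       (Nat.iter n (Vx s) (scal (- INR b) (Nat.iter (S b) (Rx s) (Nat.iter J Ai x)))).
have Hp : p <> 0.
  rewrite /p; case: (b) => [|b']; first by rewrite /=; lra.
  rewrite S_INR; have := pos_INR b'; lra.
have Hder s : eta <= s <= xi -> norm (g' s) <= c * Rpower s (p - 1).
  move=> Hs.
  have Hns : 0 < INR n * s by pos.
  have Hlin : is_linear (Nat.iter n (Vx s)).
    by apply: iter_linear; apply: (shifted_cayley_linear HT); lra.
  set Q := W * (INR n * Rpower (INR n * s) (- (INR (S (S b)) / 2))) * Rpower (s / xi) theta * norm x.
  have HQ : 0 <= Q by pos.
  have HQc : C * Q = c * Rpower s (p - 1).
    rewrite /Q /c Rpower_div_base; try lra.
    rewrite -Rpower_mult_distr; try lra.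
    have E1 : INR n * Rpower (INR n) (- (INR (S (S b)) / 2)) = Rpower (INR n) (- (INR b / 2)).
      rewrite -{1}(Rpower_1 (INR n)); last lra.
      by rewrite -Rpower_plus !S_INR; congr Rpower; field.
    have E2 : Rpower s (- (INR (S (S b)) / 2)) * Rpower s theta = Rpower s (p - 1).
      by rewrite -Rpower_plus /p !S_INR; congr Rpower; field.
    rewrite -E1 -E2; ring.
  rewrite -HQc /C Rmult_plus_distr_r.
  apply: Rle_trans (norm_triangle _ _) _; apply: Rplus_le_compat.
  - rewrite norm_scal_R Rabs_pos_eq; last lra.
    have H3 := H2 (pred n) s xi (c2 * W) x ltac:(lia) ltac:(lra) Hadm2.
    rewrite /g Hpred in H3.
    have H4 : Rpower ((INR n - 1) * s) (- (INR (S (S b)) / 2))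
        <= c3 * Rpower (INR n * s) (- (INR (S (S b)) / 2)).
      have -> : c3 * Rpower (INR n * s) (- (INR (S (S b)) / 2)) = Rpower (INR n * s / 2) (- (INR (S (S b)) / 2)).
        rewrite Rpower_div_base; try lra.
        by rewrite Ropp_involutive /c3 Rmult_comm.
      apply: Rpower_neg_le; try lra.
      + nra.
      + have := pos_INR (S (S b)); lra.
    apply: Rle_trans (Rmult_le_compat_l (2 * INR n) _ _ ltac:(lra) H3) _.
    have Hpp : 0 < Rpower (s / xi) theta by pos.
    have H5 : 0 <= 2 * INR n * (C2 * (c2 * W)) * Rpower (s / xi) theta * norm x by pos.
    have := Rmult_le_compat_l _ _ _ H5 H4.
    rewrite /Q; lra.
  - rewrite (linear_scal _ Hlin) norm_scal_R Rabs_Ropp Rabs_pos_eq // Rmult_assoc.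
    apply: Rmult_le_compat_l => //.
    have H3 := H1 n s xi W x ltac:(lia) ltac:(lra) Hadm.
    apply: Rle_trans H3 _.
    (* The term with only b + 1 resolvents fits under the same bound because (n s)^(1/2) <= n, as s
       <= xi <= 1 <= n. *)
    have H4 : Rpower (INR n * s) (- (INR (S b) / 2)) <= INR n * Rpower (INR n * s) (- (INR (S (S b)) / 2)).
      have -> : Rpower (INR n * s) (- (INR (S b) / 2))
         = Rpower (INR n * s) (1 / 2) * Rpower (INR n * s) (- (INR (S (S b)) / 2)).
        by rewrite -Rpower_plus !S_INR; congr Rpower; field.
      apply: Rmult_le_compat_r; first pos.
      apply: Rle_trans (_ : Rpower (INR n) (1 / 2) <= _).
        apply: Rle_Rpower_l; first lra.
        split=> //; nra.
      rewrite -{2}(Rpower_1 (INR n)); last lra.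
      apply: Rle_Rpower; lra.
    have Hpp : 0 < Rpower (s / xi) theta by pos.
    have H5 : 0 <= C1 * W * Rpower (s / xi) theta * norm x by pos.
    have := Rmult_le_compat_l _ _ _ H5 H4.
    rewrite /Q; lra.
have := mean_value_inequality Hrin (g n b x) g' (fun s => c / p * Rpower s p)
   (fun s => c * Rpower s (p - 1)) eta xi (proj2 Heta).
move=> H; apply: Rle_trans (H _ _ Hder) _.
- move=> s Hs.
  have Hs1 : -1 < s by lra.
  exact: (cayley_iter_derive HT n s (fun s => Nat.iter b (Rx s) (Nat.iter J Ai x)) _ Hs1
            (resolvent_iter_derive HT b s (Nat.iter J Ai x) Hs1)).
- move=> s Hs.
  have -> : c * Rpower s (p - 1) = c / p * (p * Rpower s (p - 1)) by field.
  apply: is_derive_scal; apply: is_derive_Rpower; lra.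
- by right; field.
Qed.

(** The value at eta is the value at xi plus the difference. At xi, (n xi)^(-(b + J)/2) = (n
    xi)^(-J/2) (n eta)^(-b/2) (eta / xi)^(b/2), and b / 2 >= theta. In the difference the power at
    eta prevails, its exponent theta - b/2 being negative. *)
Lemma low_bound_step b : (1 <= b)%nat -> low_bound (S b) -> low_bound (S (S b)) -> low_bound b.
Proof.
move=> Hb H1 H2.
have [C [n0 [HC H]]] := low_bound_difference b H1 H2.
have [C' [HC' H']] := cayley_inverse_high_bound b J ltac:(lia).
have Hb1 : 1 <= INR b by have := le_INR 1 b Hb.
have He : 0 < INR b / 2 - theta by lra.
set e := INR b / 2 - theta in He.
exists (C' + C / e), (n0 + S (b + J))%nat.
have HCe : 0 < C / e by pos.
split; first lra.
move=> n eta xi W x Hn Heta Hadm.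
have [Hxi1 [HW1 HW2]] := Hadm.
have HW : 0 < W by apply: Rlt_le_trans HW1; apply: exp_pos.
have Hx := norm_ge_0 x.
have Hnpos : 0 < INR n by pos.
have H3 := H n eta xi W x ltac:(lia) Heta Hadm.
have H4 := H' xi n x ltac:(lra) ltac:(lia).
have H5 := norm_split (g n b x eta) (g n b x xi).
rewrite norm_minus_sym in H3.
apply: Rle_trans H5 _.
have Hq1 : 0 < eta / xi by pos.
have Hq2 : eta / xi <= 1.
  apply: (Rmult_le_reg_r xi); first lra.
  have -> : eta / xi * xi = eta by field; lra.
    lra.
set Q := W * Rpower (INR n * eta) (- (INR b / 2)) * Rpower (eta / xi) theta * norm x.
have -> : (C' + C / e) * W * Rpower (INR n * eta) (- (INR b / 2)) * Rpower (eta / xi) theta * norm x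
  = C' * Q + C / e * Q by rewrite /Q; ring.
apply: Rplus_le_compat.
- apply: Rle_trans H4 _.
  have E : Rpower (INR n * xi) (- (INR (b + J) / 2))
     = Rpower (INR n * xi) (- (INR J / 2)) * (Rpower (INR n * eta) (- (INR b / 2)) * Rpower (eta / xi) (INR b / 2)).
    have -> : INR n * eta = INR n * xi * (eta / xi) by field; lra.
    rewrite -(Rpower_mult_distr _ (eta / xi)) //; last pos.
    rewrite Rmult_assoc -(Rpower_plus _ _ (eta / xi)).
    have -> : - (INR b / 2) + INR b / 2 = 0 by ring.
    by rewrite Rpower_O // Rmult_1_r -Rpower_plus plus_INR; congr Rpower; field.
  rewrite E /Q.
  have H6 : Rpower (eta / xi) (INR b / 2) <= Rpower (eta / xi) theta by apply: Rpower_le_exponent; lra.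
  have H7 : 0 < Rpower (INR n * eta) (- (INR b / 2)) by pos.
  have H8 : 0 < Rpower (INR n * xi) (- (INR J / 2)) by pos.
  have H9 : 0 < Rpower (eta / xi) (INR b / 2) by pos.
  rewrite !Rmult_assoc; apply: Rmult_le_compat_l; first lra.
  rewrite -!Rmult_assoc; apply: Rmult_le_compat_r => //.
  apply: Rmult_le_compat => //; try lra.
    pos.
  by apply: Rmult_le_compat_r; lra.
- apply: Rle_trans H3 _.
  have E : Rpower (INR n) (- (INR b / 2)) * Rpower xi (- theta) * Rpower eta (theta - INR b / 2)
     = Rpower (INR n * eta) (- (INR b / 2)) * Rpower (eta / xi) theta.
    rewrite -Rpower_mult_distr; try lra.
    rewrite Rpower_div_base; try lra.
    have -> : theta - INR b / 2 = - (INR b / 2) + theta by ring.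
    by rewrite Rpower_plus; ring.
  have -> : C / e * Q = C * W * norm x * Rpower (INR n) (- (INR b / 2)) * Rpower xi (- theta)
       * (Rpower eta (theta - INR b / 2) / e).
    have -> : Q = W * (Rpower (INR n * eta) (- (INR b / 2)) * Rpower (eta / xi) theta) * norm x by rewrite /Q; ring.
    by rewrite -E; field; lra.
  apply: Rmult_le_compat_l.
    have H6 : 0 < Rpower (INR n) (- (INR b / 2)) by pos.
    have H7 : 0 < Rpower xi (- theta) by pos.
    pos.
  have -> : (Rpower xi (theta - INR b / 2) - Rpower eta (theta - INR b / 2)) / (theta - INR b / 2)
    = (Rpower eta (theta - INR b / 2) - Rpower xi (theta - INR b / 2)) / e by rewrite /e; field; lra.
  apply: Rmult_le_compat_r; first pos.
  have : 0 < Rpower xi (theta - INR b / 2) by apply: exp_pos.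
  lra.
Qed.

Lemma low_bound_all b : (1 <= b)%nat -> low_bound b.
Proof.
have [q0 Hq0] : exists q, 2 * delta <= INR q.
  exists (Z.to_nat (up (2 * delta))).
  have [H1 _] := archimed (2 * delta).
  rewrite INR_IZR_INZ Z2Nat.id; first lra.
  apply: le_IZR; lra.
have Hbig q : (q0 <= q)%nat -> low_bound (S (S q)).
  move=> Hq; apply: low_bound_base; apply: Rle_trans Hq0 _; exact: le_INR.
(* Descending induction: m bounds how far b lies below q0 + 2. *)
have H m : forall b, (1 <= b)%nat -> (S (S q0) <= b + m)%nat -> low_bound b.
  elim: m => [|m IH] c Hc Hm.
  - case: c Hc Hm => [|[|q]] Hc Hm; try lia.
    apply: Hbig; lia.
  - case: (Nat.le_gt_cases (S (S q0)) (c + m)) => Hcm; first exact: IH.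
    by apply: low_bound_step => //; apply: IH; lia.
move=> Hb; apply: (H (S (S q0))) => //; lia.
Qed.

(** For b = 0 the exponent theta of the primitive is positive, so the difference is bounded by a
    multiple of W uniformly in eta, and eta may tend to 0. *)
Lemma cayley_inverse_bound : exists C n0, 0 < C /\ forall n xi W x,
  (n0 <= n)%nat -> 0 < xi -> xi <= 1 -> Rpower xi delta <= W ->
  Rpower (INR n * xi) (- (INR J / 2)) <= W ->
  norm (Nat.iter n (Vx 0) (Nat.iter J Ai x)) <= C * W * norm x.
Proof.
have [C [n0 [HC H]]] := low_bound_difference 0 (low_bound_all 1 (le_n _)) (low_bound_all 2 ltac:(lia)).
have [C' [HC' H']] := cayley_inverse_high_bound 0 J ltac:(lia).
have HCt : 0 < C / theta by pos.
exists (C' + C / theta), (n0 + S J)%nat; split; first lra.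
move=> n xi W x Hn Hxi Hxi1 HW1 HW2.
have HW : 0 < W by apply: Rlt_le_trans HW1; apply: exp_pos.
have Hx := norm_ge_0 x.
have Hnpos : 0 < INR n by pos.
apply: (limit_norm_le (fun s => Nat.iter n (Vx s) (Nat.iter J Ai x))).
  by apply: cayley_iter_continuous; lra.
apply: (at_right_intro _ xi Hxi) => s Hs.
have H3 := H n s xi W x ltac:(lia) ltac:(lra) (conj Hxi1 (conj HW1 HW2)).
have H4 := H' xi n x ltac:(lra) ltac:(lia).
have H5 := norm_split (g n 0 x s) (g n 0 x xi).
rewrite norm_minus_sym in H3.
apply: Rle_trans H5 _.
rewrite Rmult_plus_distr_r Rmult_plus_distr_r; apply: Rplus_le_compat.
- apply: Rle_trans H4 _; rewrite Nat.add_0_l; apply: Rmult_le_compat_r => //.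
  by apply: Rmult_le_compat_l; lra.
- apply: Rle_trans H3 _.
  have E0 : INR 0 / 2 = 0 by rewrite /=; field.
  rewrite E0 Ropp_0 Rminus_0_r Rpower_O // Rmult_1_r.
  have -> : C / theta * W * norm x = C * W * norm x * (Rpower xi (- theta) * (Rpower xi theta / theta)).
    have E : Rpower xi (- theta) * Rpower xi theta = 1.
      by rewrite -Rpower_plus Rplus_opp_l Rpower_O.
    have -> : Rpower xi (- theta) * (Rpower xi theta / theta) = / theta.
      by rewrite /Rdiv -Rmult_assoc E; ring.
    by field; lra.
  rewrite Rmult_assoc; apply: Rmult_le_compat_l.
    pos.
  apply: Rmult_le_compat_l; first pos.
  apply: Rmult_le_compat_r; first pos.
  have : 0 < Rpower s theta by apply: exp_pos.
  lra.
Qed.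
End LowFrequencies.

Lemma cayley_inverse_power_bound J : exists C n0, 0 < C /\ forall n x, (n0 <= n)%nat ->
  norm (Nat.iter n (Vx 0) (Nat.iter J Ai x))
  <= C * ln (INR n) * Rpower (INR n) (- (INR J * (gamma / (1 + 2 * gamma)))) * norm x.
Proof.
set r := gamma / (1 + 2 * gamma).
have Hr : 0 < r by pos.
have Hbig J' : (2 <= J')%nat -> exists C n0, 0 < C /\ forall n x, (n0 <= n)%nat ->
    norm (Nat.iter n (Vx 0) (Nat.iter J' Ai x)) <= C * Rpower (INR n) (- (INR J' * r)) * norm x.
  move=> HJ'; have [C [n0 [HC H]]] := cayley_inverse_bound J' HJ'.
  exists C, (S n0); split=> // n x Hn.
  have Hn1 : 1 <= INR n by have := le_INR 1 n ltac:(lia).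
  have Hpos : 0 < 1 + 2 * gamma by lra.
  (* This xi makes xi^(J gamma) and (n xi)^(-J/2) equal: both are n^(- J gamma / (1 + 2 gamma)). *)
  apply: (H n (Rpower (INR n) (- (/ (1 + 2 * gamma))))); first lia.
  - pos.
  - apply: Rle_trans (_ : Rpower (INR n) 0 <= 1); last by rewrite Rpower_O; lra.
    apply: Rle_Rpower => //.
    have := Rinv_0_lt_compat _ Hpos; lra.
  - rewrite Rpower_mult; right; congr Rpower; rewrite /r; field; lra.
  - rewrite -{1}(Rpower_1 (INR n)); last lra.
    rewrite -Rpower_plus Rpower_mult; right; congr Rpower; rewrite /r; field; lra.
have [C0 [HC0 Hlog]] := cayley_log_bound.
case: J => [|[|J]].
- exists C0, 3%nat; split=> // n x Hn; rewrite Rmult_0_l Ropp_0 Rpower_O.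
    by rewrite Rmult_1_r; apply: Hlog.
  pos.
- have [C [n0 [HC H]]] := Hbig 2%nat (le_n _).
  exists (M * C0 + (1 + M) * C), (n0 + 3)%nat; split; first nra.
  move=> n x Hn.
  have Hn1 : 3 <= INR n by have := le_INR 3 n ltac:(lia); rewrite /=; lra.
  have Hln := ln_ge_1 n ltac:(lia).
  set z := Nat.iter n (Vx 0) x.
  have Hcomm y : Nat.iter n (Vx 0) (Ai y) = Ai (Nat.iter n (Vx 0) y).
    apply: iter_commute => w; symmetry.
    apply: (shifted_cayley_commute (T := T) 0 Ai ltac:(lra) HAl) => v.
    by rewrite /shifted_resolvent HAc //; lra.
  have H1 : norm z <= C0 * ln (INR n) * norm x by apply: Hlog; lia.
  have H2 : norm (Ai (Ai z)) <= C * Rpower (INR n) (- (2 * r)) * norm x.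
    by have := H n x ltac:(lia); rewrite !Nat.iter_succ !Hcomm.
  rewrite Nat.iter_succ [Nat.iter 0 _ _]/= Hcomm -/z Rmult_1_l.
  set N := Rpower (INR n) r.
  have HN : 0 < N by pos.
  have EN : Rpower (INR n) (- r) = / N by rewrite /N Rpower_Ropp.
  have EN2 : Rpower (INR n) (- (2 * r)) = / N * / N.
    by rewrite -EN -Rpower_plus; congr Rpower; ring.
  have HL := laplace_linear HT N HN.
  (* Interpolation between z and A^{-2} z at the scale N = n^r: A^{-1} z = (N + A)^{-1} z + N (1 - N
     (N + A)^{-1}) A^{-2} z, where |(N + A)^{-1}| <= M / N. *)
  have E1 : Ai z = plus (laplace T N z) (scal N (minus (Ai (Ai z)) (scal N (laplace T N (Ai (Ai z)))))).
    have E2 : Ai (Ai z) = plus (laplace T N (Ai z)) (scal N (laplace T N (Ai (Ai z)))).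
      by rewrite {1}(HAr N (Ai z) HN) (linear_plus _ HL) (linear_scal _ HL).
    have E3 : Ai z = plus (laplace T N z) (scal N (laplace T N (Ai z))).
      by rewrite {1}(HAr N z HN) (linear_plus _ HL) (linear_scal _ HL).
    rewrite {1}E3; congr (plus _ (scal N _)).
    by rewrite {1}E2; lin_real V.
  have H3 := laplace_norm HT N z HN.
  have H4 := laplace_norm HT N (Ai (Ai z)) HN.
  have H5 : norm (Ai z) <= M / N * norm z + N * ((1 + M) * norm (Ai (Ai z))).
    rewrite {1}E1; apply: Rle_trans (norm_triangle _ _) _; apply: Rplus_le_compat => //.
    rewrite norm_scal_R Rabs_pos_eq; last lra.
    apply: Rmult_le_compat_l; first lra.
    apply: Rle_trans (norm_minus_le _ _) _.
    rewrite norm_scal_R Rabs_pos_eq; last lra.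
    have := Rmult_le_compat_l N _ _ ltac:(lra) H4.
    have -> : N * (M / N * norm (Ai (Ai z))) = M * norm (Ai (Ai z)) by field; lra.
    lra.
  apply: Rle_trans H5 _.
  rewrite EN; rewrite EN2 in H2.
  have HNi : 0 < / N by pos.
  have Hx := norm_ge_0 x.
  have H6 : M / N * norm z <= M * C0 * (ln (INR n) * (/ N * norm x)).
    have -> : M * C0 * (ln (INR n) * (/ N * norm x)) = M / N * (C0 * ln (INR n) * norm x) by field; lra.
    apply: Rmult_le_compat_l => //.
    pos.
  have H7 : N * ((1 + M) * norm (Ai (Ai z))) <= (1 + M) * C * (1 * (/ N * norm x)).
    have -> : (1 + M) * C * (1 * (/ N * norm x)) = N * ((1 + M) * (C * (/ N * / N) * norm x)) by field; lra.
    apply: Rmult_le_compat_l; first lra.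
    by apply: Rmult_le_compat_l; lra.
  have H8 : 1 * (/ N * norm x) <= ln (INR n) * (/ N * norm x).
    by apply: Rmult_le_compat_r => //; apply: Rmult_le_pos; lra.
  have H9 : (1 + M) * C * (1 * (/ N * norm x)) <= (1 + M) * C * (ln (INR n) * (/ N * norm x)).
    by apply: Rmult_le_compat_l => //; nra.
  lra.
- have [C [n0 [HC H]]] := Hbig (S (S J)) ltac:(lia).
  exists C, (n0 + 3)%nat; split=> // n x Hn.
  have Hln := ln_ge_1 n ltac:(lia).
  apply: Rle_trans (H n x ltac:(lia)) _.
  have Hx := norm_ge_0 x.
  have Hp : 0 < Rpower (INR n) (- (INR (S (S J)) * r)) by pos.
  apply: Rmult_le_compat_r => //.
  have : 0 < C * Rpower (INR n) (- (INR (S (S J)) * r)) by apply: Rmult_lt_0_compat.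
  nra.
Qed.
End BoundedInverse.
End CayleyEstimates.

(** * Complex resolvents *)

Ltac lin_complex H :=
  lin_eq_with C_Ring H;
  rewrite /plus /mult /opp /one /zero /=; try (ring || field).

Section Realification.
Context {H : CompleteNormedModule C_AbsRing}.

Lemma realify_scal (r : R) (x : H) :
  scal (r : R_AbsRing) (x : realify H) = scal (RtoC r : C_AbsRing) x.
Proof. by []. Qed.

Lemma norm_scal_C (c : C) (x : H) : norm (scal (c : C_AbsRing) x) = Cmod c * norm x.
Proof.
apply: Rle_antisym; first exact: (norm_scal (c : C_AbsRing) x).
case: (Ceq_dec c 0) => [->|Hc].
  by rewrite Cmod_0 Rmult_0_l; apply: norm_ge_0.
have E : scal ((/ c)%C : C_AbsRing) (scal (c : C_AbsRing) x) = x.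
  have Ec : mult ((/ c)%C : C_AbsRing) (c : C_AbsRing) = one by exact: Cinv_l.
  by rewrite scal_assoc Ec scal_one.
have Hn := norm_scal ((/ c)%C : C_AbsRing) (scal (c : C_AbsRing) x).
rewrite E /abs /= Cmod_inv // in Hn.
have Hp : 0 < Cmod c by apply (proj1 (Cmod_gt_0 c)); exact: Hc.
apply: Rle_trans (Rmult_le_compat_l _ _ _ (Rlt_le _ _ Hp) Hn) _.
by right; field; lra.
Qed.

Lemma is_linear_realify (B : H -> H) :
  is_linear (K := C_AbsRing) B -> is_linear (K := R_AbsRing) (U := realify H) (V := realify H) B.
Proof.
move=> HB; split.
- exact: linear_plus _ HB.
- by move=> k x; rewrite realify_scal (linear_scal _ HB).
- exact: linear_norm _ HB.
Qed.

Definition rotation (b t : R) : C := (cos (b * t), - sin (b * t)).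

Lemma rotation_0 b : rotation b 0 = 1%C.
Proof. by rewrite /rotation Rmult_0_r cos_0 sin_0 Ropp_0. Qed.

Lemma rotation_plus b s t : rotation b (s + t) = (rotation b s * rotation b t)%C.
Proof.
rewrite /rotation Rmult_plus_distr_l cos_plus sin_plus /Cmult /=.
by congr (_, _); ring.
Qed.

Lemma Cmod_rotation b t : Cmod (rotation b t) = 1.
Proof.
rewrite /Cmod /rotation /=.
apply: eq_trans sqrt_1; congr sqrt.
by have := sin2_cos2 (b * t); rewrite /Rsqr; lra.
Qed.

Lemma rotation_inv b t : (rotation (- b) t * rotation b t)%C = 1%C.
Proof.
rewrite /rotation Ropp_mult_distr_l_reverse cos_neg sin_neg /Cmult /=.
have E := sin2_cos2 (b * t); rewrite /Rsqr in E.
by congr (_, _); lra.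
Qed.

Lemma filterlim_C {T : Type} (F : (T -> Prop) -> Prop) {FF : Filter F} (f : T -> C) (l : C) :
  filterlim (fun t => Re (f t)) F (locally (Re l)) ->
  filterlim (fun t => Im (f t)) F (locally (Im l)) ->
  filterlim f F (locally (l : C_AbsRing)).
Proof.
move=> H1 H2.
apply (proj2 (filterlim_locally (U := AbsRing_UniformSpace C_AbsRing) f l)).
move=> eps.
have He : 0 < eps / 2 by have := cond_pos eps; lra.
apply (filter_and_imp (proj1 (filterlim_locally _ _) H1 (mkposreal _ He))
  (proj1 (filterlim_locally _ _) H2 (mkposreal _ He))) => t Ha Hb.
change (Cmod (Cminus (f t) l) < eps).
have H3 : Rabs (Re (f t) - Re l) < eps / 2 by exact: Ha.
have H4 : Rabs (Im (f t) - Im l) < eps / 2 by exact: Hb.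
apply: Rle_lt_trans (_ : Rabs (Re (f t) - Re l) + Rabs (Im (f t) - Im l) < _); last lra.
have E : Cminus (f t) l = Cplus (RtoC (Re (f t) - Re l)) (Cmult Ci (RtoC (Im (f t) - Im l))).
  by rewrite /Cminus /Cplus /Cmult /Copp /Ci /RtoC /Re /Im /=; congr (_, _); ring.
rewrite E; apply: Rle_trans (Cmod_triangle _ _) _.
rewrite Cmod_mult !Cmod_R.
have -> : Cmod Ci = 1.
  by rewrite /Cmod /Ci /=; apply: eq_trans sqrt_1; congr sqrt; ring.
lra.
Qed.

Lemma rotation_limit b : filterlim (rotation b) (at_right 0) (locally (RtoC 1 : C_AbsRing)).
Proof.
apply: filterlim_C.
- have -> : Re 1%C = cos (b * 0) by rewrite Rmult_0_r cos_0.
  have Hc : continuous (fun t => cos (b * t)) 0.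
    by apply: (ex_derive_continuous (fun t => cos (b * t))); auto_derive.
  by move=> P HP; apply: at_right_filter_le; apply: Hc.
- have -> : Im 1%C = - sin (b * 0) by rewrite Rmult_0_r sin_0 Ropp_0.
  have Hc : continuous (fun t => - sin (b * t)) 0.
    by apply: (ex_derive_continuous (fun t => - sin (b * t))); auto_derive.
  by move=> P HP; apply: at_right_filter_le; apply: Hc.
Qed.

Lemma rotation_derive b :
  filterlim (fun t => (RtoC (/ t) * (rotation b t - 1))%C) (at_right 0)
    (locally ((- (Ci * RtoC b))%C : C_AbsRing)).
Proof.
have Hd1 : is_derive (fun t => cos (b * t)) 0 0.
  by auto_derive => //; rewrite Rmult_0_r sin_0; ring.
have Hd2 : is_derive (fun t => - sin (b * t)) 0 (- b).
  by auto_derive => //; rewrite Rmult_0_r cos_0; ring.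
apply: filterlim_C.
- have -> : Re (- (Ci * RtoC b))%C = 0 by rewrite /Ci /RtoC /Re /=; ring.
  apply: (filterlim_ext _ _ _ (derive_at_right (V := R_CompleteNormedModule) _ _ Hd1)).
  move=> t; rewrite /rotation /scal /= /mult /= /minus /plus /opp /= Rmult_0_r cos_0.
  by rewrite /Re /=; ring.
- have -> : Im (- (Ci * RtoC b))%C = - b by rewrite /Ci /RtoC /Im /=; ring.
  apply: (filterlim_ext _ _ _ (derive_at_right (V := R_CompleteNormedModule) _ _ Hd2)).
  move=> t; rewrite /rotation /scal /= /mult /= /minus /plus /opp /= Rmult_0_r sin_0.
  by rewrite /Im /=; ring.
Qed.

Context {T : R -> H -> H} {M : R}.
Hypothesis HTlin : forall t, 0 <= t -> is_linear (K := C_AbsRing) (T t).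
Hypothesis HT : bounded_semigroup (V := realify H) T M.

Definition rotated_semigroup (b t : R) (x : H) : H := scal (rotation b t : C_AbsRing) (T t x).

Lemma is_linear_scal_C (c : C) : is_linear (K := C_AbsRing) (fun x : H => scal (c : C_AbsRing) x).
Proof.
split.
- by move=> x y; rewrite scal_distr_l.
- by move=> k x; lin_complex H.
- exists (Cmod c + 1); split; first by have := Cmod_ge_0 c; lra.
  by move=> x; rewrite norm_scal_C; have := norm_ge_0 x; nra.
Qed.

Lemma rotated_linear b t : 0 <= t -> is_linear (K := C_AbsRing) (rotated_semigroup b t).
Proof.
move=> Ht; exact: (is_linear_comp (T t) _ (HTlin t Ht) (is_linear_scal_C _)).
Qed.

Lemma rotated_bounded_semigroup b : bounded_semigroup (V := realify H) (rotated_semigroup b) M.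
Proof.
split.
- exact: bs_pos _ _ HT.
- by move=> t Ht; apply: is_linear_realify; apply: rotated_linear.
- by move=> x; rewrite /rotated_semigroup rotation_0 (bs_zero _ _ HT); apply: (scal_one x).
- move=> s t x Hs Ht; rewrite /rotated_semigroup rotation_plus (bs_plus _ _ HT) //.
  rewrite (linear_scal _ (HTlin s Hs)); lin_complex H.
- move=> x; rewrite /rotated_semigroup.
  have E : scal (RtoC 1 : C_AbsRing) x = x by exact: scal_one.
  rewrite -{2}E.
  exact: (filterlim_scal_fun (K := C_AbsRing) (V := H) (rotation b) (fun t => T t x)
    _ _ (rotation_limit b) (bs_cont _ _ HT x)).
- move=> t x Ht; rewrite /rotated_semigroup.
  apply: Rle_trans (_ : norm (T t x) <= _); last exact: (bs_bound _ _ HT).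
  by right; rewrite [LHS]norm_scal_C Cmod_rotation Rmult_1_l.
Qed.

(** Leibniz rule for the difference quotient at 0. The family [S] is arbitrary, so that the lemma
    applies once more, with -b, to undo a rotation. *)
Lemma rotated_generator_aux (S : R -> H -> H) b x y :
  neg_generator (V := realify H) S x y ->
  neg_generator (V := realify H) (fun t x => scal (rotation b t : C_AbsRing) (S t x))
    x (plus y (scal ((Ci * RtoC b)%C : C_AbsRing) x)).
Proof.
rewrite /neg_generator => Hg.
pose proof (filterlim_scal_fun (K := C_AbsRing) (V := H) (F := at_right 0) (rotation b) _
    _ _ (rotation_limit b) Hg) as H1.
pose proof (filterlim_scal_fun (K := C_AbsRing) (V := H) (F := at_right 0) _ (fun _ => x)
    _ _ (rotation_derive b) (filterlim_const x)) as H2.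
pose proof (filterlim_plus_fun (K := C_AbsRing) (V := H) (F := at_right 0) _ _ _ _ H1 H2) as H3.
have E : opp (plus y (scal ((Ci * RtoC b)%C : C_AbsRing) x))
  = plus (scal (RtoC 1 : C_AbsRing) (opp y)) (scal ((- (Ci * RtoC b))%C : C_AbsRing) x) by lin_complex H.
have H4 : filterlim (fun t => plus (scal (rotation b t : C_AbsRing) (scal (RtoC (/ t) : C_AbsRing) (minus (S t x) x)))
    (scal ((RtoC (/ t) * (rotation b t - 1))%C : C_AbsRing) x)) (at_right 0)
   (locally (opp (plus y (scal ((Ci * RtoC b)%C : C_AbsRing) x)) : H)).
  by rewrite E; exact: H3.
apply: (filterlim_ext (F := at_right 0) _ _ _ H4) => t.
rewrite realify_scal.
change (plus (scal (rotation b t : C_AbsRing) (scal (RtoC (/ t) : C_AbsRing) (minus (S t x) x)))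
    (scal ((RtoC (/ t) * (rotation b t - 1))%C : C_AbsRing) x)
  = scal (RtoC (/ t) : C_AbsRing) (minus (scal (rotation b t : C_AbsRing) (S t x)) x)).
lin_complex H.
Qed.
End Realification.

(** The Laplace transform of T at l, that is (l + A)^{-1} for Re l > 0. The factor e^{- i t Im l} is
    put into the semigroup, whose generator becomes - (A + i Im l), so everything known for real l
    applies. *)
Definition complex_resolvent {H : CompleteNormedModule C_AbsRing}
    (T : R -> H -> H) (l : C) : H -> H :=
  laplace (V := realify H) (rotated_semigroup (T := T) (Im l)) (Re l).

Section ComplexResolvent.
Context {H : CompleteNormedModule C_AbsRing} {T : R -> H -> H} {M : R}.
Hypothesis HTlin : forall t, 0 <= t -> is_linear (K := C_AbsRing) (T t).
Hypothesis HT : bounded_semigroup (V := realify H) T M.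

Let gen : H -> H -> Prop := neg_generator (V := realify H) T.
Let Rc := complex_resolvent T.

Lemma rotated_generator b x y :
  gen x y <-> neg_generator (V := realify H) (rotated_semigroup (T := T) b)
    x (plus y (scal ((Ci * RtoC b)%C : C_AbsRing) x)).
Proof.
split=> [|Hg]; first exact: rotated_generator_aux.
have := rotated_generator_aux _ (- b) _ _ Hg.
have -> : plus (plus y (scal ((Ci * RtoC b)%C : C_AbsRing) x))
   (scal ((Ci * RtoC (- b))%C : C_AbsRing) x) = y.
  by rewrite RtoC_opp; lin_complex H.
apply: filterlim_ext => t.
congr (scal _ (minus _ _)).
rewrite /rotated_semigroup.
change (scal (rotation (- b) t : C_AbsRing) (scal (rotation b t : C_AbsRing) (T t x)) = T t x).
rewrite scal_assoc.
have -> : mult (rotation (- b) t : C_AbsRing) (rotation b t : C_AbsRing) = one by exact: rotation_inv.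
exact: scal_one.
Qed.

Lemma complex_resolvent_iff l x y : 0 < Re l ->
  gen x y <-> x = Rc l (plus y (scal (l : C_AbsRing) x)).
Proof.
move=> Hl.
have Hb := rotated_bounded_semigroup HTlin HT (Im l).
have E : plus (plus y (scal ((Ci * RtoC (Im l))%C : C_AbsRing) x)) (scal (RtoC (Re l) : C_AbsRing) x)
   = plus y (scal (l : C_AbsRing) x).
  have El : l = (RtoC (Re l) + Ci * RtoC (Im l))%C.
    by case: l {Hl Hb} => a b; rewrite /Cplus /Cmult /Ci /RtoC /Re /Im /=; congr (_, _); ring.
  by rewrite {3}El; lin_complex H.
rewrite (rotated_generator (Im l)) (neg_generator_iff Hb (Re l) _ _ Hl).
by rewrite realify_scal /Rc /complex_resolvent -E.
Qed.

Lemma complex_resolvent_gen l u : 0 < Re l ->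
  gen (Rc l u) (minus u (scal (l : C_AbsRing) (Rc l u))).
Proof.
move=> Hl; apply/(complex_resolvent_iff l) => //.
by congr (Rc l _); lin_complex H.
Qed.

Lemma complex_resolvent_unique l x u : 0 < Re l ->
  gen x (minus u (scal (l : C_AbsRing) x)) -> x = Rc l u.
Proof.
move=> Hl /(complex_resolvent_iff l _ _ Hl).
by have -> : plus (minus u (scal (l : C_AbsRing) x)) (scal (l : C_AbsRing) x) = u by lin_complex H.
Qed.

Lemma complex_resolvent_norm l u : 0 < Re l -> norm (Rc l u) <= M / Re l * norm u.
Proof. move=> Hl; exact: (laplace_norm (rotated_bounded_semigroup HTlin HT (Im l)) (Re l) u Hl). Qed.

Lemma complex_resolvent_real l u : 0 < l -> laplace (V := realify H) T l u = Rc (RtoC l) u.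
Proof.
move=> Hl; apply: complex_resolvent_unique => //.
exact: (neg_generator_laplace HT l u Hl).
Qed.

Lemma neg_generator_scal c x y : gen x y -> gen (scal (c : C_AbsRing) x) (scal (c : C_AbsRing) y).
Proof.
rewrite /gen /neg_generator => Hg.
pose proof (filterlim_scal_r_fun (K := C_AbsRing) (V := H) (F := at_right 0) (c : C_AbsRing) _ _ Hg) as H1.
have E : scal (c : C_AbsRing) (opp y) = opp (scal (c : C_AbsRing) y) by lin_complex H.
have H2 : filterlim (fun t => scal (c : C_AbsRing) (scal (RtoC (/ t) : C_AbsRing) (minus (T t x) x))) (at_right 0)
    (locally (opp (scal (c : C_AbsRing) y) : H)) by rewrite -E; exact: H1.
apply: (filterlim_ext_loc (F := at_right 0) _ _ _ H2).
exists (mkposreal 1 Rlt_0_1) => t _ Ht; rewrite realify_scal.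
change (scal (c : C_AbsRing) (scal (RtoC (/ t) : C_AbsRing) (minus (T t x) x))
  = scal (RtoC (/ t) : C_AbsRing) (minus (T t (scal (c : C_AbsRing) x)) (scal (c : C_AbsRing) x))).
rewrite (linear_scal _ (HTlin t (Rlt_le _ _ Ht))); lin_complex H.
Qed.

Lemma neg_generator_plus x y x' y' : gen x y -> gen x' y' -> gen (plus x x') (plus y y').
Proof.
move=> Hg Hg'.
have H0 := neg_generator_scal (- (1))%C _ _ Hg'.
have := neg_generator_minus HT _ _ _ _ Hg H0.
congr (gen _ _);
  match goal with |- minus ?a ?b = ?c => change (@minus H a b = c) end; lin_complex H.
Qed.

Lemma complex_resolvent_linear l : 0 < Re l -> is_linear (K := C_AbsRing) (Rc l).
Proof.
move=> Hl; split.
- move=> x y; symmetry; apply: complex_resolvent_unique => //.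
  have := neg_generator_plus _ _ _ _ (complex_resolvent_gen l x Hl) (complex_resolvent_gen l y Hl).
  by congr (gen _ _); lin_complex H.
- move=> k x; symmetry; apply: complex_resolvent_unique => //.
  have := neg_generator_scal k _ _ (complex_resolvent_gen l x Hl).
  by congr (gen _ _); lin_complex H.
- exists (M / Re l); split; first by apply: Rdiv_lt_0_compat => //; apply: bs_pos _ _ HT.
  by move=> x; apply: complex_resolvent_norm.
Qed.

Lemma complex_resolvent_identity l m u : 0 < Re l -> 0 < Re m ->
  minus (Rc m u) (Rc l u) = scal ((l - m)%C : C_AbsRing) (Rc l (Rc m u)).
Proof.
move=> Hl Hm.
have H1 := proj1 (complex_resolvent_iff l _ _ Hl) (complex_resolvent_gen m u Hm).
have HL := complex_resolvent_linear l Hl.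
rewrite {1}H1 (linear_plus _ HL) (linear_minus _ HL) !(linear_scal _ HL); lin_complex H.
Qed.

Context {A : operator H}.
Hypothesis HA : neg_generates A T.

Lemma operator_neg_generator x y : A x y <-> gen x y.
Proof. exact: HA. Qed.

Lemma op_inv_shift_iff (l : C) x y : 0 < Re l -> op_inv (op_shift A l) x y <-> y = Rc l x.
Proof.
move=> Hl; rewrite /op_inv /op_shift operator_neg_generator.
split=> [|->]; [exact: complex_resolvent_unique|exact: complex_resolvent_gen].
Qed.

Lemma resolvent_eq (z : C) x : Re z < 0 -> resolvent A z x = opp (Rc (- z)%C x).
Proof.
move=> Hz.
have Hz' : 0 < Re (- z)%C by rewrite /Copp /Re /=; move: Hz; rewrite /Re; lra.
have Hiff y : op_inv (op_coshift A z) x y <-> y = opp (Rc (- z)%C x).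
  rewrite /op_inv /op_coshift operator_neg_generator.
  split=> [Hy|->].
  - have H1 : opp y = Rc (- z)%C x.
      apply: complex_resolvent_unique => //.
      have := neg_generator_scal (- (1))%C _ _ Hy.
      by congr (gen _ _); lin_complex H.
    by rewrite -H1 opp_opp.
  - have := neg_generator_scal (- (1))%C _ _ (complex_resolvent_gen (- z)%C x Hz').
    by congr (gen _ _); lin_complex H.
apply: iota_unique => [y|]; first by move=> /Hiff.
exact/Hiff.
Qed.

Lemma inv_one_plus_eq x : inv_one_plus A x = laplace (V := realify H) T 1 x.
Proof.
rewrite (complex_resolvent_real 1 x Rlt_0_1).
apply: iota_unique => [y|].
- by move=> /(op_inv_shift_iff 1%C x y); apply; rewrite /=; lra.
- by apply/(op_inv_shift_iff 1%C x) => //=; lra.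
Qed.

Lemma regularizer_eq x : regularizer A x = minus x (laplace (V := realify H) T 1 x).
Proof.
rewrite (complex_resolvent_real 1 x Rlt_0_1).
have Hp : 0 < Re 1%C by rewrite /=; lra.
have Hg := complex_resolvent_gen 1%C x Hp.
have E : scal (RtoC 1 : C_AbsRing) (Rc 1%C x) = Rc 1%C x by exact: scal_one.
rewrite E in Hg.
apply: iota_unique => [y|].
- move=> [w [/(op_inv_shift_iff 1%C x w Hp) -> /operator_neg_generator Hy]].
  exact: (neg_generator_unique _ _ _ Hy Hg).
- exists (Rc 1%C x); split; first exact/(op_inv_shift_iff 1%C x).
  exact/operator_neg_generator.
Qed.

Lemma cayley_eq x : cayley A x = shifted_cayley (V := realify H) T 0 x.
Proof.
rewrite /shifted_cayley /shifted_resolvent Rplus_0_r (complex_resolvent_real 1 x Rlt_0_1).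
have Hp : 0 < Re 1%C by rewrite /=; lra.
have Hg := complex_resolvent_gen 1%C x Hp.
have E : scal (RtoC 1 : C_AbsRing) (Rc 1%C x) = Rc 1%C x by exact: scal_one.
rewrite E in Hg.
change (cayley A x = minus x (scal (RtoC 2 : C_AbsRing) (Rc 1%C x))).
apply: iota_unique => [y|].
- move=> [w [/(op_inv_shift_iff 1%C x w Hp) -> /operator_neg_generator Hy]].
  have := neg_generator_unique _ _ _ Hy Hg => H1.
  have -> : y = plus (minus y (scal ((- (1))%C : C_AbsRing) (Rc 1%C x))) (scal ((- (1))%C : C_AbsRing) (Rc 1%C x)) by lin_complex H.
  rewrite H1; lin_complex H.
- exists (Rc 1%C x); split; first exact/(op_inv_shift_iff 1%C x).
  apply/operator_neg_generator; move: Hg; congr (gen _ _); lin_complex H.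
Qed.
End ComplexResolvent.

(** * Cauchy's theorem on a sector *)

(** The angle comes first in the two-variable functions, the order used for differentiation under
    the integral sign, although F takes the radius first. *)
Definition continuous_polar (F : R -> R -> C) (r t : R) : Prop :=
  continuity_2d_pt (fun t r => Re (F r t)) t r /\
  continuity_2d_pt (fun t r => Im (F r t)) t r.

(* F is a holomorphic function of z = r e^{i t}, and D is its r-derivative:
   the Cauchy-Riemann equation reads dF/dt = i r dF/dr. *)
Record polar_holomorphic (F D : R -> R -> C) (r t : R) : Prop := {
  ph_re_r : is_derive (fun r => Re (F r t)) r (Re (D r t));
  ph_im_r : is_derive (fun r => Im (F r t)) r (Im (D r t));
  ph_re_t : is_derive (fun t => Re (F r t)) t (- r * Im (D r t));
  ph_im_t : is_derive (fun t => Im (F r t)) t (r * Re (D r t));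
  ph_cont : continuous_polar F r t;
  ph_dcont : continuous_polar D r t
}.

Lemma continuous_polar_mult F G r t : continuous_polar F r t -> continuous_polar G r t ->
  continuous_polar (fun r t => (F r t * G r t)%C) r t.
Proof.
move=> [H1 H2] [H3 H4]; split.
- exact: continuity_2d_pt_minus _ _ _ _ (continuity_2d_pt_mult _ _ _ _ H1 H3)
    (continuity_2d_pt_mult _ _ _ _ H2 H4).
- exact: continuity_2d_pt_plus _ _ _ _ (continuity_2d_pt_mult _ _ _ _ H1 H4)
    (continuity_2d_pt_mult _ _ _ _ H2 H3).
Qed.

Lemma continuous_polar_plus F G r t : continuous_polar F r t -> continuous_polar G r t ->
  continuous_polar (fun r t => (F r t + G r t)%C) r t.
Proof. by move=> [H1 H2] [H3 H4]; split; apply: continuity_2d_pt_plus. Qed.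

Lemma continuous_polar_opp F r t : continuous_polar F r t ->
  continuous_polar (fun r t => (- F r t)%C) r t.
Proof. by move=> [H1 H2]; split; apply: continuity_2d_pt_opp. Qed.

Lemma continuous_polar_const c r t : continuous_polar (fun _ _ => c) r t.
Proof. by split; apply: continuity_2d_pt_const. Qed.

Lemma C_nonzero_sq (z : C) : z <> 0%C -> fst z ^ 2 + snd z ^ 2 <> 0.
Proof.
move=> Hz H; apply: Hz.
have H1 := pow2_ge_0 (fst z); have H2 := pow2_ge_0 (snd z).
case: z H H1 H2 => x y /= H H1 H2.
have -> : x = 0 by nra.
by have -> : y = 0 by nra.
Qed.

Lemma continuous_polar_inv (F : R -> R -> C) r t : continuous_polar F r t -> F r t <> 0%C ->
  continuous_polar (fun r t => (/ F r t)%C) r t.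
Proof.
move=> [H1 H2] Hz.
have Hn := C_nonzero_sq _ Hz.
have H3 : continuity_2d_pt (fun t r => fst (F r t) ^ 2 + snd (F r t) ^ 2) t r.
  apply: continuity_2d_pt_plus.
  - apply: continuity_2d_pt_mult => //; apply: continuity_2d_pt_mult => //; exact: continuity_2d_pt_const.
  - apply: continuity_2d_pt_mult => //; apply: continuity_2d_pt_mult => //; exact: continuity_2d_pt_const.
have H4 := continuity_2d_pt_inv _ _ _ H3 Hn.
by split; apply: continuity_2d_pt_mult => //; apply: continuity_2d_pt_opp.
Qed.

Lemma is_derive_eq (f : R -> R) x l l' : is_derive f x l -> l = l' -> is_derive f x l'.
Proof. by move=> H <-. Qed.

Lemma is_derive_mult_R (f g : R -> R) x f' g' : is_derive f x f' -> is_derive g x g' ->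
  is_derive (fun s => f s * g s) x (f' * g x + f x * g').
Proof. by move=> Hf Hg; exact: (is_derive_mult f g x f' g' Hf Hg Rmult_comm). Qed.

Lemma polar_holomorphic_const c r t : polar_holomorphic (fun _ _ => c) (fun _ _ => 0%C) r t.
Proof.
split; try exact: continuous_polar_const.
- exact: is_derive_const.
- exact: is_derive_const.
- by apply: is_derive_eq (is_derive_const _ _) _; rewrite /zero /=; ring.
- by apply: is_derive_eq (is_derive_const _ _) _; rewrite /zero /=; ring.
Qed.

Lemma polar_holomorphic_plus F DF G DG r t :
  polar_holomorphic F DF r t -> polar_holomorphic G DG r t ->
  polar_holomorphic (fun r t => (F r t + G r t)%C) (fun r t => (DF r t + DG r t)%C) r t.
Proof.
move=> [F1 F2 F3 F4 F5 F6] [G1 G2 G3 G4 G5 G6].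
split; try exact: continuous_polar_plus.
- exact: (is_derive_plus (V := R_NormedModule)) F1 G1.
- exact: (is_derive_plus (V := R_NormedModule)) F2 G2.
- apply: is_derive_eq (is_derive_plus (V := R_NormedModule) _ _ _ _ _ F3 G3) _.
  by rewrite /plus /Cplus /Re /Im /=; ring.
- apply: is_derive_eq (is_derive_plus (V := R_NormedModule) _ _ _ _ _ F4 G4) _.
  by rewrite /plus /Cplus /Re /Im /=; ring.
Qed.

Lemma polar_holomorphic_mult F DF G DG r t :
  polar_holomorphic F DF r t -> polar_holomorphic G DG r t ->
  polar_holomorphic (fun r t => (F r t * G r t)%C)
    (fun r t => (DF r t * G r t + F r t * DG r t)%C) r t.
Proof.
move=> [F1 F2 F3 F4 F5 F6] [G1 G2 G3 G4 G5 G6].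
split; last first.
- by apply: continuous_polar_plus; apply: continuous_polar_mult.
- exact: continuous_polar_mult.
- apply: is_derive_eq (is_derive_plus (V := R_NormedModule) _ _ _ _ _
    (is_derive_mult_R _ _ _ _ _ F3 G4) (is_derive_mult_R _ _ _ _ _ F4 G3)) _.
  by rewrite /plus /Cplus /Cmult /Re /Im /=; ring.
- apply: is_derive_eq (is_derive_minus (V := R_NormedModule) _ _ _ _ _
    (is_derive_mult_R _ _ _ _ _ F3 G3) (is_derive_mult_R _ _ _ _ _ F4 G4)) _.
  by rewrite /minus /plus /opp /Cplus /Cmult /Re /Im /=; ring.
- apply: is_derive_eq (is_derive_plus (V := R_NormedModule) _ _ _ _ _
    (is_derive_mult_R _ _ _ _ _ F1 G2) (is_derive_mult_R _ _ _ _ _ F2 G1)) _.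
  by rewrite /plus /Cplus /Cmult /Re /Im /=; ring.
- apply: is_derive_eq (is_derive_minus (V := R_NormedModule) _ _ _ _ _
    (is_derive_mult_R _ _ _ _ _ F1 G1) (is_derive_mult_R _ _ _ _ _ F2 G2)) _.
  by rewrite /minus /plus /opp /Cplus /Cmult /Re /Im /=; ring.
Qed.

Lemma is_derive_inv_parts (u v : R -> R) x u' v' : u x ^ 2 + v x ^ 2 <> 0 ->
  is_derive u x u' -> is_derive v x v' ->
  is_derive (fun s => u s / (u s ^ 2 + v s ^ 2)) x
    ((u' * (u x ^ 2 + v x ^ 2) - u x * (2 * u x * u' + 2 * v x * v')) / (u x ^ 2 + v x ^ 2) ^ 2).
Proof.
move=> Hn Hu Hv.
have H2 : is_derive (fun s => u s ^ 2 + v s ^ 2) x (2 * u x * u' + 2 * v x * v').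
  apply: is_derive_eq (is_derive_plus (V := R_NormedModule) _ _ _ _ _
    (is_derive_pow u 2 x u' Hu) (is_derive_pow v 2 x v' Hv)) _.
  by rewrite /plus /=; ring.
exact: (is_derive_div u _ x u' _ Hu H2 Hn).
Qed.

Lemma polar_holomorphic_inv (F DF : R -> R -> C) r t : F r t <> 0%C ->
  polar_holomorphic F DF r t ->
  polar_holomorphic (fun r t => (/ F r t)%C) (fun r t => (- (DF r t * (/ F r t * / F r t)))%C) r t.
Proof.
move=> Hz [F1 F2 F3 F4 F5 F6].
have Hn := C_nonzero_sq _ Hz.
have Hn' : snd (F r t) ^ 2 + fst (F r t) ^ 2 <> 0 by rewrite Rplus_comm.
have Hi := continuous_polar_inv _ _ _ F5 Hz.
have swap f x l : is_derive (fun s => Im (f s) / (Im (f s) ^ 2 + Re (f s) ^ 2)) x l ->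
    is_derive (fun s => Im (/ f s)%C) x (- l).
  move=> H.
  apply: (is_derive_ext (fun s => - (Im (f s) / (Im (f s) ^ 2 + Re (f s) ^ 2)))).
    move=> s; rewrite (Rplus_comm (Im (f s) ^ 2)).
    change (- (Im (f s) / (Re (f s) ^ 2 + Im (f s) ^ 2)) = - Im (f s) / (Re (f s) ^ 2 + Im (f s) ^ 2)).
    by rewrite /Rdiv; real_eq; ring.
  exact: (is_derive_opp (V := R_NormedModule)).
split.
- apply: is_derive_eq (is_derive_inv_parts _ _ _ _ _ Hn F1 F2) _.
  move: (F r t) (DF r t) Hn => [u v] [p q] /= Hn; rewrite /Cinv /Copp /Cmult /Re /Im /=.
  field; repeat split; move=> H0; apply: Hn; lra.
- apply: is_derive_eq (swap _ _ _ (is_derive_inv_parts _ _ _ _ _ Hn' F2 F1)) _.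
  move: (F r t) (DF r t) Hn => [u v] [p q] /= Hn; rewrite /Cinv /Copp /Cmult /Re /Im /=.
  field; repeat split; move=> H0; apply: Hn; lra.
- apply: is_derive_eq (is_derive_inv_parts _ _ _ _ _ Hn F3 F4) _.
  move: (F r t) (DF r t) Hn => [u v] [p q] /= Hn; rewrite /Cinv /Copp /Cmult /Re /Im /=.
  field; repeat split; move=> H0; apply: Hn; lra.
- apply: is_derive_eq (swap _ _ _ (is_derive_inv_parts _ _ _ _ _ Hn' F4 F3)) _.
  move: (F r t) (DF r t) Hn => [u v] [p q] /= Hn; rewrite /Cinv /Copp /Cmult /Re /Im /=.
  field; repeat split; move=> H0; apply: Hn; lra.
- exact: Hi.
- by apply: continuous_polar_opp; apply: continuous_polar_mult => //; apply: continuous_polar_mult.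
Qed.

Lemma continuous_polar_coord (f g : R -> R) (h : R -> R) r t : continuity_pt f r ->
  continuity_pt g t -> continuity_pt h t ->
  continuous_polar (fun r t => (f r * g t, f r * h t)) r t.
Proof.
move=> Hf Hg Hh.
have H1 : continuity_2d_pt (fun _ r => f r) t r.
  by apply: (continuity_1d_2d_pt_comp f (fun _ v => v)) => //; apply: continuity_2d_pt_id2.
have H2 : continuity_2d_pt (fun t _ => g t) t r.
  by apply: (continuity_1d_2d_pt_comp g (fun u _ => u)) => //; apply: continuity_2d_pt_id1.
have H3 : continuity_2d_pt (fun t _ => h t) t r.
  by apply: (continuity_1d_2d_pt_comp h (fun u _ => u)) => //; apply: continuity_2d_pt_id1.
by split; apply: continuity_2d_pt_mult.
Qed.

Lemma derivable_continuity_pt (f : R -> R) x l : is_derive f x l -> continuity_pt f x.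
Proof.
by move=> H; apply/continuity_pt_filterlim; exact: (is_derive_continuous (V := R_NormedModule) _ _ _ H).
Qed.

(** For f(r) e^{i p(t)} with p' = a the Cauchy-Riemann equation reduces to Euler's relation a f = r
    f', which powers satisfy. *)
Lemma polar_holomorphic_homogeneous (f f' p : R -> R) a r t :
  is_derive f r (f' r) -> continuity_pt f' r -> is_derive p t a -> a * f r = r * f' r ->
  polar_holomorphic (fun r t => polar (f r) (p t)) (fun r t => polar (f' r) (p t)) r t.
Proof.
move=> Hf Hf' Hp E.
have Hc : is_derive (fun t => cos (p t)) t (- (a * sin (p t))).
  apply: is_derive_eq (is_derive_comp cos p t _ _ (is_derive_cos (p t)) Hp) _.
  by rewrite /scal /= /mult /=; ring.
have Hs : is_derive (fun t => sin (p t)) t (a * cos (p t)).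
  exact: (is_derive_comp sin p t _ _ (is_derive_sin (p t)) Hp).
have Cf := derivable_continuity_pt _ _ _ Hf.
have Cc := derivable_continuity_pt _ _ _ Hc; have Cs := derivable_continuity_pt _ _ _ Hs.
split; [| | | |exact: continuous_polar_coord|exact: continuous_polar_coord].
- apply: is_derive_eq (is_derive_mult_R _ (fun _ => cos (p t)) _ _ 0 Hf (is_derive_const _ _)) _.
  by rewrite /polar /Re /=; ring.
- apply: is_derive_eq (is_derive_mult_R _ (fun _ => sin (p t)) _ _ 0 Hf (is_derive_const _ _)) _.
  by rewrite /polar /Im /=; ring.
- apply: is_derive_eq (is_derive_scal _ _ (f r) _ Hc) _.
  rewrite /polar /Im /= -Ropp_mult_distr_r -Rmult_assoc (Rmult_comm (f r)) E; ring.
- apply: is_derive_eq (is_derive_scal _ _ (f r) _ Hs) _.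
  rewrite /polar /Re /= -Rmult_assoc (Rmult_comm (f r)) E; ring.
Qed.

Lemma polar_holomorphic_power a r t : 0 < r ->
  polar_holomorphic (fun r t => polar (Rpower r a) (a * t))
    (fun r t => polar (a * Rpower r (a - 1)) (a * t)) r t.
Proof.
move=> Hr.
apply: (polar_holomorphic_homogeneous (fun r => Rpower r a) (fun r => a * Rpower r (a - 1)) _ a).
- exact: is_derive_Rpower.
- exact: derivable_continuity_pt _ _ _ (is_derive_scal _ _ a _ (is_derive_Rpower (a - 1) r Hr)).
- by auto_derive => //; ring.
- rewrite /Rminus Rpower_plus Rpower_Ropp Rpower_1 //; field; lra.
Qed.

Lemma polar_holomorphic_id r t : polar_holomorphic polar (fun _ t => polar 1 t) r t.
Proof.
apply: (polar_holomorphic_homogeneous (fun r => r) (fun _ => 1) (fun t => t) 1).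
- exact: is_derive_id.
- exact: derivable_continuity_pt _ _ _ (is_derive_const _ _).
- exact: is_derive_id.
- ring.
Qed.

(* Cauchy's theorem on the sector |arg z| <= th between the radii a and b, the
   arcs being estimated by eps. *)
Lemma cauchy_sector (F D : R -> R -> C) a b th eps :
  0 < a <= b -> 0 <= th < PI ->
  (forall r t, 0 < r -> - PI < t < PI -> polar_holomorphic F D r t) ->
  (forall t, - th <= t <= th -> Cmod (F a t) <= eps /\ Cmod (F b t) <= eps) ->
  Rabs (RInt (fun r => Re (F r th) / r) a b - RInt (fun r => Re (F r (- th)) / r) a b)
    <= 2 * th * (2 * eps).
Proof.
move=> Hab Hth HF Heps.
(* On a ray dz / z = dr / r, so F is z times the integrand of the contour integral. *)
pose f t r := Re (F r t) / r.
have Hft r t : 0 < r -> - PI < t < PI -> is_derive (fun t => f t r) t (- Im (D r t)).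
  move=> Hr Ht.
  have := is_derive_mult_R _ (fun _ => / r) _ _ 0 (ph_re_t _ _ _ _ (HF r t Hr Ht)) (is_derive_const _ _).
  move=> H; apply: is_derive_eq H _.
  by rewrite /=; field; lra.
have Hrange r : Rmin a b <= r <= Rmax a b -> 0 < r.
  by rewrite Rmin_left; [lra|lra].
have Hnear t : - PI < t < PI -> locally t (fun s => - PI < s < PI).
  move=> Ht; apply: filter_and.
  - exact: (open_gt (- PI) t (proj1 Ht)).
  - exact: (open_lt PI t (proj2 Ht)).
have Hfc t r : 0 < r -> - PI < t < PI -> continuous (f t) r.
  move=> Hr Ht; apply: (continuous_mult (fun r => Re (F r t)) (fun r => / r)).
  - exact: (is_derive_continuous (V := R_NormedModule) _ _ _ (ph_re_r _ _ _ _ (HF r t Hr Ht))).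
  - by apply: (ex_derive_continuous (fun r => / r)); auto_derive; lra.
have Hex t : - PI < t < PI -> ex_RInt (f t) a b.
  move=> Ht; apply: (ex_RInt_continuous (V := R_CompleteNormedModule)) => r Hr.
  by apply: Hfc => //; apply: Hrange.
(* The t-derivative of Re F / r is - Im D, which is an r-derivative: differentiation under the
   integral leaves only values on the two arcs. *)
have Hder t : - PI < t < PI ->
    is_derive (fun t => RInt (f t) a b) t (- (Im (F b t) - Im (F a t))).
  move=> Ht.
  have H := is_derive_RInt_param f a b t.
  have E : RInt (fun r => Derive (fun u => f u r) t) a b = - (Im (F b t) - Im (F a t)).
    rewrite (RInt_ext _ (fun r => - Im (D r t))); last first.
      move=> r Hr; apply: is_derive_unique; apply: Hft => //; apply: Hrange; lra.
    apply: is_RInt_unique.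
    have -> : - (Im (F b t) - Im (F a t)) = opp (minus (Im (F b t)) (Im (F a t))) by [].
    apply: (is_RInt_opp (V := R_NormedModule)).
    apply: (is_RInt_derive (fun r => Im (F r t)) (fun r => Im (D r t))) => r Hr.
    - exact: ph_im_r _ _ _ _ (HF r t (Hrange r Hr) Ht).
    - have Hc := proj2 (ph_dcont _ _ _ _ (HF r t (Hrange r Hr) Ht)).
      have Hc2 := proj1 (continuity_2d_pt_filterlim _ _ _) Hc.
      apply: (continuous_comp_2 (fun _ => t) (fun r => r) (fun t r => Im (D r t)) r).
      + exact: continuous_const.
      + exact: continuous_id.
      + exact: Hc2.
  rewrite -E; apply: H.
  - generalize (Hnear t Ht); apply filter_imp => s Hs r Hr.
    by eexists; apply: Hft => //; apply: Hrange.
  - move=> r Hr.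
    have Hc := continuity_2d_pt_opp _ _ _ (proj2 (ph_dcont _ _ _ _ (HF r t (Hrange r Hr) Ht))).
    apply: (continuity_2d_pt_ext_loc _ _ _ _ _ Hc).
    have Hr0 := Hrange r Hr.
    have [d Hd] := Hnear t Ht.
    have Hdr : 0 < Rmin d r by apply: Rmin_glb_lt => //; apply: cond_pos.
    exists (mkposreal _ Hdr) => u v /= Hu Hv.
    symmetry; apply: is_derive_unique; apply: Hft.
    + have := Rlt_le_trans _ _ _ Hv (Rmin_r d r).
      by move=> /Rabs_def2; lra.
    + apply: Hd; exact: (Rlt_le_trans _ _ _ Hu (Rmin_l d r)).
  - by generalize (Hnear t Ht); apply filter_imp => s Hs; apply: Hex.
case: (MVT_gen (fun t => RInt (f t) a b) (- th) th (fun t => - (Im (F b t) - Im (F a t)))).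
- by rewrite Rmin_left ?Rmax_right; try lra; move=> t Ht; apply: Hder; lra.
- rewrite Rmin_left ?Rmax_right; try lra; move=> t Ht.
  by apply: derivable_continuity_pt; apply: Hder; lra.
- rewrite Rmin_left ?Rmax_right; try lra; move=> t [Ht ->].
  have [H1 H2] := Heps t Ht.
  have H3 z : Rabs (Im z) <= Cmod z.
    by apply: Rle_trans (Rmax_r (Rabs (fst z)) _) (Rmax_Cmod z).
  have H4 := H3 (F a t); have H5 := H3 (F b t).
  rewrite Rabs_mult Rabs_Ropp (Rabs_pos_eq (th - - th)); last lra.
  have H6 := Rabs_triang (Im (F b t)) (- Im (F a t)).
  rewrite Rabs_Ropp in H6.
  have -> : 2 * th * (2 * eps) = 2 * eps * (th - - th) by ring.
  apply: Rmult_le_compat_r; first lra.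
  by apply: Rle_trans H6 _; lra.
Qed.

(** * Improper integrals over (0, +oo) *)

Notation zero_to_infinity := (filter_prod (at_right 0) (Rbar_locally p_infty)).

Lemma zero_to_infinity_intro (P : R -> R -> Prop) d e : 0 < d ->
  (forall a b, 0 < a < d -> e < b -> P a b) ->
  zero_to_infinity (fun ab => P (fst ab) (snd ab)).
Proof.
move=> Hd H.
apply: (Filter_prod _ _ _ (fun a => 0 < a < d) (fun b => e < b)).
- by apply: (at_right_intro _ d Hd).
- by exists e.
- by move=> a b /= Ha Hb; apply: H.
Qed.

(** Dominated convergence for a majorant g known through a bounded primitive G. As G is
    nondecreasing, its infimum and supremum take the place of its limits at 0 and at infinity in the
    Cauchy criterion. *)
Lemma dominated_RInt_gen {V : CompleteNormedModule R_AbsRing} (f : R -> V) (G g : R -> R) lo hi :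
  (forall r, 0 < r -> continuous f r) -> (forall r, 0 < r -> is_derive G r (g r)) ->
  (forall r, 0 < r -> continuous g r) -> (forall r, 0 < r -> norm (f r) <= g r) ->
  (forall r, 0 < r -> lo <= G r <= hi) ->
  exists l, is_RInt_gen f (at_right 0) (Rbar_locally p_infty) l /\ norm l <= hi - lo.
Proof.
move=> Hf HG Hg Hle Hb.
have Hex p q : 0 < p -> 0 < q -> ex_RInt f p q.
  move=> Hp Hq; apply: ex_RInt_continuous => z [Hz _]; apply: Hf.
  by apply: Rlt_le_trans Hz; apply: Rmin_glb_lt.
have Hd1 p q : 0 < p <= q -> norm (RInt f p q) <= G q - G p.
  move=> Hpq; apply: (norm_RInt_le f g p q) => //; first lra.
  - by move=> r Hr; apply: Hle; lra.
  - by apply: RInt_correct; apply: Hex; lra.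
  - apply: (is_RInt_derive G g) => r; rewrite Rmin_left; try lra; move=> [Hr _].
    + by apply: HG; lra.
    + by apply: Hg; lra.
have Hmono p q : 0 < p <= q -> G p <= G q.
  by move=> Hpq; have := Hd1 p q Hpq; have := norm_ge_0 (RInt f p q); lra.
have Hd p q : 0 < p -> 0 < q -> norm (RInt f p q) <= Rabs (G q - G p).
  move=> Hp Hq; case: (Rle_dec p q) => Hpq.
  - by apply: Rle_trans (Hd1 p q _) _; [lra|apply: Rle_abs].
  - rewrite -(opp_RInt_swap f q p); last by apply: Hex.
    rewrite norm_opp Rabs_minus_sym.
    by apply: Rle_trans (Hd1 q p _) _; [lra|apply: Rle_abs].
have [S [HS1 HS2]] : {S | is_lub (fun y => exists r, 0 < r /\ y = G r) S}.
  apply: completeness; last by exists (G 1), 1; split=> //; lra.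
  by exists hi => y [r [Hr ->]]; case: (Hb r Hr).
have [I [HI1 HI2]] : {I | is_lub (fun y => exists r, 0 < r /\ y = - G r) I}.
  apply: completeness; last by exists (- G 1), 1; split=> //; lra.
  by exists (- lo) => y [r [Hr ->]]; case: (Hb r Hr); lra.
have HSle r : 0 < r -> G r <= S by move=> Hr; apply: HS1; exists r.
have HIle r : 0 < r -> - I <= G r by move=> Hr; have := HI1 (- G r); move=> H; have := H (ex_intro _ r (conj Hr eq_refl)); lra.
have Hsup e : 0 < e -> exists r, 0 < r /\ S - e < G r.
  move=> He; apply: Classical_Prop.NNPP => Hn.
  have : S <= S - e; last lra.
  apply: HS2 => y [r [Hr ->]]; apply: Rnot_lt_le => H; apply: Hn; by exists r.
have Hinf e : 0 < e -> exists r, 0 < r /\ G r < - I + e.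
  move=> He; apply: Classical_Prop.NNPP => Hn.
  have : I <= I - e; last lra.
  apply: HI2 => y [r [Hr ->]]; apply: Rnot_lt_le => H; apply: Hn; exists r; split=> //; lra.
have Hproper : ProperFilter zero_to_infinity by apply: filter_prod_proper.
have [l Hl] : exists l, filterlim (fun ab => RInt f (fst ab) (snd ab)) zero_to_infinity (locally l).
  apply: (proj1 (filterlim_locally_cauchy (F := zero_to_infinity) (fun ab => RInt f (fst ab) (snd ab)))) => eps.
  have He : 0 < eps / 2 by have := cond_pos eps; lra.
  have [b0 [Hb0 Hb1]] := Hsup _ He.
  have [a0 [Ha0 Ha1]] := Hinf _ He.
  exists (fun ab => 0 < fst ab < a0 /\ b0 < snd ab); split.
    by apply: (zero_to_infinity_intro (fun a b => 0 < a < a0 /\ b0 < b) a0 b0).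
  move=> [a b] [a' b'] /= [Ha Hb2] [Ha' Hb2']; apply: norm_compat1.
  have -> : minus (RInt f a' b') (RInt f a b) = plus (RInt f a' a) (RInt f b b').
    rewrite -(RInt_Chasles f a' a b'); try (apply: Hex; lra).
    rewrite -(RInt_Chasles f a b b'); try (apply: Hex; lra).
    lin_real V.
  apply: Rle_lt_trans (norm_triangle _ _) _.
  have H1 := Hd a' a ltac:(lra) ltac:(lra).
  have H2 := Hd b b' ltac:(lra) ltac:(lra).
  have H3 : Rabs (G a - G a') < eps / 2.
    have K1 := HIle a ltac:(lra); have K2 := HIle a' ltac:(lra).
    have K3 := Hmono a a0 ltac:(lra); have K4 := Hmono a' a0 ltac:(lra).
    by apply: Rabs_def1; lra.
  have H4 : Rabs (G b' - G b) < eps / 2.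
    have K1 := HSle b ltac:(lra); have K2 := HSle b' ltac:(lra).
    have K3 := Hmono b0 b ltac:(lra); have K4 := Hmono b0 b' ltac:(lra).
    by apply: Rabs_def1; lra.
  lra.
exists l; split.
- move=> P HP; rewrite /filtermapi.
  have HP2 : zero_to_infinity (fun ab => P (RInt f (fst ab) (snd ab))) by exact: Hl.
  apply (filter_and_imp HP2
    (zero_to_infinity_intro (fun a b => 0 < a < 1 /\ 0 < b) 1 0 Rlt_0_1 (fun a b Ha Hb => conj Ha Hb))) => [[a b]] /= Hp [Ha Hb'].
  by exists (RInt f a b); split=> //; apply: RInt_correct; apply: Hex; lra.
- have Hn : filterlim (fun ab => norm (RInt f (fst ab) (snd ab))) zero_to_infinity (locally (norm l)).
    exact: (filterlim_comp _ _ _ _ norm _ _ _ Hl (filterlim_norm l)).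
  apply: (filterlim_le (F := zero_to_infinity)
    (fun ab => norm (RInt f (fst ab) (snd ab))) (fun _ => hi - lo) (norm l) (hi - lo)) => //.
    apply: (zero_to_infinity_intro (fun a b => norm (RInt f a b) <= hi - lo) 1 1 Rlt_0_1).
    move=> a b Ha Hb'; apply: Rle_trans (Hd1 a b _) _; first lra.
    have := Hb a ltac:(lra); have := Hb b ltac:(lra); lra.
  exact: filterlim_const.
Qed.

Lemma is_RInt_gen_linear {V W : NormedModule R_AbsRing} (B : V -> W) (f : R -> V) Fa Fb l :
  is_linear B -> is_RInt_gen f Fa Fb l -> Filter Fa -> Filter Fb ->
  is_RInt_gen (fun r => B (f r)) Fa Fb (B l).
Proof.
move=> HB Hf FFa FFb P HP.
have HP' : locally l (fun x => P (B x)) by exact: (linear_cont B l HB P HP).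
generalize (Hf _ HP'); rewrite /filtermapi; apply filter_imp => ab [y [Hy HPy]].
by exists (B y); split=> //; apply: is_RInt_linear.
Qed.

(** * Holomorphic functions on the slit plane and the geometry of the contour *)

Definition holomorphic_on_sector (F : R -> R -> C) : Prop := exists D,
  forall r t, 0 < r -> - PI < t < PI -> polar_holomorphic F D r t.

Lemma holomorphic_mult F G : holomorphic_on_sector F -> holomorphic_on_sector G ->
  holomorphic_on_sector (fun r t => (F r t * G r t)%C).
Proof.
move=> [DF HF] [DG HG]; exists (fun r t => (DF r t * G r t + F r t * DG r t)%C) => r t Hr Ht.
by apply: polar_holomorphic_mult; [apply: HF|apply: HG].
Qed.

Lemma holomorphic_const c : holomorphic_on_sector (fun _ _ => c).
Proof. by exists (fun _ _ => 0%C) => r t _ _; apply: polar_holomorphic_const. Qed.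

Lemma holomorphic_pow F n : holomorphic_on_sector F ->
  holomorphic_on_sector (fun r t => Cpow (F r t) n).
Proof.
move=> HF; elim: n => [|n IH]; first exact: holomorphic_const.
exact: holomorphic_mult HF IH.
Qed.

Lemma cos_gt_minus_one t : - PI < t < PI -> -1 < cos t.
Proof.
move=> Ht; rewrite -cos_PI.
case: (Rle_dec 0 t) => H.
- by apply: cos_decreasing_1; lra.
- by rewrite -(cos_neg t); apply: cos_decreasing_1; lra.
Qed.

Lemma polar_plus_nonzero c r t : 0 < c -> 0 < r -> - PI < t < PI -> (RtoC c + polar r t <> 0)%C.
Proof.
move=> Hc Hr Ht [H1 H2].
have H3 := cos_gt_minus_one t Ht.
have H4 := sin2_cos2 t; rewrite /Rsqr in H4.
have Hs : sin t = 0 by nra.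
have Hcos : cos t * cos t = 1 by rewrite Hs in H4; lra.
have : cos t = 1 by nra.
move=> E; rewrite E in H1; lra.
Qed.

Lemma holomorphic_fraction c : 0 < c ->
  holomorphic_on_sector (fun r t => (polar r t / (RtoC c + polar r t))%C).
Proof.
move=> Hc; apply: holomorphic_mult.
  by exists (fun _ t => polar 1 t) => r t _ _; apply: polar_holomorphic_id.
exists (fun r t => (- ((0 + polar 1 t) * (/ (RtoC c + polar r t) * / (RtoC c + polar r t))))%C) => r t Hr Ht.
apply: (polar_holomorphic_inv (fun r t => (RtoC c + polar r t)%C) (fun _ t => (0 + polar 1 t)%C)).
  exact: polar_plus_nonzero.
apply: polar_holomorphic_plus; [exact: polar_holomorphic_const|exact: polar_holomorphic_id].
Qed.

Lemma holomorphic_power a : holomorphic_on_sector (fun r t => polar (Rpower r a) (a * t)).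
Proof. by eexists => r t Hr _; apply: polar_holomorphic_power. Qed.

Lemma Cmod_polar r t : 0 <= r -> Cmod (polar r t) = r.
Proof.
move=> Hr; rewrite /Cmod /polar /=.
apply: eq_trans (sqrt_pow2 r Hr); congr sqrt.
have := sin2_cos2 t; rewrite /Rsqr => E.
have -> : r ^ 2 = r * r * (sin t * sin t + cos t * cos t) by rewrite E; ring.
ring.
Qed.

Lemma contour_angle_range : PI / 2 < contour_angle < PI.
Proof. have := PI_RGT_0; rewrite /contour_angle; lra. Qed.

(** -7/9 is the least cosine for which |c + r e^{i t}| >= (c + r) / 3 holds for all c, r >= 0; the
    upper bound -1/2 yields Re (-z) >= r / 2 on the rays. *)
Lemma cos_contour_angle : -7/9 <= cos contour_angle <= -1/2.
Proof.
have -> : contour_angle = 3 * (PI / 4) by rewrite /contour_angle; field.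
rewrite cos_3PI4.
have H2 := sqrt_sqrt 2 ltac:(lra).
have H0 := sqrt_lt_R0 2 ltac:(lra).
have E : (-1 / sqrt 2) * sqrt 2 = -1 by field; lra.
by split; apply: (Rmult_le_reg_r (sqrt 2)) => //; rewrite E; nra.
Qed.

Lemma cos_sector t : - contour_angle <= t <= contour_angle -> -7/9 <= cos t.
Proof.
move=> Ht; have [H1 _] := cos_contour_angle; have H2 := contour_angle_range.
have Hmain s : 0 <= s <= contour_angle -> -7/9 <= cos s.
  by move=> Hs; apply: Rle_trans H1 _; apply: cos_decr_1; lra.
case: (Rle_dec 0 t) => H; first by apply: Hmain; lra.
by rewrite -(cos_neg t); apply: Hmain; lra.
Qed.

Lemma Cmod_sector_lower c r t : 0 <= c -> 0 <= r -> - contour_angle <= t <= contour_angle ->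
  (c + r) / 3 <= Cmod (RtoC c + polar r t)%C.
Proof.
move=> Hc Hr Ht; have Hcos := cos_sector t Ht.
have H0 : 0 <= (c + r) / 3 by lra.
rewrite -(sqrt_pow2 _ H0) /Cmod; apply: sqrt_le_1_alt.
have := sin2_cos2 t; rewrite /Rsqr /polar /= => E.
have -> : (c + r * cos t) * ((c + r * cos t) * 1) + (0 + r * sin t) * ((0 + r * sin t) * 1)
  = c * c + 2 * (c * r) * cos t + r * r * (sin t * sin t + cos t * cos t) by ring.
rewrite E.
have : 0 <= c * r by apply: Rmult_le_pos.
have := pow2_ge_0 (c - r).
nra.
Qed.

Lemma Cmod_fraction_le c r t : 0 < c -> 0 < r -> - contour_angle <= t <= contour_angle ->
  Cmod (polar r t / (RtoC c + polar r t))%C <= 3 * (r / (c + r)).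
Proof.
move=> Hc Hr Ht.
have H1 := Cmod_sector_lower c r t ltac:(lra) ltac:(lra) Ht.
have Hne : (RtoC c + polar r t <> 0)%C.
  by move=> H; rewrite H Cmod_0 in H1; lra.
rewrite /Cdiv Cmod_mult Cmod_inv // Cmod_polar; last lra.
have -> : 3 * (r / (c + r)) = r * / ((c + r) / 3) by field; lra.
apply: Rmult_le_compat_l; first lra.
by apply: Rinv_le_contravar; lra.
Qed.

(** Half-angle formulas: r + Re z = 2 r cos^2(t/2) and Im z = 2 r sin(t/2) cos(t/2), so the quotient
    in [Arg] is tan(t/2) with |t/2| < PI/2. *)
Lemma Arg_polar r t : 0 < r -> - PI < t < PI -> Arg (polar r t) = t.
Proof.
move=> Hr Ht; rewrite /Arg Cmod_polar; last lra.
have Hc : cos (t / 2) <> 0.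
  have : 0 < cos (t / 2) by apply: cos_gt_0; lra.
  lra.
have E1 : cos t = 2 * cos (t / 2) * cos (t / 2) - 1.
  by rewrite -cos_2a_cos; congr cos; field.
have E2 : sin t = 2 * sin (t / 2) * cos (t / 2).
  by rewrite -sin_2a; congr sin; field.
have -> : Im (polar r t) / (r + Re (polar r t)) = tan (t / 2).
  rewrite /polar /Im /Re /= E1 E2 /tan; field; split=> //.
  have -> : r + r * (2 * cos (t / 2) * cos (t / 2) - 1) = 2 * r * (cos (t / 2) * cos (t / 2)) by ring.
  apply: Rmult_integral_contrapositive_currified; first lra.
  exact: Rmult_integral_contrapositive_currified.
rewrite atan_tan; lra.
Qed.

Lemma Cpower_polar r t a : 0 < r -> - PI < t < PI ->
  Cpower (polar r t) a = polar (Rpower r a) (a * t).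
Proof. by move=> Hr Ht; rewrite /Cpower Arg_polar // Cmod_polar //; lra. Qed.

(** * Scalar kernels and their majorants *)

Section ScalarKernels.
Context (alpha N : R) (m : nat).
Hypothesis Halpha : 0 < alpha.
Hypothesis HN : 0 < N.
Hypothesis Hm : alpha < INR m <= alpha + 1.

Definition fraction_on_ray (c r t : R) : C := (polar r t / (RtoC c + polar r t))%C.

(* The values on the ray arg z = t of (z / (1 + z))^m z^(-alpha) (z / (N + z))^i. *)
Definition kernel (i : nat) (r t : R) : C :=
  (Cpow (fraction_on_ray 1 r t) m * polar (Rpower r (- alpha)) (- alpha * t)
   * Cpow (fraction_on_ray N r t) i)%C.

Lemma kernel_holomorphic i : holomorphic_on_sector (kernel i).
Proof.
apply: holomorphic_mult; [apply: holomorphic_mult|].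
- by apply: holomorphic_pow; apply: holomorphic_fraction; lra.
- exact: holomorphic_power.
- by apply: holomorphic_pow; apply: holomorphic_fraction.
Qed.

Lemma kernel_S i r t : kernel (S i) r t = (kernel i r t * fraction_on_ray N r t)%C.
Proof. by rewrite /kernel Cpow_S; ring. Qed.

Lemma kernel_continuous i r t : 0 < r -> - PI < t < PI ->
  continuous (fun r => (kernel i r t * polar 1 t)%C : C_AbsRing) r.
Proof.
move=> Hr Ht.
have [D HD] := holomorphic_mult _ _ (kernel_holomorphic i) (holomorphic_const (polar 1 t)).
have Hh := HD r t Hr Ht.
unfold continuous; apply (filterlim_C (locally r)).
- exact: (is_derive_continuous (V := R_NormedModule) _ _ _ (ph_re_r _ _ _ _ Hh)).
- exact: (is_derive_continuous (V := R_NormedModule) _ _ _ (ph_im_r _ _ _ _ Hh)).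
Qed.

Lemma kernel_norm i r t : 0 < r -> - contour_angle <= t <= contour_angle ->
  Cmod (kernel i r t) <= 3 ^ (m + i) * (Rpower r (- alpha) * (r / (1 + r)) ^ m * (r / (N + r)) ^ i).
Proof.
move=> Hr Ht.
rewrite /kernel !Cmod_mult !Cmod_pow (Cmod_polar (Rpower _ _)); last pos.
have H1 := Cmod_fraction_le 1 r t Rlt_0_1 Hr Ht.
have H2 := Cmod_fraction_le N r t HN Hr Ht.
have H3 : Cmod (fraction_on_ray 1 r t) ^ m <= 3 ^ m * (r / (1 + r)) ^ m.
  by rewrite -Rpow_mult_distr; apply: pow_incr; split=> //; apply: Cmod_ge_0.
have H4 : Cmod (fraction_on_ray N r t) ^ i <= 3 ^ i * (r / (N + r)) ^ i.
  by rewrite -Rpow_mult_distr; apply: pow_incr; split=> //; apply: Cmod_ge_0.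
have H5 : 0 < Rpower r (- alpha) by pos.
have -> : 3 ^ (m + i) * (Rpower r (- alpha) * (r / (1 + r)) ^ m * (r / (N + r)) ^ i)
  = 3 ^ m * (r / (1 + r)) ^ m * Rpower r (- alpha) * (3 ^ i * (r / (N + r)) ^ i).
  by rewrite pow_add; ring.
apply: Rmult_le_compat => //.
- pos.
- pos.
- by apply: Rmult_le_compat_r; lra.
Qed.

Lemma pow_unit_interval x n : 0 <= x <= 1 -> 0 <= x ^ n <= 1.
Proof.
move=> Hx; split; first pos.
by have := pow_incr x 1 n Hx; rewrite pow1.
Qed.

Lemma ratio_bounds c r : 0 < c -> 0 < r -> 0 < r / (c + r) <= 1.
Proof.
move=> Hc Hr; split; first pos.
apply: (Rmult_le_reg_r (c + r)); first lra.
have -> : r / (c + r) * (c + r) = r by field; lra.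
lra.
Qed.

(** The first bound tends to 0 at 0 since m > alpha, the second at infinity since alpha > 0; this is
    what makes the arcs in Cauchy's theorem negligible. *)
Lemma kernel_norm_weak i r t : 0 < r -> - contour_angle <= t <= contour_angle ->
  Cmod (kernel i r t) <= 3 ^ (m + i) * Rpower r (INR m - alpha) /\
  Cmod (kernel i r t) <= 3 ^ (m + i) * Rpower r (- alpha).
Proof.
move=> Hr Ht.
have H := kernel_norm i r t Hr Ht.
have H3 : 0 < 3 ^ (m + i) by pos.
have H5 : 0 < Rpower r (- alpha) by pos.
have [B1 B2] := ratio_bounds 1 r Rlt_0_1 Hr.
have [B3 B4] := ratio_bounds N r HN Hr.
have P1 : 0 <= (r / (N + r)) ^ i <= 1 by apply: pow_unit_interval; lra.
have P2 : 0 <= (r / (1 + r)) ^ m <= 1 by apply: pow_unit_interval; lra.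
have P3 : (r / (1 + r)) ^ m <= r ^ m.
  apply: pow_incr; split; first lra.
  apply: (Rmult_le_reg_r (1 + r)); first lra.
  have -> : r / (1 + r) * (1 + r) = r by field; lra.
  nra.
split; apply: Rle_trans H _; apply: Rmult_le_compat_l; try lra.
- have -> : Rpower r (INR m - alpha) = Rpower r (- alpha) * r ^ m * 1.
    by rewrite -Rpower_pow // -Rpower_plus Rmult_1_r; congr Rpower; ring.
  apply: Rmult_le_compat; try lra.
  + pos.
  + by apply: Rmult_le_compat_l; lra.
- have : Rpower r (- alpha) * (r / (1 + r)) ^ m * (r / (N + r)) ^ i <= Rpower r (- alpha) * 1 * 1.
    apply: Rmult_le_compat; try lra.
    + pos.
    + by apply: Rmult_le_compat_l; lra.
  lra.
Qed.

Lemma kernel_small i eps : 0 < eps -> exists d e, 0 < d /\ 0 < e /\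
  forall r t, 0 < r -> r < d \/ e < r -> - contour_angle <= t <= contour_angle ->
  Cmod (kernel i r t) <= eps.
Proof.
move=> He.
have H3 : 0 < 3 ^ (m + i) by pos.
set c := eps / 3 ^ (m + i).
have Hc : 0 < c by pos.
have Hc3 : 3 ^ (m + i) * c = eps by rewrite /c; field; lra.
(* The radii at which r^(m - alpha) and r^(-alpha) equal eps / 3^(m + i). *)
exists (Rpower c (/ (INR m - alpha))), (Rpower c (- / alpha)).
split; [exact: exp_pos|split; first exact: exp_pos].
move=> r t Hr Hcase Ht.
have [K1 K2] := kernel_norm_weak i r t Hr Ht.
rewrite -Hc3; case: Hcase => Hr2.
- apply: Rle_trans K1 _; apply: Rmult_le_compat_l; first lra.
  have -> : c = Rpower (Rpower c (/ (INR m - alpha))) (INR m - alpha).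
    by rewrite Rpower_mult Rinv_l ?Rpower_1 //; lra.
  apply: Rle_Rpower_l; lra.
- apply: Rle_trans K2 _; apply: Rmult_le_compat_l; first lra.
  have -> : c = Rpower (Rpower c (- / alpha)) (- alpha).
    have E : - / alpha * - alpha = 1 by field; lra.
    by rewrite Rpower_mult E Rpower_1.
  apply: Rpower_neg_le; try lra; exact: exp_pos.
Qed.

(** With c = m - alpha in (0, 1], the kernel divided by r is of size r^(c - 1) (1 + r)^(-m). The
    majorant is chosen for its primitive (r / (1 + r))^c / c - (1 + r)^(-alpha) / alpha: its first
    term serves r <= 1, where (1 + r)^(-c - 1) >= 1/4, and its second r > 1, where r^(c - 1) <= 2 (1
    + r)^(c - 1). *)
Lemma kernel_dominated i r t : 0 < r -> - contour_angle <= t <= contour_angle ->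
  Cmod (kernel i r t) / r <= 3 ^ (m + i) * (4 * (Rpower r (INR m - alpha - 1) * Rpower (1 + r) (- (INR m - alpha) - 1)
     + Rpower (1 + r) (- alpha - 1))).
Proof.
move=> Hr Ht.
have H := kernel_norm i r t Hr Ht.
have H3 : 0 < 3 ^ (m + i) by pos.
have [B3 B4] := ratio_bounds N r HN Hr.
have P1 : 0 <= (r / (N + r)) ^ i <= 1 by apply: pow_unit_interval; lra.
set c := INR m - alpha.
have Hc : 0 < c <= 1 by rewrite /c; lra.
have E : Rpower r (- alpha) * (r / (1 + r)) ^ m / r = Rpower r (c - 1) * Rpower (1 + r) (- INR m).
  rewrite -Rpower_pow; last pos.
  rewrite Rpower_div_base; try lra.
  have -> : forall z, z / r = z * Rpower r (- (1)).
    by move=> z; rewrite Rpower_Ropp Rpower_1.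
  have -> : c - 1 = - alpha + INR m + - (1) by rewrite /c; ring.
  rewrite !Rpower_plus; ring.
have Hq : 0 < Rpower r (- alpha) * (r / (1 + r)) ^ m by pos.
have H6 : Cmod (kernel i r t) / r <= 3 ^ (m + i) * (Rpower r (c - 1) * Rpower (1 + r) (- INR m)).
  rewrite -E.
  apply: Rle_trans (_ : 3 ^ (m + i) * (Rpower r (- alpha) * (r / (1 + r)) ^ m * 1) / r <= _); last first.
    by right; field; lra.
  apply: Rmult_le_compat_r; first pos.
  apply: Rle_trans H _; apply: Rmult_le_compat_l; first lra.
  by apply: Rmult_le_compat_l; lra.
apply: Rle_trans H6 _; apply: Rmult_le_compat_l; first lra.
have Q1 : 0 < Rpower r (c - 1) by pos.
have Q2 : 0 < Rpower (1 + r) (- INR m) by pos.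
have Q3 : 0 < Rpower (1 + r) (- c - 1) by pos.
have Q4 : 0 < Rpower (1 + r) (- alpha - 1) by pos.
case: (Rle_dec r 1) => Hr1.
- have L1 : Rpower (1 + r) (- INR m) <= 1.
    apply: Rle_trans (_ : Rpower (1 + r) 0 <= 1); last by rewrite Rpower_O; lra.
    apply: Rle_Rpower; first lra.
    have := pos_INR m; lra.
  have L2 : / 4 <= Rpower (1 + r) (- c - 1).
    apply: Rle_trans (_ : Rpower 2 (- INR 2) <= _).
      by rewrite Rpower_Ropp Rpower_pow; lra.
    apply: Rle_trans (_ : Rpower 2 (- (c + 1)) <= _).
      by apply: Rle_Rpower; rewrite /=; lra.
    have -> : - c - 1 = - (c + 1) by ring.
    apply: Rpower_neg_le; lra.
  have : Rpower r (c - 1) * Rpower (1 + r) (- INR m) <= Rpower r (c - 1) * (4 * Rpower (1 + r) (- c - 1)).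
    by apply: Rmult_le_compat_l; lra.
  lra.
- have L1 : Rpower r (c - 1) <= 2 * Rpower (1 + r) (c - 1).
    apply: Rle_trans (_ : Rpower ((1 + r) / 2) (c - 1) <= _).
      have -> : c - 1 = - (1 - c) by ring.
      apply: Rpower_neg_le; lra.
    rewrite Rpower_div_base; try lra.
    rewrite Rmult_comm; apply: Rmult_le_compat_r; first pos.
    rewrite -{2}(Rpower_1 2); last lra.
    apply: Rle_Rpower; lra.
  have E2 : Rpower (1 + r) (c - 1) * Rpower (1 + r) (- INR m) = Rpower (1 + r) (- alpha - 1).
    by rewrite -Rpower_plus /c; congr Rpower; ring.
  have : Rpower r (c - 1) * Rpower (1 + r) (- INR m) <= 2 * Rpower (1 + r) (c - 1) * Rpower (1 + r) (- INR m).
    by apply: Rmult_le_compat_r; lra.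
  rewrite Rmult_assoc E2.
  have : 0 < Rpower r (c - 1) * Rpower (1 + r) (- c - 1) by apply: Rmult_lt_0_compat.
  lra.
Qed.

(** For i >= alpha + 1 the singular power of r is compensated: r^(i - alpha - 1) (N + r)^(-i) <= (N
    + r)^(-alpha - 1). *)
Lemma kernel_dominated_far i r t : alpha + 1 <= INR i -> 0 < r ->
  - contour_angle <= t <= contour_angle ->
  Cmod (kernel i r t) / r <= 3 ^ (m + i) * Rpower (N + r) (- alpha - 1).
Proof.
move=> Hi Hr Ht.
have H := kernel_norm i r t Hr Ht.
have H3 : 0 < 3 ^ (m + i) by pos.
have [B1 B2] := ratio_bounds 1 r Rlt_0_1 Hr.
have P2 : 0 <= (r / (1 + r)) ^ m <= 1 by apply: pow_unit_interval; lra.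
have Hpi : 0 < (r / (N + r)) ^ i by pos.
have Hpa : 0 < Rpower r (- alpha) by pos.
have E : Rpower r (- alpha) * 1 * (r / (N + r)) ^ i / r
   = Rpower r (INR i - alpha - 1) * Rpower (N + r) (- INR i).
  rewrite -Rpower_pow; last pos.
  rewrite Rpower_div_base; try lra.
  have -> : forall z, z / r = z * Rpower r (- (1)).
    by move=> z; rewrite Rpower_Ropp Rpower_1.
  have -> : INR i - alpha - 1 = - alpha + INR i + - (1) by ring.
  rewrite !Rpower_plus; ring.
apply: Rle_trans (_ : 3 ^ (m + i) * (Rpower r (- alpha) * 1 * (r / (N + r)) ^ i / r) <= _).
  have -> : 3 ^ (m + i) * (Rpower r (- alpha) * 1 * (r / (N + r)) ^ i / r)
    = 3 ^ (m + i) * (Rpower r (- alpha) * 1 * (r / (N + r)) ^ i) / r by field; lra.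
  apply: Rmult_le_compat_r; first pos.
  apply: Rle_trans H _; apply: Rmult_le_compat_l; first lra.
  apply: Rmult_le_compat_r; first lra.
  by apply: Rmult_le_compat_l; lra.
apply: Rmult_le_compat_l; first lra.
rewrite E.
have -> : Rpower (N + r) (- alpha - 1) = Rpower (N + r) (INR i - alpha - 1) * Rpower (N + r) (- INR i).
  by rewrite -Rpower_plus; congr Rpower; ring.
apply: Rmult_le_compat_r; first pos.
apply: Rle_Rpower_l; lra.
Qed.

Lemma dominating_derive r : 0 < r -> is_derive
  (fun r => / (INR m - alpha) * (Rpower r (INR m - alpha) * Rpower (1 + r) (- (INR m - alpha)))
     - / alpha * Rpower (1 + r) (- alpha)) r
  (Rpower r (INR m - alpha - 1) * Rpower (1 + r) (- (INR m - alpha) - 1) + Rpower (1 + r) (- alpha - 1)).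
Proof.
move=> Hr; set c := INR m - alpha.
have Hc : 0 < c by rewrite /c; lra.
have Hr1 : 0 < 1 + r by lra.
have Hp a b : 0 < b -> Rpower b (a - 1) = Rpower b a * / b.
  by move=> Hb; rewrite /Rminus Rpower_plus Rpower_Ropp Rpower_1.
rewrite !Hp // /Rpower.
auto_derive; first by repeat split.
field; repeat split; lra.
Qed.
End ScalarKernels.

(** * The contour integral of the fractional power *)

Section Contour.
Context {H : CompleteNormedModule C_AbsRing} {inner : H -> H -> C}.
Hypothesis Hinner : is_inner_product inner.
Context {T : R -> H -> H} {M : R}.
Hypothesis HTlin : forall t, 0 <= t -> is_linear (K := C_AbsRing) (T t).
Hypothesis HT : bounded_semigroup (V := realify H) T M.
Let Mpos : 0 < M := bs_pos _ _ HT.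
Let Rc := complex_resolvent T.
Local Notation improper_integral f l :=
  (is_RInt_gen (V := realify H) f (at_right 0) (Rbar_locally p_infty) l).

Definition real_inner (x y : H) : R := Re (inner x y).

Lemma real_inner_spec : real_inner_product (V := realify H) real_inner.
Proof.
split.
- by move=> x y z; rewrite /real_inner (inner_plus_l _ Hinner).
- move=> r x z; rewrite /real_inner realify_scal (inner_scal_l _ Hinner).
  by rewrite /Cmult /RtoC /Re /=; ring.
- by move=> x y; rewrite /real_inner (inner_conj _ Hinner x y).
- by move=> x; rewrite /real_inner (inner_norm _ Hinner).
Qed.

Context (alpha N : R) (m : nat).
Hypothesis Halpha : 0 < alpha.
Hypothesis HN : 0 < N.
Hypothesis Hm : alpha < INR m <= alpha + 1.

(** Here (z - A)^{-1} is written as - (- z + A)^{-1}, a Laplace transform because Re z < 0 on the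
    rays; [polar 1 t] is dz / dr. *)
Definition ray_term (i : nat) (t : R) (x : H) (r : R) : H :=
  scal ((kernel alpha N m i r t * polar 1 t)%C : C_AbsRing) (opp (Rc (- polar r t)%C x)).

Definition is_ray (t : R) : Prop := t = contour_angle \/ t = - contour_angle.

Lemma is_ray_range t : is_ray t -> - contour_angle <= t <= contour_angle /\ - PI < t < PI.
Proof. by have := contour_angle_range; have := PI_RGT_0; move=> H1 H2 [->|->]; lra. Qed.

Lemma ray_re r t : is_ray t -> 0 < r -> r / 2 <= Re (- polar r t)%C.
Proof.
have [_ Hc] := cos_contour_angle.
move=> Ht Hr.
have Hct : cos t <= -1/2 by case: Ht => ->; rewrite ?cos_neg.
by rewrite /polar /Copp /Re /=; nra.
Qed.

Lemma ray_resolvent_norm r t x : is_ray t -> 0 < r ->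
  norm (Rc (- polar r t)%C x) <= 2 * M / r * norm x.
Proof.
move=> Ht Hr; have H1 := ray_re r t Ht Hr.
apply: Rle_trans (complex_resolvent_norm HTlin HT _ x _) _; first lra.
apply: Rmult_le_compat_r; first pos.
have -> : 2 * M / r = M / (r / 2) by field; lra.
apply: Rmult_le_compat_l; first lra.
by apply: Rinv_le_contravar; lra.
Qed.

Lemma ray_resolvent_continuous r t x : is_ray t -> 0 < r ->
  continuous (fun r => Rc (- polar r t)%C x : realify H) r.
Proof.
move=> Ht Hr.
set c := 2 * M / r * (2 * M / (r / 2) * norm x).
have Hc : 0 <= c by pos.
apply/filterlim_norm_eps => eps Heps.
have Hd : 0 < Rmin (r / 2) (eps / (c + 1)).
  by apply: Rmin_glb_lt; [lra|apply: Rdiv_lt_0_compat; lra].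
exists (mkposreal _ Hd) => s Hs.
have Hs0 : Rabs (s - r) < Rmin (r / 2) (eps / (c + 1)) by exact: Hs.
have Hs1 := Rlt_le_trans _ _ _ Hs0 (Rmin_l _ _).
have Hs2 := Rlt_le_trans _ _ _ Hs0 (Rmin_r _ _).
have [Hs3 Hs4] := Rabs_def2 _ _ Hs1.
have Hspos : 0 < s by lra.
have E := complex_resolvent_identity HTlin HT (- polar r t)%C (- polar s t)%C x
  ltac:(have := ray_re r t Ht Hr; lra) ltac:(have := ray_re s t Ht Hspos; lra).
change (norm (minus (Rc (- polar s t)%C x) (Rc (- polar r t)%C x)) < eps).
rewrite E norm_scal_C.
have -> : Cmod (- polar r t - - polar s t)%C = Rabs (s - r).
  have -> : (- polar r t - - polar s t)%C = (RtoC (s - r) * polar 1 t)%C.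
    by rewrite /polar /Cminus /Cplus /Copp /Cmult /RtoC /=; congr (_, _); ring.
  by rewrite Cmod_mult Cmod_R Cmod_polar; lra.
have H1 := ray_resolvent_norm r t (Rc (- polar s t)%C x) Ht Hr.
have H2 := ray_resolvent_norm s t x Ht Hspos.
have H3 : norm (Rc (- polar r t)%C (Rc (- polar s t)%C x)) <= c.
  apply: Rle_trans H1 _; apply: Rmult_le_compat_l.
    pos.
  apply: Rle_trans H2 _; apply: Rmult_le_compat_r; first pos.
  apply: Rmult_le_compat_l; first lra.
  by apply: Rinv_le_contravar; lra.
have H4 := Rabs_pos (s - r).
have H5 : Rabs (s - r) * c <= eps / (c + 1) * c by apply: Rmult_le_compat_r; lra.
have H6 : eps / (c + 1) * c < eps.
  have E2 : eps = eps / (c + 1) * (c + 1) by field; lra.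
  have : 0 < eps / (c + 1) by apply: Rdiv_lt_0_compat; lra.
  lra.
apply: Rle_lt_trans (Rmult_le_compat_l _ _ _ H4 H3) _; lra.
Qed.

Lemma ray_term_continuous i t x r : is_ray t -> 0 < r ->
  continuous (ray_term i t x : R -> realify H) r.
Proof.
move=> Ht Hr.
exact: (continuous_scal (K := C_AbsRing) (V := H) (fun r => (kernel alpha N m i r t * polar 1 t)%C : C_AbsRing)
  (fun r => opp (Rc (- polar r t)%C x)) r
  (kernel_continuous alpha N m HN i r t Hr (proj2 (is_ray_range t Ht)))
  (continuous_opp (K := C_AbsRing) (V := H) _ r (ray_resolvent_continuous r t x Ht Hr))).
Qed.

Lemma ray_term_norm i t x r : is_ray t -> 0 < r ->
  norm (ray_term i t x r) <= 2 * M * norm x * (Cmod (kernel alpha N m i r t) / r).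
Proof.
move=> Ht Hr; rewrite /ray_term norm_scal_C Cmod_mult Cmod_polar; last lra.
rewrite norm_opp Rmult_1_r.
have H1 := ray_resolvent_norm r t x Ht Hr.
apply: Rle_trans (Rmult_le_compat_l _ _ _ (Cmod_ge_0 _) H1) _.
by right; field; lra.
Qed.

Lemma ray_integral_exists i t x : is_ray t -> exists l : H,
  improper_integral (ray_term i t x) l.
Proof.
move=> Ht.
have Hc : 0 < INR m - alpha by lra.
set k := 2 * M * norm x * (3 ^ (m + i) * 4).
have Hk : 0 <= k by pos.
pose g r := Rpower r (INR m - alpha - 1) * Rpower (1 + r) (- (INR m - alpha) - 1) + Rpower (1 + r) (- alpha - 1).
pose G r := / (INR m - alpha) * (Rpower r (INR m - alpha) * Rpower (1 + r) (- (INR m - alpha)))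
     - / alpha * Rpower (1 + r) (- alpha).
have D1 : forall r, 0 < r -> continuous (fun r => k * g r) r.
  move=> r Hr; apply: (ex_derive_continuous (fun r => k * g r)); rewrite /g /Rpower; auto_derive; lra.
have D2 : forall r, 0 < r -> norm (ray_term i t x r) <= k * g r.
  move=> r Hr.
  have H1 := ray_term_norm i t x r Ht Hr.
  have H2 := kernel_dominated alpha N m HN Hm i r t Hr (proj1 (is_ray_range t Ht)).
  change (norm (ray_term i t x r) <= k * g r).
  apply: Rle_trans H1 _.
  have H3 : 0 <= 2 * M * norm x by pos.
  apply: Rle_trans (Rmult_le_compat_l _ _ _ H3 H2) _.
  by right; rewrite /k /g; ring.
have D3 : forall r, 0 < r -> - (k * / alpha) <= k * G r <= k * / (INR m - alpha).
  move=> r Hr.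
  have P1 : 0 < Rpower r (INR m - alpha) * Rpower (1 + r) (- (INR m - alpha)) <= 1.
    split; first by apply: Rmult_lt_0_compat; apply: exp_pos.
    rewrite Rpower_Ropp; apply: (Rmult_le_reg_r (Rpower (1 + r) (INR m - alpha))); first exact: exp_pos.
    have Hne : Rpower (1 + r) (INR m - alpha) <> 0 by apply: Rgt_not_eq; apply: exp_pos.
    rewrite Rmult_assoc Rinv_l // Rmult_1_r Rmult_1_l.
    apply: Rle_Rpower_l; lra.
  have P2 : 0 < Rpower (1 + r) (- alpha) <= 1.
    split; first exact: exp_pos.
    apply: Rle_trans (_ : Rpower (1 + r) 0 <= 1); last by rewrite Rpower_O; lra.
    apply: Rle_Rpower; lra.
  have Q1 : 0 < / (INR m - alpha) by pos.
  have Q2 : 0 < / alpha by pos.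
  have G1 : - / alpha <= G r by rewrite /G; nra.
  have G2 : G r <= / (INR m - alpha) by rewrite /G; nra.
  have -> : - (k * / alpha) = k * - / alpha by ring.
  by split; apply: Rmult_le_compat_l.
have [l [Hl _]] := dominated_RInt_gen (V := realify H) (ray_term i t x) (fun r => k * G r) (fun r => k * g r)
    (- (k * / alpha)) (k * / (INR m - alpha))
    (fun r Hr => ray_term_continuous i t x r Ht Hr)
    (fun r Hr => is_derive_scal _ _ k _ (dominating_derive alpha m Halpha Hm r Hr))
    D1 D2 D3.
by exists l.
Qed.

(** The factor N^(-alpha) originates here: it is alpha times the integral of (N + r)^(-alpha - 1)
    over the ray. *)
Lemma ray_integral_far i t x : is_ray t -> alpha + 1 <= INR i -> exists l : H,
  improper_integral (ray_term i t x) l /\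
  norm l <= 2 * M * 3 ^ (m + i) / alpha * Rpower N (- alpha) * norm x.
Proof.
move=> Ht Hi.
set k := 2 * M * norm x * 3 ^ (m + i).
have Hk : 0 <= k by pos.
have Hd r : 0 < r -> is_derive (fun r => - (k / alpha) * Rpower (N + r) (- alpha)) r (k * Rpower (N + r) (- alpha - 1)).
  move=> Hr; have HNr : 0 < N + r by lra.
  have -> : Rpower (N + r) (- alpha - 1) = Rpower (N + r) (- alpha) * / (N + r).
    by rewrite /Rminus Rpower_plus (Rpower_Ropp _ 1) Rpower_1.
  by rewrite /Rpower; auto_derive => //; field; lra.
have D1 : forall r, 0 < r -> continuous (fun r => k * Rpower (N + r) (- alpha - 1)) r.
  move=> r Hr; apply: (ex_derive_continuous (fun r => k * Rpower (N + r) (- alpha - 1))).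
  by rewrite /Rpower; auto_derive; lra.
have D2 : forall r, 0 < r -> norm (ray_term i t x r) <= k * Rpower (N + r) (- alpha - 1).
  move=> r Hr.
  have H1 := ray_term_norm i t x r Ht Hr.
  have H2 := kernel_dominated_far alpha N m HN i r t Hi Hr (proj1 (is_ray_range t Ht)).
  change (norm (ray_term i t x r) <= k * Rpower (N + r) (- alpha - 1)).
  apply: Rle_trans H1 _.
  have H3 : 0 <= 2 * M * norm x by pos.
  apply: Rle_trans (Rmult_le_compat_l _ _ _ H3 H2) _.
  by right; rewrite /k; ring.
have D3 : forall r, 0 < r -> - (k / alpha) * Rpower N (- alpha) <= - (k / alpha) * Rpower (N + r) (- alpha) <= 0.
  move=> r Hr.
  have Hka : 0 <= k / alpha by pos.
  have P1 : 0 < Rpower (N + r) (- alpha) by pos.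
  have P2 : Rpower (N + r) (- alpha) <= Rpower N (- alpha) by apply: Rpower_neg_le; lra.
  split; nra.
have [l [Hl Hn]] := dominated_RInt_gen (V := realify H) (ray_term i t x)
    (fun r => - (k / alpha) * Rpower (N + r) (- alpha)) (fun r => k * Rpower (N + r) (- alpha - 1))
    (- (k / alpha) * Rpower N (- alpha)) 0
    (fun r Hr => ray_term_continuous i t x r Ht Hr) Hd
    D1 D2 D3.
exists l; split=> //.
apply: Rle_trans Hn _; right; rewrite /k; field; lra.
Qed.

Let K : H -> H := Rc (RtoC N).
Let B (x : H) : H := minus x (scal (RtoC N : C_AbsRing) (K x)).

(** By the resolvent identity, (z - A)^{-1} B x and z / (N + z) (z - A)^{-1} x differ by a
    holomorphic scalar times the fixed vector K x. Multiplied by dz, this error is a multiple of the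
    next kernel times dz / z, the form that Cauchy's theorem on the sector handles. *)
Lemma ray_term_shift i t x r : is_ray t -> 0 < r ->
  minus (ray_term (S i) t x r) (ray_term i t (B x) r)
  = scal ((RtoC (N / r) * kernel alpha N m (S i) r t)%C : C_AbsRing) (K x).
Proof.
move=> Ht Hr.
set z := polar r t.
have Hz : 0 < Re (- z)%C by have := ray_re r t Ht Hr; rewrite -/z; lra.
have HNre : 0 < Re (RtoC N) by [].
have [Hrange1 Hrange2] := is_ray_range t Ht.
have Hne : (RtoC N + z <> 0)%C by apply: polar_plus_nonzero.
have HL : is_linear (K := C_AbsRing) (Rc (- z)%C) := complex_resolvent_linear HTlin HT (- z)%C Hz.
have E := complex_resolvent_identity HTlin HT (- z)%C (RtoC N) x Hz HNre.
have E2 : Rc (- z)%C (B x) = plus (scal ((z / (RtoC N + z))%C : C_AbsRing) (Rc (- z)%C x))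
    (scal ((RtoC N / (RtoC N + z))%C : C_AbsRing) (K x)).
  rewrite /B (linear_minus _ HL) (linear_scal _ HL).
  have -> : Rc (- z)%C (K x) = scal ((- / (RtoC N + z))%C : C_AbsRing) (minus (K x) (Rc (- z)%C x)).
    rewrite /K /Rc E scal_assoc.
    have -> : mult ((- / (RtoC N + z))%C : C_AbsRing) ((- z - RtoC N)%C : C_AbsRing) = one.
      by rewrite /mult /one /=; field.
    by rewrite scal_one.
  move: (Rc (- z)%C x) (K x) => p q.
  lin_complex H; exact: Hne.
have Er : polar 1 t = (RtoC (/ r) * z)%C.
  by rewrite /z /polar /Cmult /RtoC /=; congr (_, _); field; lra.
have Hrne : RtoC r <> 0%C by move=> /RtoC_inj; lra.
rewrite /ray_term -/z E2 kernel_S /fraction_on_ray -/z Er.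
have -> : RtoC (/ r) = (/ RtoC r)%C.
  by rewrite /RtoC /Cinv /=; congr (_, _); field; lra.
have -> : RtoC (N / r) = (RtoC N * / RtoC r)%C.
  by rewrite /RtoC /Cinv /Cmult /=; congr (_, _); field; lra.
move: (kernel _ _ _ _ _ _) (Rc (- z)%C x) (K x) => c p q.
by lin_complex H; split.
Qed.

Lemma is_linear_real_inner_l w : is_linear (K := R_AbsRing) (U := realify H) (V := R_NormedModule)
  (fun x => real_inner x w).
Proof. exact: is_linear_rin_l real_inner_spec w. Qed.

(* Cauchy's theorem, tested against w := l1 - l2. *)
Lemma ray_shift_independent i x l1 l2 :
  improper_integral (fun r => scal ((RtoC (N / r) * kernel alpha N m i r contour_angle)%C : C_AbsRing) x) l1 ->
  improper_integral (fun r => scal ((RtoC (N / r) * kernel alpha N m i r (- contour_angle))%C : C_AbsRing) x) l2 ->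
  l1 = l2.
Proof.
move=> H1 H2.
set w := minus l1 l2.
have HB := is_linear_real_inner_l w.
pose proof (is_RInt_gen_linear _ _ _ _ _ HB H1 _ _) as I1.
pose proof (is_RInt_gen_linear _ _ _ _ _ HB H2 _ _) as I2.
(* Linearity of the inner product in its first argument leaves the scalar integrand Re (kernel N c)
   / r, with c independent of r and of the angle. *)
set c := inner x w.
have Hhol : holomorphic_on_sector (fun r t => (kernel alpha N m i r t * (RtoC N * c))%C).
  by apply: holomorphic_mult; [apply: kernel_holomorphic|apply: holomorphic_const].
have Ew r t : 0 < r -> real_inner (scal ((RtoC (N / r) * kernel alpha N m i r t)%C : C_AbsRing) x) w
    = Re (kernel alpha N m i r t * (RtoC N * c))%C / r.
  move=> Hr; rewrite /real_inner (inner_scal_l _ Hinner) -/c.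
  have Hrne : RtoC r <> 0%C by move=> /RtoC_inj; lra.
  have -> : (RtoC (N / r) * kernel alpha N m i r t * c)%C = (RtoC (/ r) * (kernel alpha N m i r t * (RtoC N * c)))%C.
    by rewrite /Rdiv RtoC_mult; ring.
  by rewrite /Cmult /RtoC /Re /=; field; lra.
have Hw : norm w ^ 2 = real_inner l1 w - real_inner l2 w.
  have := rin_norm _ real_inner_spec w.
  have := rin_minus_l real_inner_spec l1 l2 w.
  move=> E1 E2; change (norm (w : realify H) ^ 2 = real_inner l1 w - real_inner l2 w).
  by rewrite -E2 -E1.
have Hsmall eps : 0 < eps -> norm w ^ 2 <= eps.
  move=> He.
  have Hang := contour_angle_range; have Hpi := PI_RGT_0.
  have Hcc : 0 < 4 * contour_angle * (N * Cmod c + 1).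
    have := Cmod_ge_0 c => Hc0; have : 0 <= N * Cmod c by apply: Rmult_le_pos; lra.
    by move=> H0; apply: Rmult_lt_0_compat; lra.
  (* Chosen so that the arcs contribute at most eps / 2; the summand 1 covers c = 0. The two
     integrals are each approximated up to eps / 4. *)
  set e := eps / 2 / (4 * contour_angle * (N * Cmod c + 1)).
  have He1 : 0 < e by pos.
  have [d [e' [Hd [He' Hk]]]] := kernel_small alpha N m Halpha HN Hm i e He1.
  have Hq : 0 < eps / 4 by lra.
  have Hd1 : 0 < Rmin d 1 by apply: Rmin_glb_lt; lra.
  have HF : zero_to_infinity (fun ab => 0 < fst ab < Rmin d 1 /\ Rmax e' 1 < snd ab).
    by apply: (zero_to_infinity_intro (fun a b => 0 < a < Rmin d 1 /\ Rmax e' 1 < b) (Rmin d 1) (Rmax e' 1)).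
  have near l : locally (real_inner l w : R_NormedModule) (fun y => Rabs (y - real_inner l w) < eps / 4).
    by exists (mkposreal _ Hq).
  have J1 : zero_to_infinity (fun ab => exists y : R, is_RInt (V := R_NormedModule)
      (fun r => real_inner (scal ((RtoC (N / r) * kernel alpha N m i r contour_angle)%C : C_AbsRing) x) w)
      (fst ab) (snd ab) y /\ Rabs (y - real_inner l1 w) < eps / 4).
    exact: (I1 (fun y => Rabs (y - real_inner l1 w) < eps / 4) (near l1)).
  have J2 : zero_to_infinity (fun ab => exists y : R, is_RInt (V := R_NormedModule)
      (fun r => real_inner (scal ((RtoC (N / r) * kernel alpha N m i r (- contour_angle))%C : C_AbsRing) x) w)
      (fst ab) (snd ab) y /\ Rabs (y - real_inner l2 w) < eps / 4).
    exact: (I2 (fun y => Rabs (y - real_inner l2 w) < eps / 4) (near l2)).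
  have Hproper : ProperFilter zero_to_infinity by apply: filter_prod_proper.
  have [[a b] [[Hab1 Hab2] [[y1 [Y1 Z1]] [y2 [Y2 Z2]]]]] := filter_ex (F := zero_to_infinity) _
    (filter_and _ _ HF (filter_and _ _ J1 J2)).
  rewrite /= in Hab1 Hab2 Y1 Y2.
  have Ha1 : a < d by apply: Rlt_le_trans (Rmin_l d 1); lra.
  have Ha2 : a < 1 by apply: Rlt_le_trans (Rmin_r d 1); lra.
  have Hb1 : e' < b by apply: Rle_lt_trans (Rmax_l e' 1) Hab2.
  have Hb2 : 1 < b by apply: Rle_lt_trans (Rmax_r e' 1) Hab2.
  have [D HD] := Hhol.
  have Hc0 : 0 <= N * Cmod c by pos.
  have Hbound r t : 0 < r -> r < d \/ e' < r -> - contour_angle <= t <= contour_angle ->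
      Cmod (kernel alpha N m i r t * (RtoC N * c))%C <= e * (N * Cmod c).
    move=> Hr Hcase Ht.
    rewrite (Cmod_mult (kernel _ _ _ _ _ _)) (Cmod_mult (RtoC N)) Cmod_R (Rabs_pos_eq N); last lra.
    by apply: Rmult_le_compat_r => //; apply: Hk.
  have Hcau := cauchy_sector _ D a b contour_angle (e * (N * Cmod c)) ltac:(lra) ltac:(lra) HD
    (fun t Ht => conj (Hbound a t (proj1 Hab1) (or_introl Ha1) Ht)
                      (Hbound b t ltac:(lra) (or_intror Hb1) Ht)).
  have R1 : RInt (fun r => Re (kernel alpha N m i r contour_angle * (RtoC N * c))%C / r) a b = y1.
    apply: is_RInt_unique; apply: is_RInt_ext Y1 => r; rewrite Rmin_left; try lra; move=> [Hr _].
    by apply: Ew; lra.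
  have R2 : RInt (fun r => Re (kernel alpha N m i r (- contour_angle) * (RtoC N * c))%C / r) a b = y2.
    apply: is_RInt_unique; apply: is_RInt_ext Y2 => r; rewrite Rmin_left; try lra; move=> [Hr _].
    by apply: Ew; lra.
  rewrite R1 R2 in Hcau.
  have He2 : 2 * contour_angle * (2 * (e * (N * Cmod c))) <= eps / 2.
    have E : eps / 2 = e * (4 * contour_angle * (N * Cmod c + 1)) by rewrite /e; field; lra.
    rewrite E.
    have : 0 <= e * (4 * contour_angle) by apply: Rmult_le_pos; lra.
    lra.
  have B1 := Rabs_def2 _ _ Z1; have B2 := Rabs_def2 _ _ Z2.
  have B3 := Rle_abs (y1 - y2).
  rewrite Hw; lra.
have Hw0 : norm w = 0.
  have := norm_ge_0 w; case: (Req_dec (norm w) 0) => // Hne Hpos.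
  have Hp2 : 0 < norm w ^ 2 by pos.
  have := Hsmall (norm w ^ 2 / 2) ltac:(lra); lra.
have Hwz : w = zero by exact: norm_eq_zero.
have -> : l1 = plus w l2 by rewrite /w; lin_complex H.
by rewrite Hwz plus_zero_l.
Qed.

(** The regularized symbol of A^{-alpha}; on the rays it is [kernel] with i = 0. *)
Definition shifted_function (z : C) : C := (Cpow (z / (1 + z)) m * Cpower z (- alpha))%C.

Context {A : operator H}.
Hypothesis HA : neg_generates A T.

Lemma ray_integrand_eq t x r : is_ray t -> 0 < r ->
  scal ((shifted_function (polar r t) * polar 1 t)%C : C_AbsRing) (resolvent A (polar r t) x)
  = ray_term 0 t x r.
Proof.
move=> Ht Hr; have [Hr1 Hr2] := is_ray_range t Ht.
have H1 := ray_re r t Ht Hr.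
have Hz : Re (polar r t) < 0 by move: H1; rewrite /Copp /Re /=; lra.
rewrite (resolvent_eq HTlin HT HA _ _ Hz) /ray_term /kernel /shifted_function Cpower_polar //.
by rewrite /= Cmult_1_r /fraction_on_ray.
Qed.

Lemma ray_integral_eq t x l : is_ray t ->
  improper_integral (ray_term 0 t x) l ->
  ray_integral A shifted_function t x = l.
Proof.
move=> Ht Hl.
set f := fun r => scal ((shifted_function (polar r t) * polar 1 t)%C : C_AbsRing) (resolvent A (polar r t) x).
have Hf : improper_integral f l.
  apply (is_RInt_gen_ext (V := realify H) (ray_term 0 t x) f l); last exact: Hl.
  apply: (zero_to_infinity_intro (fun a b => forall r, Rmin a b < r < Rmax a b -> ray_term 0 t x r = f r) 1 1 Rlt_0_1).
  move=> a b Ha Hb r; rewrite Rmin_left; last lra.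
  move=> [Hr _]; symmetry; apply: ray_integrand_eq => //; lra.
exact: (is_RInt_gen_unique (V := realify H) f l Hf).
Qed.

Lemma contour_rays : is_ray contour_angle /\ is_ray (- contour_angle).
Proof. by split; [left|right]. Qed.

(* The jump l2 - l1 of the two ray integrals is invariant under
   (g_i, B x) -> (g_(i+1), x). *)
Lemma ray_jump_shift J x : exists l1 l2 k1 k2 : H,
  improper_integral (ray_term 0 contour_angle (Nat.iter J B x)) l1 /\
  improper_integral (ray_term 0 (- contour_angle) (Nat.iter J B x)) l2 /\
  improper_integral (ray_term J contour_angle x) k1 /\
  improper_integral (ray_term J (- contour_angle) x) k2 /\
  minus l2 l1 = minus k2 k1.
Proof.
have [R1 R2] := contour_rays.
elim: J x => [|J IH] x.
  have [l1 H1] := ray_integral_exists 0 contour_angle x R1.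
  have [l2 H2] := ray_integral_exists 0 (- contour_angle) x R2.
  by exists l1, l2, l1, l2.
have [l1 [l2 [k1 [k2 [H1 [H2 [H3 [H4 H5]]]]]]]] := IH (B x).
have [p1 P1] := ray_integral_exists (S J) contour_angle x R1.
have [p2 P2] := ray_integral_exists (S J) (- contour_angle) x R2.
exists l1, l2, p1, p2; rewrite Nat.iter_succ_r; do 4! (split=> //).
have D t p k : is_ray t ->
    improper_integral (ray_term (S J) t x) p ->
    improper_integral (ray_term J t (B x)) k ->
    improper_integral (fun r => scal ((RtoC (N / r) * kernel alpha N m (S J) r t)%C : C_AbsRing) (K x)) (minus p k).
  move=> Ht Hp Hk.
  pose proof (is_RInt_gen_minus (V := realify H) _ _ _ _ Hp Hk) as Hpk.
  apply (is_RInt_gen_ext (V := realify H) _ _ _) with (2 := Hpk).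
  apply: (zero_to_infinity_intro (fun a b => forall r, Rmin a b < r < Rmax a b -> minus (ray_term (S J) t x r) (ray_term J t (B x) r)
    = scal ((RtoC (N / r) * kernel alpha N m (S J) r t)%C : C_AbsRing) (K x)) 1 1 Rlt_0_1).
  move=> a b Ha Hb r; rewrite Rmin_left; last lra.
  by move=> [Hr _]; apply: ray_term_shift => //; lra.
have E := ray_shift_independent (S J) (K x) _ _ (D _ _ _ R1 P1 H3) (D _ _ _ R2 P2 H4).
have E' : minus p1 k1 = minus p2 k2 by exact: E.
rewrite H5.
have -> : p2 = plus (minus p2 k2) k2 by lin_complex H.
by rewrite -E'; lin_complex H.
Qed.

Lemma contour_constant_norm : Cmod (/ (2 * PI * Ci))%C <= 1 / 2.
Proof.
have Hpi := PI2_1; have Hpi0 := PI_RGT_0.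
have HCi : Cmod Ci = 1 by rewrite /Cmod /Ci /=; apply: eq_trans sqrt_1; congr sqrt; ring.
have E : Cmod (2 * PI * Ci)%C = 2 * PI.
  by rewrite !Cmod_mult HCi !Cmod_R !Rabs_pos_eq; lra.
have Hne : (2 * PI * Ci)%C <> 0%C by move=> H0; rewrite H0 Cmod_0 in E; lra.
rewrite Cmod_inv // E.
have -> : 1 / 2 = / 2 by field.
by apply: Rinv_le_contravar; lra.
Qed.

(** The jump between the rays for B^J x equals the jump for x with the kernel containing (z / (N +
    z))^J, and both of its rays are O(N^(-alpha)). The factor 1 / (2 PI) <= 1/2 compensates for
    there being two rays. *)
Lemma primary_calculus_shift_bound J x : alpha + 1 <= INR J ->
  norm (primary_calculus A shifted_function (Nat.iter J B x))
  <= 2 * M * 3 ^ (m + J) / alpha * Rpower N (- alpha) * norm x.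
Proof.
move=> HJ; have [R1 R2] := contour_rays.
have [l1 [l2 [k1 [k2 [H1 [H2 [H3 [H4 H5]]]]]]]] := ray_jump_shift J x.
rewrite /primary_calculus (ray_integral_eq _ _ _ R1 H1) (ray_integral_eq _ _ _ R2 H2) H5.
have [p1 [P1 Q1]] := ray_integral_far J contour_angle x R1 HJ.
have [p2 [P2 Q2]] := ray_integral_far J (- contour_angle) x R2 HJ.
have E1 : k1 = p1.
  by rewrite -(is_RInt_gen_unique (V := realify H) _ _ H3); exact: (is_RInt_gen_unique (V := realify H) _ _ P1).
have E2 : k2 = p2.
  by rewrite -(is_RInt_gen_unique (V := realify H) _ _ H4); exact: (is_RInt_gen_unique (V := realify H) _ _ P2).
rewrite E1 E2 norm_scal_C.
have H6 := norm_minus_le (V := realify H) p2 p1.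
have H6' : norm (minus p2 p1) <= norm p2 + norm p1 by exact: H6.
have H7 := contour_constant_norm; have H8 := Cmod_ge_0 (/ (2 * PI * Ci))%C.
have H9 := norm_ge_0 (minus p2 p1).
apply: Rle_trans (_ : 1 / 2 * (norm p2 + norm p1) <= _); last lra.
by apply: Rmult_le_compat.
Qed.

Lemma primary_calculus_commute (Q : H -> H) x : is_linear (K := C_AbsRing) Q ->
  (forall l x, 0 < Re l -> Q (Rc l x) = Rc l (Q x)) ->
  Q (primary_calculus A shifted_function x) = primary_calculus A shifted_function (Q x).
Proof.
move=> HQ Hc; have [R1 R2] := contour_rays.
have Hray t : is_ray t -> Q (ray_integral A shifted_function t x) = ray_integral A shifted_function t (Q x).
  move=> Ht; have [l Hl] := ray_integral_exists 0 t x Ht.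
  rewrite (ray_integral_eq t x l Ht Hl); symmetry; apply: ray_integral_eq => //.
  pose proof (is_RInt_gen_linear (V := realify H) (W := realify H) Q _ _ _ _ (is_linear_realify Q HQ) Hl _ _) as H1.
  apply (is_RInt_gen_ext (V := realify H) _ _ _) with (2 := H1).
  apply: (zero_to_infinity_intro (fun a b => forall r, Rmin a b < r < Rmax a b -> Q (ray_term 0 t x r) = ray_term 0 t (Q x) r) 1 1 Rlt_0_1).
  move=> a b Ha Hb r; rewrite Rmin_left; last lra.
  move=> [Hr _]; rewrite /ray_term (linear_scal _ HQ) (linear_opp _ HQ) Hc //.
  by have := ray_re r t Ht ltac:(lra); lra.
rewrite /primary_calculus (linear_scal _ HQ) (linear_minus _ HQ) !Hray //.
Qed.
End Contour.

(** * Fractional powers *)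

Lemma iter_cancel {X : Type} (B C : X -> X) n x :
  (forall x, B (C x) = x) -> Nat.iter n B (Nat.iter n C x) = x.
Proof. by move=> H; elim: n => [|n IH] //; rewrite Nat.iter_succ_r Nat.iter_succ H. Qed.

Lemma iter_norm_le {V : NormedModule R_AbsRing} (B : V -> V) K n x :
  0 <= K -> (forall x, norm (B x) <= K * norm x) -> norm (Nat.iter n B x) <= K ^ n * norm x.
Proof.
move=> HK H; elim: n => [|n IH]; first by rewrite /=; lra.
rewrite Nat.iter_succ; apply: Rle_trans (H _) _.
apply: Rle_trans (Rmult_le_compat_l _ _ _ HK IH) _; rewrite /=; lra.
Qed.

(** The binomial estimate for (1 + N B)^J, without binomial coefficients: the induction carries the
    bounds for all N^i B^i applied to the intermediate vectors, each step costing a factor 2. *)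
Lemma iter_perturbed_norm {V : NormedModule R_AbsRing} (B : V -> V) N S J z :
  is_linear B -> 0 < N ->
  (forall i, (i <= J)%nat -> N ^ i * norm (Nat.iter i B z) <= S) ->
  norm (Nat.iter J (fun u => plus u (scal N (B u))) z) <= 2 ^ J * S.
Proof.
move=> HB HN HS; set G := fun u => _.
have Hj : forall j i, (i + j <= J)%nat ->
    N ^ i * norm (Nat.iter i B (Nat.iter j G z)) <= 2 ^ j * S.
  elim=> [|j IH] i Hij; first by rewrite /= Rmult_1_l; apply: HS; lia.
  have Hi := iter_linear B i HB.
  have E : Nat.iter i B (Nat.iter (Datatypes.S j) G z) = plus (Nat.iter i B (Nat.iter j G z))
      (scal N (Nat.iter (Datatypes.S i) B (Nat.iter j G z))).
    rewrite {1}Nat.iter_succ {1}/G (linear_plus _ Hi) (linear_scal _ Hi).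
    by rewrite -Nat.iter_succ_r.
  rewrite E.
  have H1 := IH i ltac:(lia); have H2 := IH (Datatypes.S i) ltac:(lia).
  have H3 := norm_triangle (Nat.iter i B (Nat.iter j G z))
    (scal N (Nat.iter (Datatypes.S i) B (Nat.iter j G z))).
  rewrite norm_scal_R Rabs_pos_eq in H3; last lra.
  have HNi : 0 < N ^ i by pos.
  apply: Rle_trans (Rmult_le_compat_l _ _ _ (Rlt_le _ _ HNi) H3) _.
  move: H1 H2; rewrite /=; lra.
by have := Hj J 0%nat ltac:(lia); rewrite /= Rmult_1_l.
Qed.

Lemma opnorm_le {H : CompleteNormedModule C_AbsRing} (B : H -> H) c :
  0 <= c -> (forall x, norm (B x) <= c * norm x) -> Rbar_le (opnorm B) c.
Proof.
move=> Hc HB; apply: (proj2 (Lub_Rbar_correct _)) => r [x [Hx ->]] /=.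
apply: Rle_trans (HB x) _; rewrite -{2}(Rmult_1_r c); exact: Rmult_le_compat_l.
Qed.

Lemma opnorm_norm_le {H : CompleteNormedModule C_AbsRing} (B : H -> H) c x :
  (forall k y, B (scal (k : C_AbsRing) y) = scal (k : C_AbsRing) (B y)) ->
  Rbar_le (opnorm B) (Finite c) -> norm (B x) <= c * norm x.
Proof.
move=> HB Hc.
have Hunit y : norm y <= 1 -> norm (B y) <= c.
  move=> Hy.
  have := proj1 (Lub_Rbar_correct (fun r => exists x, norm x <= 1 /\ r = norm (B x))) (norm (B y))
    (ex_intro _ y (conj Hy eq_refl)).
  by move=> H1; exact: (Rbar_le_trans (Finite _) _ (Finite c) H1 Hc).
case: (Rle_lt_or_eq_dec 0 (norm x) (norm_ge_0 x)) => Hx; last first.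
  have -> : x = zero by apply: norm_eq_zero; rewrite -Hx.
  have -> : B zero = zero by rewrite -(scal_zero_l (K := C_AbsRing) zero) HB !scal_zero_l.
  by rewrite !norm_zero; lra.
have Hi : 0 < / norm x by pos.
have := Hunit (scal (RtoC (/ norm x) : C_AbsRing) x).
rewrite HB !norm_scal_C Cmod_R Rabs_pos_eq; last lra.
have -> : / norm x * norm x = 1 by field; lra.
move=> /(_ (Rle_refl 1)) H1.
have -> : norm (B x) = norm x * (/ norm x * norm (B x)) by field; lra.
rewrite (Rmult_comm c); apply: Rmult_le_compat_l; lra.
Qed.

(** * The Cayley transform and the negative fractional power *)

Section Assembly.
Context {H : CompleteNormedModule C_AbsRing} {inner : H -> H -> C}.
Hypothesis Hinner : is_inner_product inner.
Context {T : R -> H -> H} {M : R}.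
Hypothesis HTlin : forall t, 0 <= t -> is_linear (K := C_AbsRing) (T t).
Hypothesis HT : bounded_semigroup (V := realify H) T M.
Context {A : operator H}.
Hypothesis HA : neg_generates A T.
Let Rc := complex_resolvent T.
Let W := realify H.

(** The resolvent identity with l and m exchanged, divided by l - m. *)
Lemma complex_resolvent_commute l m u : 0 < Re l -> 0 < Re m ->
  Rc l (Rc m u) = Rc m (Rc l u).
Proof.
move=> Hl Hm; case: (Ceq_dec l m) => [->//|Hlm].
have Hd : (l - m)%C <> 0%C.
  move=> E; apply: Hlm.
  have -> : l = ((l - m) + m)%C by rewrite /Cminus -Cplus_assoc (Cplus_comm _ m) Cplus_opp_r Cplus_0_r.
  by rewrite E Cplus_0_l.
have H1 := complex_resolvent_identity HTlin HT l m u Hl Hm.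
have H2 := complex_resolvent_identity HTlin HT m l u Hm Hl.
have E : scal ((l - m)%C : C_AbsRing) (Rc l (Rc m u)) = scal ((l - m)%C : C_AbsRing) (Rc m (Rc l u)).
  apply: eq_trans (eq_sym H1) _.
  have -> : scal ((l - m)%C : C_AbsRing) (Rc m (Rc l u)) = opp (scal ((m - l)%C : C_AbsRing) (Rc m (Rc l u))).
    by lin_complex H.
  rewrite -H2; lin_complex H.
have Hs y : scal ((/ (l - m))%C : C_AbsRing) (scal ((l - m)%C : C_AbsRing) y) = y :> H.
  have Ec : mult ((/ (l - m))%C : C_AbsRing) ((l - m)%C : C_AbsRing) = one by exact: Cinv_l.
  by rewrite scal_assoc Ec scal_one.
by rewrite -(Hs (Rc l (Rc m u))) E Hs.
Qed.

Lemma complex_cayley_eq x : shifted_cayley (V := W) T 0 x = minus x (scal (RtoC 2 : C_AbsRing) (Rc 1%C x)).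
Proof.
by rewrite /shifted_cayley /shifted_resolvent Rplus_0_r (complex_resolvent_real HTlin HT 1 x Rlt_0_1).
Qed.

Lemma complex_cayley_linear : is_linear (K := C_AbsRing) (shifted_cayley (V := W) T 0 : H -> H).
Proof.
have HR := complex_resolvent_linear HTlin HT 1%C Rlt_0_1.
have HV := shifted_cayley_linear HT 0 ltac:(lra).
split.
- exact: linear_plus _ HV.
- move=> k x; rewrite !complex_cayley_eq.
  have -> : Rc 1%C (scal k x) = scal k (Rc 1%C x) by exact: (linear_scal _ HR).
  by lin_complex H.
- exact: linear_norm _ HV.
Qed.

Lemma complex_cayley_resolvent l x : 0 < Re l ->
  shifted_cayley (V := W) T 0 (Rc l x) = Rc l (shifted_cayley (V := W) T 0 x).
Proof.
move=> Hl; rewrite !complex_cayley_eq.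
have HR : is_linear (K := C_AbsRing) (Rc l) := complex_resolvent_linear HTlin HT l Hl.
by rewrite (linear_minus _ HR) (linear_scal _ HR) complex_resolvent_commute //=; lra.
Qed.

Context (t1 alpha : R).
Hypothesis Ht1 : 0 <= t1.
Hypothesis Hhalf : forall x, norm (T t1 (laplace (V := W) T 1 x)) <= / 2 * norm x.
Hypothesis Halpha : 0 < alpha.
Let Ai : H -> H := generator_inverse (V := W) T.
Let Vn n : H -> H := Nat.iter n (shifted_cayley (V := W) T 0).
Let m := Z.to_nat (up alpha).
Let Phi : H -> H := primary_calculus A (shifted_function alpha m).
(** 1 + A^{-1} is the inverse of the regularizer A (1 + A)^{-1}; because it is bounded and
    everywhere defined, the regularized calculus gives A^{-alpha} as a function on all of H. *)
Let E (y : H) : H := plus y (Ai y).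

Lemma up_range : alpha < INR m <= alpha + 1.
Proof.
have [H1 H2] := archimed alpha.
have Hu : (0 <= up alpha)%Z by apply: le_IZR; lra.
by rewrite /m INR_IZR_INZ Z2Nat.id //; lra.
Qed.

Lemma regularizer_inverse_r y : regularizer A (E y) = y.
Proof.
rewrite (regularizer_eq HTlin HT HA) /E.
have HR := generator_inverse_resolvent HT t1 Ht1 Hhalf 1 y Rlt_0_1.
have E1 : plus (y : W) (scal 1 (generator_inverse (V := W) T y)) = plus y (Ai y).
  by congr plus; exact: scal_one.
rewrite E1 in HR.
have -> : laplace (V := W) T 1 (plus y (Ai y)) = Ai y by symmetry; exact: HR.
by lin_complex H.
Qed.

Lemma regularizer_inverse_l y : E (regularizer A y) = y.
Proof.
rewrite (regularizer_eq HTlin HT HA) /E.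
have HL := laplace_linear HT 1 Rlt_0_1.
have HAl := generator_inverse_linear HT t1 Ht1 Hhalf.
have HR : Ai y = plus (laplace (V := W) T 1 y : H) (Ai (laplace (V := W) T 1 y)).
  have := generator_inverse_resolvent HT t1 Ht1 Hhalf 1 y Rlt_0_1.
  have -> : scal 1 (generator_inverse (V := W) T y) = generator_inverse (V := W) T y by exact: scal_one.
  by rewrite (linear_plus _ HL) (generator_inverse_laplace HT t1 Ht1 Hhalf 1 y Rlt_0_1).
have HM : Ai (minus (y : H) (laplace (V := W) T 1 y)) = minus (Ai y) (Ai (laplace (V := W) T 1 y)).
  exact: (linear_minus _ HAl).
rewrite HM HR -/W.
generalize (laplace (V := W) T 1 y : H) => r.
change (plus (minus y r) (minus (plus r (Ai r)) (Ai r)) = y :> H).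
lin_complex H.
Qed.

Lemma neg_power_eq x : neg_power A alpha x = Nat.iter m E (Phi x).
Proof.
apply: iota_unique => [y|].
- move=> Hy; have -> : Phi x = Nat.iter m (regularizer A) y by symmetry; exact: Hy.
  by rewrite iter_cancel // => z; exact: regularizer_inverse_l.
- by apply: (iter_cancel (regularizer A) E) => z; exact: regularizer_inverse_r.
Qed.

Lemma cayley_generator_inverse n x : Ai (Vn n x) = Vn n (Ai x).
Proof.
symmetry; apply: iter_commute => y; symmetry.
have HAl := generator_inverse_linear HT t1 Ht1 Hhalf.
apply: (shifted_cayley_commute (V := W) (T := T) 0 Ai ltac:(lra) HAl) => z.
symmetry; apply: (generator_inverse_laplace HT t1 Ht1 Hhalf); lra.
Qed.

Lemma cayley_power_neg_power n x :
  Vn n (neg_power A alpha x) = Nat.iter m E (Phi (Vn n x)).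
Proof.
rewrite neg_power_eq.
have HV : is_linear (K := C_AbsRing) (Vn n).
  rewrite /Vn; elim: n => [|n IH]; first exact: is_linear_id.
  exact: (is_linear_comp _ _ IH complex_cayley_linear).
have HE y : E (Vn n y) = Vn n (E y).
  by rewrite /E (linear_plus _ HV) cayley_generator_inverse.
rewrite -(iter_commute E (Vn n)) //; congr Nat.iter.
apply: (primary_calculus_commute HTlin HT alpha 1 m Halpha Rlt_0_1 up_range HA) => // l y Hl.
by apply: iter_commute => z; exact: complex_cayley_resolvent.
Qed.

(** V^n A^{-alpha} x = E^m Phi B^J (1 + N A^{-1})^J V^n x. The factor Phi B^J yields N^(-alpha), E^m
    a constant, and the J-th power is expanded into the vectors N^i A^{-i} V^n x bounded by S. *)
Lemma neg_power_bound J N S n x : alpha + 1 <= INR J -> 0 < N ->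
  (forall i, (i <= J)%nat -> N ^ i * norm (Vn n (Nat.iter i Ai x)) <= S) ->
  norm (Vn n (neg_power A alpha x)) <=
  (1 + @inverse_bound M t1) ^ m * (2 * M * 3 ^ (m + J) / alpha) * 2 ^ J * S * Rpower N (- alpha).
Proof.
move=> HJ HN HS.
set K := inverse_bound t1.
have HK : 1 <= K by exact: inverse_bound_ge_1 HT t1 Ht1.
have HAl := generator_inverse_linear HT t1 Ht1 Hhalf.
rewrite cayley_power_neg_power.
have HE y : norm (E y) <= (1 + K) * norm y.
  apply: Rle_trans (norm_triangle _ _) _.
  have := generator_inverse_norm HT t1 Ht1 Hhalf y.
  by move=> H1; rewrite Rmult_plus_distr_r Rmult_1_l; apply: Rplus_le_compat_l; exact: H1.
apply: Rle_trans (iter_norm_le (V := W) E (1 + K) m _ ltac:(lra) HE) _.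
rewrite !Rmult_assoc; apply: Rmult_le_compat_l; first pos.
pose G (u : W) : W := plus u (scal N (Ai u : W)).
pose B (u : H) : H := minus u (scal (RtoC N : C_AbsRing) (Rc (RtoC N) u)).
have HBG u : B (G u) = u.
  have HR := generator_inverse_resolvent HT t1 Ht1 Hhalf N u HN.
  rewrite /B /Rc -(complex_resolvent_real HTlin HT N _ HN).
  have -> : laplace (V := W) T N (G u) = Ai u by symmetry; exact: HR.
  change (G u) with (plus u (scal (RtoC N : C_AbsRing) (Ai u)) : H); lin_complex H.
rewrite -(iter_cancel B G J (Vn n x) HBG).
apply: Rle_trans (primary_calculus_shift_bound Hinner HTlin HT alpha N m Halpha HN up_range HA J _ HJ) _.
have HG : norm (Nat.iter J G (Vn n x)) <= 2 ^ J * S.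
  apply: (iter_perturbed_norm (V := W)) => // i Hi.
  have -> : Nat.iter i Ai (Vn n x) = Vn n (Nat.iter i Ai x).
    by apply: iter_commute => y; exact: cayley_generator_inverse.
  exact: HS.
have Mpos : 0 < M := bs_pos _ _ HT.
have HP : 0 < Rpower N (- alpha) by pos.
have Hc : 0 < 2 * M * 3 ^ (m + J) / alpha by pos.
have Hc2 : 0 <= 2 * M * 3 ^ (m + J) / alpha * Rpower N (- alpha) by pos.
apply: Rle_trans (Rmult_le_compat_l _ _ _ Hc2 HG) _.
by right; rewrite /Rdiv; ring.
Qed.
End Assembly.

(** Multiplying by N^i with N = n^r cancels the rate of the i-th estimate and leaves the logarithm;
    the finitely many i <= J then share one constant. *)
Lemma uniform_power_bound {X : Type} (F : nat -> nat -> X -> R) (nX : X -> R) (r : R) :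
  (forall x, 0 <= nX x) ->
  (forall i, exists C n0, 0 < C /\ forall n x, (n0 <= n)%nat ->
    F i n x <= C * ln (INR n) * Rpower (INR n) (- (INR i * r)) * nX x) ->
  forall J, exists C n0, 0 < C /\ forall n x i, (n0 <= n)%nat -> (i <= J)%nat ->
    Rpower (INR n) r ^ i * F i n x <= C * ln (INR n) * nX x.
Proof.
move=> HX HF.
have Hone i : exists C n0, 0 < C /\ forall n x, (n0 <= n)%nat ->
    Rpower (INR n) r ^ i * F i n x <= C * ln (INR n) * nX x.
  have [C [n0 [HC H]]] := HF i; exists C, n0; split=> // n x Hn.
  have Hp : 0 < Rpower (INR n) r by pos.
  have Hpi : 0 < Rpower (INR n) r ^ i by pos.
  apply: Rle_trans (Rmult_le_compat_l _ _ _ (Rlt_le _ _ Hpi) (H n x Hn)) _.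
  have E : Rpower (INR n) r ^ i * Rpower (INR n) (- (INR i * r)) = 1.
    rewrite -Rpower_pow // Rpower_mult -Rpower_plus.
    have -> : r * INR i + - (INR i * r) = 0 by ring.
    by rewrite /Rpower Rmult_0_l exp_0.
  right; rewrite -(Rmult_1_l (C * ln (INR n) * nX x)) -E; ring.
elim=> [|J [C [n0 [HC H]]]].
  have [C [n0 [HC H]]] := Hone 0%nat; exists C, n0; split=> // n x i Hn Hi.
  by have -> : i = 0%nat by [lia]; exact: H.
have [C' [n0' [HC' H']]] := Hone (S J).
exists (C + C'), (n0 + n0' + 3)%nat; split; first lra.
move=> n x i Hn Hi.
have Hln := ln_ge_1 n ltac:(lia).
have Hx := HX x.
have Hlx : 0 <= ln (INR n) * nX x by pos.
have H1 : 0 <= C * (ln (INR n) * nX x) by pos.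
have H2 : 0 <= C' * (ln (INR n) * nX x) by pos.
case: (Nat.eq_dec i (S J)) => [->|Hne].
- by have := H' n x ltac:(lia); lra.
- by have := H n x i ltac:(lia) ltac:(lia); lra.
Qed.

Lemma le_powerRZ_succ a k : 1 <= a -> (0 <= k)%Z -> a <= powerRZ a (k + 1).
Proof.
move=> Ha Hk; rewrite -(Z2Nat.id (k + 1)) -?pow_powerRZ; last lia.
have -> : Z.to_nat (k + 1) = S (Z.to_nat k) by [lia].
rewrite /= -{1}(Rmult_1_r a); apply: Rmult_le_compat_l; first lra.
exact: pow_R1_Rle.
Qed.

Theorem theorem3p1
  (H : CompleteNormedModule C_AbsRing)
  (inner : H -> H -> C) (Hinner : is_inner_product inner)
  (T : R -> H -> H) (A : operator H) (beta : R)
  (Hbeta : 0 < beta)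
  (HT : is_C0_semigroup T)
  (HA : neg_generates A T)
  (Hstable : polynomially_stable T A beta) :
  forall alpha : R, 0 < alpha ->
  exists (M : R) (n0 : nat), 0 < M /\
  forall n : nat, (n0 <= n)%nat ->
  Rbar_le
    (opnorm (fun x => Nat.iter n (cayley A) (neg_power A alpha x)))
    (Finite (M * (powerRZ (ln (INR n)) (Int_part (2 * alpha / (2 + beta)) + 1)
                  / Rpower (INR n) (alpha / (2 + beta))))).
Proof.
move=> alpha Halpha.
pose W := realify H.
have HTlin := C0_linear _ HT.
have [[M0 HM0] [C1 [t0 [HC1 Hdec]]]] := Hstable.
(* [M0] need not be positive, since H may be trivial. *)
pose M := Rmax M0 1.
have HM : 1 <= M by exact: Rmax_r.
have HB : bounded_semigroup (V := W) T M.
  split; first lra.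
  - by move=> t Ht; apply: is_linear_realify; exact: HTlin.
  - exact: (C0_zero _ HT).
  - exact: (C0_plus _ HT).
  - exact: (C0_cont _ HT).
  - move=> t x Ht.
    have HL := HTlin t Ht.
    have H1 := opnorm_norm_le (T t) M0 x (fun k y => linear_scal _ HL k y) (HM0 t Ht).
    apply: Rle_trans H1 _; apply: Rmult_le_compat_r; [exact: norm_ge_0|exact: Rmax_l].
pose gamma := 1 / beta.
have Hgamma : 0 < gamma by pos.
(* Passing from the operator norm to vectors uses the linearity of T(t), which is known for t >=
   0. *)
pose t0' := Rmax t0 0.
have Hdecay : forall t x, t0' <= t ->
    norm (T t (laplace (V := W) T 1 x)) <= C1 * Rpower t (- gamma) * norm (x : W).
  move=> t x Ht.
  have Ht1 : t0 <= t by apply: Rle_trans Ht; exact: Rmax_l.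
  have Ht2 : 0 <= t by apply: Rle_trans Ht; exact: Rmax_r.
  have HL := HTlin t Ht2.
  rewrite -(inv_one_plus_eq HTlin HB HA).
  apply: (opnorm_norm_le (fun x => T t (inv_one_plus A x)) _ x _ (Hdec t Ht1)) => k y.
  rewrite !(inv_one_plus_eq HTlin HB HA) !(complex_resolvent_real HTlin HB 1 _ Rlt_0_1).
  have HR := complex_resolvent_linear HTlin HB 1%C Rlt_0_1.
  have -> : complex_resolvent T 1%C (scal k y) = scal k (complex_resolvent T 1%C y).
    exact: (linear_scal _ HR).
  exact: (linear_scal _ HL).
have [t1 [Ht1 Hhalf]] := eventual_contraction (V := W) gamma C1 t0' Hgamma HC1 Hdecay.
have [C2 [HC2 Hd2]] := inverse_decay HB gamma C1 t0' Hgamma HC1 Hdecay t1 Ht1 Hhalf.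
pose Ai : W -> W := generator_inverse (V := W) T.
have Hpow := cayley_inverse_power_bound HB (real_inner_spec Hinner) Ai (@inverse_bound M t1) gamma
  (generator_inverse_linear HB t1 Ht1 Hhalf) (inverse_bound_ge_1 HB t1 Ht1)
  (generator_inverse_norm HB t1 Ht1 Hhalf) (generator_inverse_resolvent HB t1 Ht1 Hhalf)
  (generator_inverse_laplace HB t1 Ht1 Hhalf) Hgamma
  (inverse_power_decay HB t1 Ht1 Hhalf gamma C2 Hgamma HC2 Hd2).
have Hr : gamma / (1 + 2 * gamma) = 1 / (2 + beta) by rewrite /gamma; field; lra.
rewrite Hr in Hpow.
have HJ := up_range alpha Halpha.
(* [up alpha] exceeds alpha, so J >= alpha + 1, as the contour estimate requires. *)
pose J := S (Z.to_nat (up alpha)).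
have HJ' : alpha + 1 <= INR J by rewrite /J S_INR; lra.
have [C [n0 [HC Hunif]]] := uniform_power_bound
  (fun i n (x : W) => norm (Nat.iter n (shifted_cayley (V := W) T 0) (Nat.iter i Ai x)))
  (fun x => norm x) (1 / (2 + beta)) (fun x => norm_ge_0 x) Hpow J.
set c := (1 + @inverse_bound M t1) ^ Z.to_nat (up alpha) *
  (2 * M * 3 ^ (Z.to_nat (up alpha) + J) / alpha) * 2 ^ J.
have HK := inverse_bound_ge_1 HB t1 Ht1.
have Hc : 0 < c by pos.
exists (c * C), (n0 + 3)%nat; split; first pos.
move=> n Hn.
have Hln := ln_ge_1 n ltac:(lia).
set k := Int_part _.
have Hk : (0 <= k)%Z.
  have [_ Hk] := base_Int_part (2 * alpha / (2 + beta)).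
  have Hpos : 0 < 2 * alpha / (2 + beta) by pos.
  have : -1 < IZR k by rewrite /k; lra.
  by move=> /lt_IZR; lia.
(* The single logarithm of the estimate is at most (log n)^(k + 1): log n >= 1 for n >= 3, and k >=
   0. *)
have Hlnk := le_powerRZ_succ _ _ Hln Hk.
have Hp : 0 < Rpower (INR n) (alpha / (2 + beta)) by pos.
have HcC : 0 < c * C by pos.
have Hip : 0 < / Rpower (INR n) (alpha / (2 + beta)) by pos.
apply: opnorm_le.
  pos.
move=> x.
have EV y : Nat.iter n (cayley A) y = Nat.iter n (shifted_cayley (V := W) T 0) y.
  by elim: (n) => [|j IH] //; rewrite !Nat.iter_succ IH (cayley_eq HTlin HB HA).
rewrite EV.
apply: Rle_trans (neg_power_bound Hinner HTlin HB HA t1 alpha Ht1 Hhalf Halpha J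
  (Rpower (INR n) (1 / (2 + beta))) (C * ln (INR n) * norm x) n x HJ' _ _) _.
- pos.
- by move=> i Hi; apply: Hunif => //; lia.
rewrite -/c Rpower_mult.
have -> : 1 / (2 + beta) * - alpha = - (alpha / (2 + beta)) by field; lra.
rewrite Rpower_Ropp.
have -> : c * (C * ln (INR n) * norm x) * / Rpower (INR n) (alpha / (2 + beta))
  = c * C * (ln (INR n) / Rpower (INR n) (alpha / (2 + beta))) * norm x by rewrite /Rdiv; ring.
apply: Rmult_le_compat_r; first pos.
apply: Rmult_le_compat_l; first lra.
by apply: Rmult_le_compat_r; first lra.
Qed.
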